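(* Let $X:\Sigma\to\mathbb{I}^3$ be a zero mean curvature immersion with planar curvature lines. Then, up to isometries and homotheties of isotropic space, $X$ must be a piece of one, and only one, of the following surfaces, given with their Weierstrass data $(h,\eta)$: - plane: $(0,\ 1\,dz)$; - trivial Enneper-type surface: $(z,\ 1\,dz)$; - catenoid: $(e^{z},\ e^{-z}\,dz)$; - Enneper-type surface: $(\frac1z,\ z^2\,dz)$; - one of the Bonnet-type surfaces: $\left(\frac{\alpha}{\beta}\coth\frac{\alpha z}{2},\ \frac{2\beta}{\alpha^2}\sinh^2\frac{\alpha z}{2}\,dz\right)$ with real $\alpha>0$, $\beta>0$.
   Context: Isotropic space: $\mathbb{R}^{3,1}$ is Minkowski $4$-space with bilinear form $\langle\cdot,\cdot\rangle$ of signature $(-+++)$, $\mathcal{L}=\{Y:\langle Y,Y\rangle=0\}$, $\mathfrak{p}=(1,0,0,1)^t\in\mathcal{L}$, and $\mathbb{I}^3=\{Y\in\mathbb{R}^{3,1}:\langle Y,\mathfrak{p}\rangle=0\}=\{(\mathbf l,\mathbf x,\mathbf y,\mathbf l)^t\}$, with degenerate induced metric $d\mathbf x^2+d\mathbf y^2$; it is identified with coordinate space $\{(\mathbf l,\mathbf x,\mathbf y)\}$. Isometries of $\mathbb{I}^3$ are compositions of translations of $\mathbb{I}^3$ and the restrictions to $\mathbb{I}^3$ of $A\in\mathrm{SO}(3,1)$ with $A\mathfrak p=\mathfrak p$; homotheties are the maps $Y\mapsto\lambda Y$, $\lambda\in\mathbb{R}\setminus\{0\}$. Surfaces: $\Sigma$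 is a simply-connected domain and $X:\Sigma\to\mathbb{I}^3$ is a spacelike immersion (the induced metric is Riemannian), with conformal coordinates $z=u+iv$ and $ds^2=e^{2\omega}(du^2+dv^2)$. The lightlike Gauss map $n:\Sigma\to\mathcal L$ is the unique map with $\langle dX,n\rangle=0$, $\langle n,\mathfrak p\rangle=1$. Put $L=\langle X_{uu},n\rangle$, $M=\langle X_{uv},n\rangle$, $N=\langle X_{vv},n\rangle$. The mean curvature is $H=\tfrac12e^{-2\omega}(L+N)$, the second fundamental form is $L\,du^2+2M\,du\,dv+N\,dv^2$, and zero mean curvature means $H\equiv0$. Curvature lines are the lines of principal directions of the second fundamental form with respect to the induced metric. The surface has planar curvature lines if every curvature line lies in an affine plane of $\mathbb{I}^3$; (pieces of) planes are counted as having planar curvature lines. Weierstrass data: the zero mean curvature surface with data $(h,\eta)$, where $h$ is meromorphic and $\eta$ is a holomorphic $1$-form, is $X=\mathrm{Re}\int(h,1,-i)\,\eta$ in the coordinates $(\mathbf l,\mathbf x,\mathbf y)$. ''A piece of'' means: after reparametrization, $X$ is a restriction of the given surface. *)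

(* Defs.v *)
From HB Require Import structures.
From mathcomp Require Import all_boot all_order all_algebra.
From mathcomp Require Import complex.
From mathcomp Require Import all_classical all_reals all_analysis.

Set Implicit Arguments.
Unset Strict Implicit.
Unset Printing Implicit Defensive.

Import Order.TTheory GRing.Theory Num.Theory.
Import numFieldNormedType.Exports.

Local Open Scope classical_set_scope.
Local Open Scope ring_scope.

Section PlaneCalculus.
Variable R : realType.

Definition e_u : R * R := (1, 0).
Definition e_v : R * R := (0, 1).

Definition pd_u (V : normedModType R) (f : R * R -> V) : R * R -> V :=
  fun z => 'D_e_u f z.
Definition pd_v (V : normedModType R) (f : R * R -> V) : R * R -> V :=
  fun z => 'D_e_v f z.

Fixpoint Ck_on (k : nat) (V : normedModType R) (U : set (R * R))
    (f : R * R -> V) : Prop :=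
  match k with
  | 0%N => forall z, U z -> {for z, continuous f}
  | j.+1 => [/\ forall z, U z -> derivable f z e_u /\ derivable f z e_v,
                Ck_on j U (pd_u f) & Ck_on j U (pd_v f)]
  end.

(* Meant for open [U] only. *)
Definition smooth_on (V : normedModType R) (U : set (R * R))
    (f : R * R -> V) : Prop := forall k, Ck_on k U f.

Definition domain (U : set (R * R)) : Prop :=
  [/\ open U, connected U & U !=set0].

(* Every loop in [U], parametrized by [0, 1], is freely homotopic in [U] to a
   constant loop; [G (s, t)] is the point at time [t] of the loop at stage [s]. *)
Definition simply_connected (U : set (R * R)) : Prop :=
  forall c : R -> R * R,
    {within `[0, 1], continuous c} -> (forall t : R, t \in `[0, 1] -> U (c t)) ->
    c 0 = c 1 ->
  exists G : R * R -> R * R,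
    [/\ {within `[0, 1] `*` `[0, 1], continuous G},
        forall s t : R, s \in `[0, 1] -> t \in `[0, 1] -> U (G (s, t)),
        forall t : R, t \in `[0, 1] -> G (0, t) = c t,
        exists p, forall t : R, t \in `[0, 1] -> G (1, t) = p
      & forall s : R, s \in `[0, 1] -> G (s, 0) = G (s, 1)].

Definition jacobian (phi : R * R -> R * R) (z : R * R) : R :=
  (pd_u phi z).1 * (pd_v phi z).2 - (pd_v phi z).1 * (pd_u phi z).2.

End PlaneCalculus.

Section IsotropicSpace.
Variable R : realType.

(* The first coordinate is the timelike one. *)
Definition lorentz : 'M[R]_4 := diag_mx (\row_i (if i == 0 then -1 else 1)).

Definition mink (Y Z : 'cV[R]_4) : R := (Y^T *m lorentz *m Z) 0 0.

(* The point with coordinates (l, x, y) of isotropic space. *)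
Definition iso_pt (l x y : R) : 'cV[R]_4 := \col_i [:: l; x; y; l]`_i.

Definition p_vec : 'cV[R]_4 := iso_pt 1 0 0.

Definition isotropic_space : set 'cV[R]_4 := [set Y | mink Y p_vec = 0].

Definition SO31 (A : 'M[R]_4) : Prop :=
  A^T *m lorentz *m A = lorentz /\ \det A = 1.

(* Both relations are given by maps of the ambient Minkowski space, of which only
   the restriction to isotropic space (which they all preserve) matters. *)
Inductive isotropic_isometry : ('cV[R]_4 -> 'cV[R]_4) -> Prop :=
| isometry_translation b : isotropic_space b ->
    isotropic_isometry (fun Y => Y + b)
| isometry_linear A : SO31 A -> A *m p_vec = p_vec ->
    isotropic_isometry (fun Y => A *m Y)
| isometry_comp F G : isotropic_isometry F -> isotropic_isometry G ->
    isotropic_isometry (F \o G).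

Inductive isotropic_similarity : ('cV[R]_4 -> 'cV[R]_4) -> Prop :=
| similarity_isometry F : isotropic_isometry F -> isotropic_similarity F
| similarity_homothety (lambda : R) : lambda != 0 ->
    isotropic_similarity (fun Y => lambda *: Y)
| similarity_comp F G : isotropic_similarity F -> isotropic_similarity G ->
    isotropic_similarity (F \o G).

Definition affine_plane (P : set 'cV[R]_4) : Prop :=
  exists Y0 Y1 Y2 : 'cV[R]_4,
    [/\ isotropic_space Y0, isotropic_space Y1, isotropic_space Y2,
        \rank (row_mx Y1 Y2) = 2%N
      & P = [set Y | exists s t : R, Y = Y0 + s *: Y1 + t *: Y2]].

End IsotropicSpace.

Section Surfaces.
Variable R : realType.
Implicit Types (Sigma : set (R * R)) (X n : R * R -> 'cV[R]_4)
  (omega : R * R -> R) (z w : R * R).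

Definition differential X z w : 'cV[R]_4 :=
  w.1 *: pd_u X z + w.2 *: pd_v X z.

Definition first_form X z w w' : R :=
  mink (differential X z w) (differential X z w').

Definition spacelike_immersion Sigma X : Prop :=
  [/\ smooth_on Sigma X,
      forall z, Sigma z -> isotropic_space (X z)
    & forall z w, Sigma z -> w != 0 -> 0 < first_form X z w w].

Definition conformal_coordinates Sigma X omega : Prop :=
  forall z w, Sigma z ->
    first_form X z w w = expR (2 * omega z) * (w.1 ^+ 2 + w.2 ^+ 2).

Definition lightlike_gauss_map Sigma X n : Prop :=
  forall z, Sigma z ->
    [/\ mink (n z) (n z) = 0,
        forall w, mink (differential X z w) (n z) = 0
      & mink (n z) (p_vec R) = 1].

Definition coefL X n z : R := mink (pd_u (pd_u X) z) (n z).
Definition coefM X n z : R := mink (pd_v (pd_u X) z) (n z).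
Definition coefN X n z : R := mink (pd_v (pd_v X) z) (n z).

Definition mean_curvature X n omega z : R :=
  2^-1 * expR (- (2 * omega z)) * (coefL X n z + coefN X n z).

Definition zero_mean_curvature Sigma X n omega : Prop :=
  forall z, Sigma z -> mean_curvature X n omega z = 0.

Definition second_form X n z w w' : R :=
  coefL X n z * (w.1 * w'.1) + coefM X n z * (w.1 * w'.2 + w.2 * w'.1)
  + coefN X n z * (w.2 * w'.2).

(* At an umbilic every direction is principal. *)
Definition principal_direction X n z w : Prop :=
  w != 0 /\
  exists k : R, forall w', second_form X n z w w' = k * first_form X z w w'.

(* A regular C^1 curve, defined on the open interval ]a, b[. *)
Definition curvature_line Sigma X n (a b : R) (c : R -> R * R) : Prop :=
  forall t, a < t < b ->
    [/\ Sigma (c t), derivable c t 1, {for t, continuous (derive1 c)}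
      & principal_direction X n (c t) (derive1 c t)].

(* Pieces of planes satisfy this, since then every curve lies in that plane. *)
Definition planar_curvature_lines Sigma X n : Prop :=
  forall a b c, a < b -> curvature_line Sigma X n a b c ->
  exists2 P : set 'cV[R]_4, affine_plane P
    & forall t, a < t < b -> P (X (c t)).

End Surfaces.

Section ComplexFunctions.
Variable R : realType.

Definition cexp (z : R[i]) : R[i] :=
  Complex (expR (complex.Re z) * cos (complex.Im z))
          (expR (complex.Re z) * sin (complex.Im z)).
Definition csinh (z : R[i]) : R[i] := (cexp z - cexp (- z)) / 2.
Definition ccosh (z : R[i]) : R[i] := (cexp z + cexp (- z)) / 2.
Definition ccoth (z : R[i]) : R[i] := ccosh z / csinh z.

Definition to_complex (z : R * R) : R[i] := Complex z.1 z.2.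

End ComplexFunctions.

Section Weierstrass.
Variable R : realType.
Implicit Types (h f : R[i] -> R[i]) (S : R * R -> 'cV[R]_4).

(* The 1-form is eta = f dz.  The metric of Re \int (h, 1, -i) eta is |f|^2 |dz|^2,
   so the surface is regular where [f] does not vanish.  For each of the data
   below the only poles of [h] are zeros of [f]. *)
Definition regular_points f : set (R * R) :=
  [set z | f (to_complex z) != 0].

(* [S] is Re \int (h, 1, -i) f dz up to a constant of integration: as
   dz = du + i dv, its partial derivatives are Re Phi and Re (i Phi), with
   Phi = (h f, f, -i f). *)
Definition weierstrass_surface h f S : Prop :=
  forall z, regular_points f z ->
    let Phi1 := h (to_complex z) * f (to_complex z) in
    let Phi2 := f (to_complex z) in
    let i : R[i] := Complex 0 1 in
    let Phi3 := - i * f (to_complex z) in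
    [/\ isotropic_space (S z),
        is_derive z (e_u R) S
          (iso_pt (complex.Re Phi1) (complex.Re Phi2) (complex.Re Phi3))
      & is_derive z (e_v R) S
          (iso_pt (complex.Re (i * Phi1)) (complex.Re (i * Phi2))
                  (complex.Re (i * Phi3)))].

(* A reparametrization is a smooth local diffeomorphism: already for the plane,
   [X] need not be injective.  It may reverse the orientation. *)
Definition piece_up_to_similarity (Sigma : set (R * R))
    (X : R * R -> 'cV[R]_4) h f : Prop :=
  exists S F (phi : R * R -> R * R),
    [/\ weierstrass_surface h f S,
        isotropic_similarity F,
        smooth_on Sigma phi,
        forall z, Sigma z -> jacobian phi z != 0
      & forall z, Sigma z -> regular_points f (phi z) /\ X z = F (S (phi z))].

Inductive surface_type : Set :=
  | plane | trivial_enneper | catenoid | enneper | bonnet.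

Inductive weierstrass_data :
    surface_type -> (R[i] -> R[i]) -> (R[i] -> R[i]) -> Prop :=
| plane_data : weierstrass_data plane (fun=> 0) (fun=> 1)
| trivial_enneper_data : weierstrass_data trivial_enneper (fun z => z) (fun=> 1)
| catenoid_data : weierstrass_data catenoid (fun z => cexp z) (fun z => cexp (- z))
| enneper_data : weierstrass_data enneper (fun z => 1 / z) (fun z => z ^+ 2)
| bonnet_data (alpha beta : R) : 0 < alpha -> 0 < beta ->
    let a : R[i] := Complex alpha 0 in
    let b : R[i] := Complex beta 0 in
    weierstrass_data bonnet
      (fun z => a / b * ccoth (a * z / 2))
      (fun z => 2 * b / a ^+ 2 * csinh (a * z / 2) ^+ 2).

End Weierstrass.

(* Main.v *)
From HB Require Import structures.
From mathcomp Require Import all_boot all_order all_algebra.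
From mathcomp Require Import complex ring lra.
From mathcomp Require Import all_classical all_reals all_analysis.
Require Import Defs.

(** Write W = x + i y.  A conformal immersion with zero mean curvature has W' = f
    and l = Re \int h f dz with f, h holomorphic (antiholomorphic if the frame is
    negatively oriented: the imaginary unit is J = i or -i).  Isometries and
    homotheties replace f by mu f and h by (la h + ka) / mu, where |mu| = |la|.

    Differentiate with respect to W, that is, by G |-> G_z / f, and let P, P1, P2 be
    the first three derivatives of h; the second fundamental form is Re (P f^2 dz^2).
    Along a curvature line P f^2 dz^2 is real, and differentiating the equation of a
    plane containing the line three times shows that
    C = (7 P1^2 - 4 P P2) / (8 P^3) is real wherever P is not 0.  So C is a real
    constant c, and then (P1^2 - 8 c P^3)^2 = e P^7 with a constant e.  This bounds P1
    by a multiple of P, so by Gronwall P vanishes everywhere or nowhere.  The five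
    surfaces are, in this order, the cases P = 0 and, for P without zeros, c and e both
    zero, only e zero, only c zero, and neither zero; in each of them the equations
    integrate explicitly.  Simple connectedness enters
    only through the logarithm that parametrizes the catenoid.

    Similarities scale (P, P1, P2) by (la/mu^2, la/mu^3, la/mu^4), so the vanishing of
    P, P1, 7 P1^2 - 4 P P2 and 3 P1^2 - 2 P P2 at one point is an invariant, and it
    separates the five surfaces. *)

Set Implicit Arguments.
Unset Strict Implicit.
Unset Printing Implicit Defensive.

Import Order.TTheory GRing.Theory Num.Theory.
Import numFieldNormedType.Exports.

Local Open Scope classical_set_scope.
Local Open Scope ring_scope.

(** * Complex numbers and complex derivatives *)

Notation Re := complex.Re.
Notation Im := complex.Im.
Notation "x %:C" := (real_complex _ x) (format "x %:C") : ring_scope.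

Section ComplexNumbers.
Variable R : realType.
Implicit Types (x y z : R[i]) (a b : R).

(** The hypothesis on planes speaks only of curves already known to be curvature lines, so one has
    to be constructed through each point where [P] is not 0. A local root [F] of [s / P] with
    [s = 1] or [s = -1] gives the direction field [V = F / f], for which [P f^2 V^2 = s], and an
    integral curve of [V] comes from an existence theorem for differential equations. As [P F^2] is
    constant, each derivative of the equation of the plane along [V] is again a short expression in
    [F]. Eliminating the unknown plane from three of them leaves one real condition on [F] alone,
    which says that [s C] is real.

    The exponent 7 arises as follows: with [C = c], the function [D = P1^2 - 8 c P^3] has
    logarithmic derivative 7/2 times that of [P], hence [D^2 / P^7] is constant.

    The obstacle is the set of zeros of [P], the umbilics: [C] has [P] in its denominator, so [c]
    and [e] are a priori known to be constant only along paths that avoid the zeros. The relation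
    between [P1] and [P] survives because it can be written without denominators. *)

Lemma eq_ReIm x y : Re x = Re y -> Im x = Im y -> x = y.
Proof. by case: x y => [? ?] [? ?] /= -> ->. Qed.

Lemma ReD x y : Re (x + y) = Re x + Re y. Proof. by case: x y => [? ?] [? ?]. Qed.
Lemma ImD x y : Im (x + y) = Im x + Im y. Proof. by case: x y => [? ?] [? ?]. Qed.
Lemma ReN x : Re (- x) = - Re x. Proof. by case: x. Qed.
Lemma ImN x : Im (- x) = - Im x. Proof. by case: x. Qed.
Lemma ReM x y : Re (x * y) = Re x * Re y - Im x * Im y.
Proof. by case: x y => [? ?] [? ?]. Qed.
Lemma ImM x y : Im (x * y) = Re x * Im y + Im x * Re y.
Proof. by case: x y => [? ?] [? ?]. Qed.
Lemma ReV x : Re x^-1 = Re x / (Re x ^+ 2 + Im x ^+ 2). Proof. by case: x. Qed.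
Lemma ImV x : Im x^-1 = - (Im x / (Re x ^+ 2 + Im x ^+ 2)). Proof. by case: x. Qed.
Lemma Re0 : Re (0 : R[i]) = 0. Proof. by []. Qed.
Lemma Im0 : Im (0 : R[i]) = 0. Proof. by []. Qed.
Lemma Re1 : Re (1 : R[i]) = 1. Proof. by []. Qed.
Lemma Im1 : Im (1 : R[i]) = 0. Proof. by []. Qed.
Lemma ReC a : Re a%:C = a. Proof. by []. Qed.
Lemma ImC a : Im a%:C = 0. Proof. by []. Qed.
Lemma Re_mk a b : Re (Complex a b) = a. Proof. by []. Qed.
Lemma Im_mk a b : Im (Complex a b) = b. Proof. by []. Qed.
Definition ReImE := (ReD, ImD, ReN, ImN, ReM, ImM, Re0, Im0, Re1, Im1, ReC, ImC).

Definition normc2 x : R := Re x ^+ 2 + Im x ^+ 2.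

Lemma normc2_ge0 x : 0 <= normc2 x.
Proof. by rewrite addr_ge0 ?sqr_ge0. Qed.

Lemma normc2_gt0 x : (0 < normc2 x) = (x != 0).
Proof.
rewrite lt0r normc2_ge0 andbT /normc2 paddr_eq0 ?sqr_ge0 // !sqrf_eq0.
by case: x => a b; rewrite eq_complex.
Qed.

Lemma normc2M x y : normc2 (x * y) = normc2 x * normc2 y.
Proof. by rewrite /normc2 !ReImE; ring. Qed.

Lemma normc2C a : normc2 a%:C = a ^+ 2.
Proof. by rewrite /normc2 !ReImE; ring. Qed.

Lemma scaleE (a b : R) : a *: b = a * b. Proof. by []. Qed.
Lemma Re_cexp x : Re (cexp x) = expR (Re x) * cos (Im x). Proof. by []. Qed.
Lemma Im_cexp x : Im (cexp x) = expR (Re x) * sin (Im x). Proof. by []. Qed.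

Lemma cexpD x y : cexp (x + y) = cexp x * cexp y.
Proof.
by case: x y => [a b] [c d]; apply: eq_ReIm; rewrite /cexp /= expRD ?cosD ?sinD; ring.
Qed.

Lemma cexp0 : cexp (0 : R[i]) = 1.
Proof. by apply: eq_ReIm => /=; rewrite expR0 ?cos0 ?sin0; ring. Qed.

Lemma normc2_cexp x : normc2 (cexp x) = expR (Re x) ^+ 2.
Proof.
rewrite /normc2 /= !exprMn -mulrDr cos2Dsin2; ring.
Qed.

Lemma cexp_neq0 x : cexp x != 0.
Proof. by rewrite -normc2_gt0 normc2_cexp exprn_gt0 ?expR_gt0. Qed.

Lemma cexpN x : cexp (- x) = (cexp x)^-1.
Proof.
apply: (mulfI (cexp_neq0 x)); rewrite mulfV ?cexp_neq0 //.
by rewrite -cexpD subrr cexp0.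
Qed.

(* The principal branch, on the half-plane [0 < Re x] only. *)
Definition clog x : R[i] := Complex (ln (normc2 x) / 2) (atan (Im x / Re x)).

Lemma clogK x : 0 < Re x -> cexp (clog x) = x.
Proof.
move=> x0; have n0 : 0 < normc2 x.
  by rewrite ltr_pwDl ?exprn_gt0 ?sqr_ge0.
have r0 : 0 < 1 + (Im x / Re x) ^+ 2 by rewrite ltr_pwDl ?sqr_ge0.
set s := Num.sqrt (normc2 x); have s0 : 0 < s by rewrite sqrtr_gt0.
have s2 : s ^+ 2 = normc2 x by rewrite sqr_sqrtr // ltW.
have eE : expR (ln (normc2 x) / 2) = s.
  have : expR (ln (normc2 x) / 2) ^+ 2 = s ^+ 2.
    by rewrite s2 -expRM_natr divfK ?pnatr_eq0 // lnK.
  by move/eqP; rewrite eqrXn2 ?expR_ge0 // ?ltW // => /eqP.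
have cE : cos (atan (Im x / Re x)) = Re x / s.
  rewrite cos_atan -[RHS]invrK; congr (_ ^-1).
  have e0 : 0 <= (Re x / s)^-1 by rewrite invr_ge0 divr_ge0 // ltW.
  rewrite -[RHS]ger0_norm // -sqrtr_sqr; congr Num.sqrt.
  have -> : (Re x / s)^-1 ^+ 2 = s ^+ 2 / Re x ^+ 2 by field; rewrite !gt_eqF.
  rewrite s2 /normc2; field.
  by rewrite !gt_eqF.
have sE : sin (atan (Im x / Re x)) = Im x / s.
  have := atanK (Im x / Re x); rewrite /tan cE => h.
  have := congr1 (fun u => u * (Re x / s)) h => /=.
  rewrite divfK; last by rewrite mulf_neq0 ?invr_eq0 ?gt_eqF.
  by move=> ->; field; rewrite !gt_eqF.
by apply: eq_ReIm; rewrite /= eE ?cE ?sE; field; rewrite !gt_eqF.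
Qed.

End ComplexNumbers.

(** * Complex differentiability for either orientation of the plane *)

Section ComplexDerivative.
Variable R : realType.
Implicit Types (J d : R[i]) (G F : R * R -> R[i]) (z w : R * R).

Lemma is_diff_ext (V W : normedModType R) (f df dg : V -> W) (z : V) :
  is_diff z f df -> df =1 dg -> is_diff z f dg.
Proof. by move=> fz /funext <-. Qed.

(** Differentiability is derived from an estimate only here: [is_diff_near] and [C1_is_diff]
    subtract a function whose differential is known and apply this to the difference. *)
Lemma is_diff0P (V W : normedModType R) (f : V -> W) (z : V) :
  (forall e : R, 0 < e -> \forall h \near (0 : V), `|f (h + z) - f z| <= e * `|h|) ->
  is_diff z f (fun=> 0).
Proof.
move=> fz.
have [c0 o0] : continuous (\0 : V -> W) /\
    f \o shift z = cst (f z) + (\0 : {linear V -> W}) +o_ 0 id.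
  split; first exact: cst_continuous.
  apply/eqaddoP => e e0; near=> h.
  rewrite /= !fctE addr0; near: h; exact: fz.
have d0 := diff_unique c0 o0.
apply: DiffDef => //; apply/diff_locallyP; rewrite d0; split => //.
Unshelve. all: by end_near. Qed.

Lemma is_diff_near (V W : normedModType R) (f g df : V -> W) (z : V) :
  (\forall y \near z, f y = g y) -> is_diff z f df -> is_diff z g df.
Proof.
move=> fg fz.
have fg0 : \forall h \near (0 : V), f (h + z) = g (h + z).
  by move/nbhs0P : fg; apply: filterS => h /=; rewrite addrC.
have : is_diff z (fun y => f y - g y) (fun=> 0).
  apply: is_diff0P => e e0; near=> h.
  have -> : f (h + z) = g (h + z) by near: h.
  by rewrite (nbhs_singleton fg) !subrr normr0 mulr_ge0 // ltW.
move=> d; have -> : g = f - (fun y => f y - g y).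
  by apply/funext => y; rewrite !fctE subKr.
by apply: (is_diff_ext (is_diffB fz d)) => w; rewrite !fctE subr0.
Unshelve. all: by end_near. Qed.

Lemma is_diff_fst (V W : normedModType R) (z : V * W) : is_diff z fst fst.
Proof.
have c : continuous (fst : V * W -> V) by move=> x; exact: cvg_fst.
by apply: DiffDef; [exact: linear_differentiable | exact: diff_lin].
Qed.

Lemma is_diff_snd (V W : normedModType R) (z : V * W) : is_diff z snd snd.
Proof.
have c : continuous (snd : V * W -> W) by move=> x; exact: cvg_snd.
by apply: DiffDef; [exact: linear_differentiable | exact: diff_lin].
Qed.

Lemma is_diff_inv (V : normedModType R) (f df : V -> R) (z : V) :
  is_diff z f df -> f z != 0 ->
  is_diff z (fun y => (f y)^-1) (fun w : V => - (f z) ^- 2 * df w).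
Proof.
move=> fz f0; have fd : differentiable f z by [].
apply: DiffDef; first exact: differentiableV.
by rewrite diffV // diff_val.
Qed.

Lemma is_diff_comp1 (V : normedModType R) (k : R -> R) (k' : R)
    (f df : V -> R) (z : V) :
  is_diff z f df -> is_derive (f z) 1 k k' ->
  is_diff z (k \o f) (fun w : V => k' * df w).
Proof.
move=> ff kk.
have kd : differentiable k (f z) by apply/derivable1_diffP.
have kD : is_diff (f z) k (fun h => k' * h).
  have kv : derivable k (f z) 1 by [].
  apply: DiffDef => //; rewrite deriv1E //.
  by apply/funext => h; rewrite derive1E derive_val /= mulrC.
exact: is_diff_comp.
Qed.

(** The imaginary unit is a parameter, so that [i] and [-i], that is both orientations of a surface,
    share one calculus. *)
Definition jc J w : R[i] := w.1%:C + J * w.2%:C.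

(* [G] has complex derivative [d] at [z], for [u + J v] as complex coordinate. *)
Definition cdiff J G z d :=
  is_diff z (fun y => Re (G y)) (fun w => Re (d * jc J w)) /\
  is_diff z (fun y => Im (G y)) (fun w => Im (d * jc J w)).

Lemma cdiff_eq J G z d d' : cdiff J G z d -> d = d' -> cdiff J G z d'.
Proof. by move=> ? <-. Qed.

Lemma cdiff_cst J (a : R[i]) z : cdiff J (fun=> a) z 0.
Proof.
by split; apply: (is_diff_ext (is_diff_cst _ _)) => w; rewrite mul0r ?ReImE.
Qed.

Lemma cdiff_jc J z : cdiff J (jc J) z 1.
Proof.
have f := is_diff_fst z; have s := is_diff_snd z.
split.
  have -> : (fun y => Re (jc J y)) = fst + Re J *: snd.
    by apply/funext => w; rewrite ?fctE ?ReImE mulr0 subr0.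
  apply: (is_diff_ext (is_diffD f (is_diffZ _ s))) => w.
  by rewrite ?fctE ?ReImE /GRing.scale /=; ring.
have -> : (fun y => Im (jc J y)) = Im J *: snd.
  by apply/funext => w; rewrite ?fctE ?ReImE mulr0 !add0r.
apply: (is_diff_ext (is_diffZ _ s)) => w.
rewrite ?fctE ?ReImE /GRing.scale /=; ring.
Qed.

Lemma cdiffD J G F z dG dF : cdiff J G z dG -> cdiff J F z dF ->
  cdiff J (fun y => G y + F y) z (dG + dF).
Proof.
move=> [G1 G2] [F1 F2]; split.
  under eq_fun do rewrite ReD; apply: (is_diff_ext (is_diffD G1 F1)) => w.
  by rewrite mulrDl ReD.
under eq_fun do rewrite ImD; apply: (is_diff_ext (is_diffD G2 F2)) => w.
by rewrite mulrDl ImD.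
Qed.

Lemma cdiffM J G F z dG dF : cdiff J G z dG -> cdiff J F z dF ->
  cdiff J (fun y => G y * F y) z (dG * F z + G z * dF).
Proof.
move=> [G1 G2] [F1 F2]; split.
  under eq_fun do rewrite ReM; apply: (is_diff_ext (is_diffB (is_diffM G1 F1) (is_diffM G2 F2))) => w.
  by rewrite ?fctE /= ?ReImE /GRing.scale /=; ring.
under eq_fun do rewrite ImM; apply: (is_diff_ext (is_diffD (is_diffM G1 F2) (is_diffM G2 F1))) => w.
by rewrite ?fctE /= ?ReImE /GRing.scale /=; ring.
Qed.

Lemma cdiffV J G z d : G z != 0 -> cdiff J G z d ->
  cdiff J (fun y => (G y)^-1) z (- d / G z ^+ 2).
Proof.
move=> G0 [G1 G2].
have n0 : Re (G z) ^+ 2 + Im (G z) ^+ 2 != 0 by rewrite gt_eqF // normc2_gt0.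
have nd : is_diff z (fun y => Re (G y) ^+ 2 + Im (G y) ^+ 2)
    (fun w => 2 * Re (G z) * Re (d * jc J w) + 2 * Im (G z) * Im (d * jc J w)).
  apply: (is_diff_ext (is_diffD (is_diffX 1 G1) (is_diffX 1 G2))) => w.
  by rewrite !fctE /= /GRing.scale /=; ring.
have nv := is_diff_inv nd n0.
split.
  under eq_fun do rewrite ReV; apply: (is_diff_ext (is_diffM G1 nv)) => w.
  rewrite (expr2 (G z)) (invfM (G z)) ?fctE /= ?ReImE /GRing.scale /= ?ReImE ?ReV ?ImV.
  by field.
under eq_fun do rewrite ImV; apply: (is_diff_ext (is_diffN (is_diffM G2 nv))) => w.
rewrite (expr2 (G z)) (invfM (G z)) ?fctE /= ?ReImE /GRing.scale /= ?ReImE ?ReV ?ImV.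
by field.
Qed.

Lemma cdiff_cexp J G z d : cdiff J G z d ->
  cdiff J (fun y => cexp (G y)) z (d * cexp (G z)).
Proof.
move=> [G1 G2].
have e := is_diff_comp1 G1 (is_derive_expR (Re (G z))).
have c := is_diff_comp1 G2 (is_derive_cos (Im (G z))).
have s := is_diff_comp1 G2 (is_derive_sin (Im (G z))).
split; [apply: (is_diff_ext (is_diffM e c))|apply: (is_diff_ext (is_diffM e s))] => w;
  rewrite ?fctE ?scaleE ?(ReM, ImM, Re_cexp, Im_cexp); ring.
Qed.

Lemma cdiff_clog J G z d : 0 < Re (G z) -> cdiff J G z d ->
  cdiff J (fun y => clog (G y)) z (d / G z).
Proof.
move=> G0 [G1 G2].
have n0 : 0 < Re (G z) ^+ 2 + Im (G z) ^+ 2.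
  by rewrite ltr_pwDl ?sqr_ge0 ?exprn_gt0.
have nd : is_diff z (fun y => Re (G y) ^+ 2 + Im (G y) ^+ 2)
    (fun w => 2 * Re (G z) * Re (d * jc J w) + 2 * Im (G z) * Im (d * jc J w)).
  apply: (is_diff_ext (is_diffD (is_diffX 1 G1) (is_diffX 1 G2))) => w.
  by rewrite !fctE /= /GRing.scale /=; ring.
have R0 : Re (G z) != 0 by rewrite gt_eqF.
have r := is_diff_inv G1 R0.
have q : is_diff z (fun y => Im (G y) / Re (G y)) (fun w =>
   Im (d * jc J w) / Re (G z) - Im (G z) * Re (d * jc J w) / Re (G z) ^+ 2).
  apply: (is_diff_ext (is_diffM G2 r)) => w.
  by rewrite !fctE /= /GRing.scale /=; field.
have a := is_diff_comp1 q (is_derive1_atan (Im (G z) / Re (G z))).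
have l := is_diff_comp1 nd (is_derive1_ln n0).
split => /=.
  have -> : (fun y => Re (clog (G y))) = (2^-1 : R) *: (@ln R \o (fun y => Re (G y) ^+ 2 + Im (G y) ^+ 2)).
    by apply/funext => y; rewrite fctE /= mulrC.
  apply: (is_diff_ext (is_diffZ _ l)) => w.
  rewrite ?fctE /= ?ReImE /GRing.scale /= ?ReImE ?ReV ?ImV.
  by field; rewrite gt_eqF.
apply: (is_diff_ext a) => w.
rewrite ?fctE /= ?ReImE ?ReImE ?ReV ?ImV.
have : 1 + (Im (G z) / Re (G z)) ^+ 2 = (Re (G z) ^+ 2 + Im (G z) ^+ 2) / Re (G z) ^+ 2.
  by field.
move=> ->; field.
by rewrite R0 gt_eqF.
Qed.

End ComplexDerivative.

(** * Calculus in the plane *)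

Section PlaneAnalysis.
Variable R : realType.
Implicit Types (z w : R * R) (U : set (R * R)).

Lemma near_box (P : R * R -> Prop) (x y : R) : (\forall w \near (x, y), P w) ->
  exists2 d : R, 0 < d & forall a b, `|a - x| < d -> `|b - y| < d -> P (a, b).
Proof.
move=> /nbhs_ballP[d /= d0 dP]; exists d => // a b ax bY.
by apply: dP; split => /=; rewrite -ball_normE /= distrC.
Qed.

Lemma box_near (P : R * R -> Prop) (x y d : R) : 0 < d ->
  (forall a b, `|a - x| < d -> `|b - y| < d -> P (a, b)) ->
  \forall w \near (x, y), P w.
Proof.
move=> d0 dP; apply/nbhs_ballP; exists d => //= -[a b] /= [].
by rewrite -!ball_normE /= => ? ?; apply: dP; rewrite distrC.
Qed.

Lemma is_derive_u (V : normedModType R) (f : R * R -> V) x y d :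
  is_derive (x, y) (e_u R) f d <-> is_derive x 1 (fun t => f (t, y)) d.
Proof.
have E : (fun h : R => h^-1 *: ((f \o shift (x, y)) (h *: e_u R) - f (x, y))) =
         (fun h : R => h^-1 *: (((fun t => f (t, y)) \o shift x) (h *: 1) - f (x, y))).
  apply/funext => h; congr (_ *: (f _ - _)).
  by apply/pair_equal_spec; rewrite /= /GRing.scale /= mulr0 add0r.
by split=> -[]; rewrite /derivable /derive ?E => p q; apply: DeriveDef;
  rewrite /derivable /derive ?E.
Qed.

Lemma is_derive_v (V : normedModType R) (f : R * R -> V) x y d :
  is_derive (x, y) (e_v R) f d <-> is_derive y 1 (fun t => f (x, t)) d.
Proof.
have E : (fun h : R => h^-1 *: ((f \o shift (x, y)) (h *: e_v R) - f (x, y))) =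
         (fun h : R => h^-1 *: (((fun t => f (x, t)) \o shift y) (h *: 1) - f (x, y))).
  apply/funext => h; congr (_ *: (f _ - _)).
  by apply/pair_equal_spec; rewrite /= /GRing.scale /= mulr0 add0r.
by split=> -[]; rewrite /derivable /derive ?E => p q; apply: DeriveDef;
  rewrite /derivable /derive ?E.
Qed.

Lemma mvt (f df : R -> R) (a b : R) : a < b ->
  (forall t, a <= t <= b -> is_derive t 1 f (df t)) ->
  exists2 c, a < c < b & f b - f a = df c * (b - a).
Proof.
move=> ab fd.
have [||c] := @MVT R f df a b ab.
- by move=> t; rewrite in_itv /= => /andP[at_ tb]; apply: fd; rewrite !ltW.
- apply: derivable_within_continuous => t; rewrite in_itv /= => /fd fd'.
  exact: ex_derive.
by rewrite in_itv => cab E; exists c.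
Qed.

(** Serves for linear approximation, with [m] the derivative at the base point, and for Lipschitz
    bounds, with [m = 0]. The end points may come in either order. *)
Lemma mvt_le (f df : R -> R) (a b m e : R) :
  (forall t, Num.min a b <= t <= Num.max a b -> is_derive t 1 f (df t)) ->
  (forall t, Num.min a b <= t <= Num.max a b -> `|df t - m| <= e) ->
  `|f b - f a - m * (b - a)| <= e * `|b - a|.
Proof.
move=> fd dm.
have [ab|ba|->] := ltgtP a b; last by rewrite !subrr mulr0 subr0 normr0 mulr0.
  move: fd dm; rewrite (min_l (ltW ab)) (max_r (ltW ab)) => fd dm.
  have [c /andP[ac cb] ->] := mvt ab fd.
  by rewrite -mulrBl normrM; apply: ler_wpM2r => //; apply: dm; rewrite !ltW.
move: fd dm; rewrite (min_r (ltW ba)) (max_l (ltW ba)) => fd dm.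
have [c /andP[ac cb] E] := mvt ba fd.
have -> : f b - f a = df c * (b - a) by rewrite -opprB E; ring.
by rewrite -mulrBl normrM; apply: ler_wpM2r => //; apply: dm; rewrite !ltW.
Qed.

Lemma minmax_dist (a b t : R) : Num.min a b <= t <= Num.max a b ->
  `|t - a| <= `|b - a|.
Proof.
have [ab|ba] := leP a b.
  by move=> /andP[h1 h2]; rewrite !ger0_norm ?subr_ge0 // lerD2r.
move=> /andP[h1 h2]; rewrite !ler0_norm ?subr_le0 ?(ltW ba) //; lra.
Qed.

(** The increment is split into a horizontal and a vertical leg; the mean value inequality on each
    leg compares it with the value of the partial derivative at the base point. *)
Lemma C1_is_diff (f a b : R * R -> R) z :
  (\forall y \near z, is_derive y (e_u R) f (a y)) ->
  (\forall y \near z, is_derive y (e_v R) f (b y)) ->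
  {for z, continuous a} -> {for z, continuous b} ->
  is_diff z f (fun w => w.1 * a z + w.2 * b z).
Proof.
case: z => x y fa fb ca cb.
pose l := a (x, y) *: (fst : R * R -> R) + b (x, y) *: (snd : R * R -> R).
have dl (w : R * R) : is_diff w l l.
  by apply: is_diffD; apply: is_diffZ; [exact: is_diff_fst|exact: is_diff_snd].
have lE (w : R * R) : l w = w.1 * a (x, y) + w.2 * b (x, y).
  by rewrite /l !fctE /GRing.scale /=; ring.
suff h : is_diff (x, y) (f - l) (fun=> 0).
  have -> : f = (f - l) + l by rewrite subrK.
  by apply: (is_diff_ext (is_diffD h (dl _))) => w; rewrite !fctE add0r lE.
apply: is_diff0P => e e0.
have e2 : 0 < e / 2 by rewrite divr_gt0.
have na : \forall w \near (x, y), `|a w - a (x, y)| < e / 2.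
  by move/cvgrPdist_lt : ca => /(_ _ e2); apply: filterS => w; rewrite distrC.
have nb : \forall w \near (x, y), `|b w - b (x, y)| < e / 2.
  by move/cvgrPdist_lt : cb => /(_ _ e2); apply: filterS => w; rewrite distrC.
have [d d0 dP] := near_box (filterI (filterI fa fb) (filterI na nb)).
apply: (box_near d0) => h k; rewrite !subr0 => hd kd.
have Ev := @mvt_le (fun t => f (h + x, t)) (fun t => b (h + x, t)) y (k + y)
  (b (x, y)) (e / 2).
have Eu := @mvt_le (fun t => f (t, y)) (fun t => a (t, y)) x (h + x)
  (a (x, y)) (e / 2).
have hx : `|h + x - x| < d by rewrite addrK.
have y0 : `|y - y| < d by rewrite subrr normr0.
have {}Ev : `|f (h + x, k + y) - f (h + x, y) - b (x, y) * k| <= e / 2 * `|k|.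
  rewrite -{2 3}(addrK y k); apply: Ev => t /minmax_dist; rewrite addrK => tk;
    have [[_ fb'] [_ nb']] := dP _ _ hx (le_lt_trans tk kd).
    exact/is_derive_v.
  exact: ltW.
have {}Eu : `|f (h + x, y) - f (x, y) - a (x, y) * h| <= e / 2 * `|h|.
  rewrite -{2 3}(addrK x h); apply: Eu => t /minmax_dist; rewrite addrK => tk;
    have [[fa' _] [na' _]] := dP _ _ (le_lt_trans tk hd) y0.
    exact/is_derive_u.
  exact: ltW.
rewrite !fctE !lE /=.
have -> : f (h + x, k + y) - ((h + x) * a (x, y) + (k + y) * b (x, y)) -
    (f (x, y) - (x * a (x, y) + y * b (x, y))) =
  (f (h + x, k + y) - f (h + x, y) - b (x, y) * k) +
  (f (h + x, y) - f (x, y) - a (x, y) * h) by ring.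
apply: (le_trans (ler_normD _ _)); apply: (le_trans (lerD Ev Eu)).
have h1 : `|h| <= `|(h, k)| by rewrite prod_normE le_max lexx.
have h2 : `|k| <= `|(h, k)| by rewrite prod_normE le_max lexx orbT.
rewrite [leRHS](_ : _ = e / 2 * `|(h, k)| + e / 2 * `|(h, k)|); last by field.
by apply: lerD; apply: ler_wpM2l => //; exact: ltW.
Qed.

(** The second difference of [f] over a small square, divided by the area, is a value of [fuv] and
    also a value of [fvu], by two mean value theorems taken in either order. Continuity at the
    corner does the rest. *)
Lemma schwarz (f fu fv fuv fvu : R * R -> R) z :
  (\forall y \near z, [/\ is_derive y (e_u R) f (fu y),
    is_derive y (e_v R) f (fv y), is_derive y (e_v R) fu (fuv y)
    & is_derive y (e_u R) fv (fvu y)]) ->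
  {for z, continuous fuv} -> {for z, continuous fvu} -> fuv z = fvu z.
Proof.
case: z => x y fd c1 c2.
suff close e : 0 < e -> `|fuv (x, y) - fvu (x, y)| < e + e.
  apply/eqP; rewrite -subr_eq0 -normr_le0 leNgt; apply/negP => p.
  have := close (`|fuv (x, y) - fvu (x, y)| / 2); rewrite divr_gt0 // -splitr.
  by rewrite ltxx => /(_ isT).
move=> e0.
have n1 : \forall w \near (x, y), `|fuv (x, y) - fuv w| < e.
  by move/cvgrPdist_lt : c1 => /(_ _ e0).
have n2 : \forall w \near (x, y), `|fvu w - fvu (x, y)| < e.
  by move/cvgrPdist_lt : c2 => /(_ _ e0); apply: filterS => w; rewrite distrC.
have [d d0 dP] := near_box (filterI fd (filterI n1 n2)).
pose s := d / 2; have s0 : 0 < s by rewrite divr_gt0.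
have sd : s < d by rewrite /s; lra.
have nr (c t : R) : c <= t <= c + s -> `|t - c| < d.
  by move=> /andP[? ?]; rewrite ger0_norm ?subr_ge0 //; lra.
have cc (c : R) : c < c + s by lra.
have xx : x <= x <= x + s by rewrite lexx ltW.
have xs : x <= x + s <= x + s by rewrite lexx ltW.
have yy : y <= y <= y + s by rewrite lexx ltW.
have ys : y <= y + s <= y + s by rewrite lexx ltW.
have D a b (ax : x <= a <= x + s) (yb : y <= b <= y + s) := (dP a b (nr _ _ ax) (nr _ _ yb)).1.
have d1 t : x <= t <= x + s ->
    is_derive t 1 (fun t => f (t, y + s) - f (t, y)) (fu (t, y + s) - fu (t, y)).
  move=> tP; have [/is_derive_u h1 _ _ _] := D _ _ tP ys.
  by have [/is_derive_u h2 _ _ _] := D _ _ tP yy; exact: is_deriveB.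
have [xi xiP E1] := mvt (cc x) d1.
have xiP' : x <= xi <= x + s by case/andP: xiP => *; rewrite !ltW.
have d2 t : y <= t <= y + s -> is_derive t 1 (fun t => fu (xi, t)) (fuv (xi, t)).
  by move=> tP; have [_ _ /is_derive_v h1 _] := D _ _ xiP' tP.
have [eta etaP F1] := mvt (cc y) d2.
have d3 t : y <= t <= y + s ->
    is_derive t 1 (fun t => f (x + s, t) - f (x, t)) (fv (x + s, t) - fv (x, t)).
  move=> tP; have [_ /is_derive_v h1 _ _] := D _ _ xs tP.
  by have [_ /is_derive_v h2 _ _] := D _ _ xx tP; exact: is_deriveB.
have [et2 et2P E2] := mvt (cc y) d3.
have et2P' : y <= et2 <= y + s by case/andP: et2P => *; rewrite !ltW.
have d4 t : x <= t <= x + s -> is_derive t 1 (fun t => fv (t, et2)) (fvu (t, et2)).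
  by move=> tP; have [_ _ _ /is_derive_u h1] := D _ _ tP et2P'.
have [x2 x2P F2] := mvt (cc x) d4.
have E : fuv (xi, eta) = fvu (x2, et2).
  have ss : s * s != 0 by rewrite mulf_neq0 // gt_eqF.
  apply: (mulIf ss).
  have -> : fuv (xi, eta) * (s * s) = fuv (xi, eta) * (y + s - y) * (x + s - x) by ring.
  have -> : fvu (x2, et2) * (s * s) = fvu (x2, et2) * (x + s - x) * (y + s - y) by ring.
  by rewrite -F1 -F2 -E1 -E2; ring.
have etaP' : y <= eta <= y + s by case/andP: etaP => *; rewrite !ltW.
have x2P' : x <= x2 <= x + s by case/andP: x2P => *; rewrite !ltW.
have [_ [m1 _]] := dP _ _ (nr _ _ xiP') (nr _ _ etaP').
have [_ [_ m2]] := dP _ _ (nr _ _ x2P') (nr _ _ et2P').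
rewrite -(subrK (fuv (xi, eta)) (fuv (x, y))) -addrA.
by apply: (le_lt_trans (ler_normD _ _)); rewrite ltrD // E.
Qed.

(** A property that is locally constant on [U] cuts out a subset that is both open and closed in
    [U]. *)
Lemma connected_near U (A : R * R -> Prop) z0 z : open U -> connected U ->
  (forall z, U z -> \forall w \near z, A w <-> A z) ->
  U z0 -> A z0 -> U z -> A z.
Proof.
move=> oU cU nA U0 A0 Uz.
suff E : U `&` A = U by move: Uz; rewrite -E => -[].
apply: cU; first by exists z0.
  exists (U `&` A); last by rewrite setIA setIid.
  rewrite openE => w [Uw Aw]; rewrite /interior.
  near=> t; split; near: t; first exact: open_nbhs_nbhs.
  by apply: filterS (nA _ Uw) => t [_]; exact.
exists (~` (U `&` ~` A)).
  rewrite closedC openE => w [Uw Aw]; rewrite /interior.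
  near=> t; split; near: t; first exact: open_nbhs_nbhs.
  by apply: filterS (nA _ Uw) => t [h _] /h.
apply/seteqP; split=> w [Uw Aw]; split=> //; first by case.
by apply: contrapT => nw; apply: Aw.
Unshelve. all: by end_near. Qed.

End PlaneAnalysis.

(** * Holomorphic functions *)

Section Holomorphic.
Variable R : realType.
Implicit Types (z w : R * R) (U : set (R * R)) (J d : R[i]) (G F : R * R -> R[i]).

Lemma is_diff_curve (V : normedModType R) (f df : R * R -> V) (c1 c2 : R -> R) (t d1 d2 : R) :
  is_derive t 1 c1 d1 -> is_derive t 1 c2 d2 -> is_diff (c1 t, c2 t) f df ->
  is_derive t 1 (fun s => f (c1 s, c2 s)) (df (d1, d2)).
Proof.
move=> h1 h2 hf.
have k1 : is_diff t c1 (fun h : R => h * d1).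
  have e1 : derivable c1 t 1 by [].
  apply: DiffDef; first exact/derivable1_diffP.
  by rewrite deriv1E //; apply/funext => h; rewrite derive1E derive_val.
have k2 : is_diff t c2 (fun h : R => h * d2).
  have e1 : derivable c2 t 1 by [].
  apply: DiffDef; first exact/derivable1_diffP.
  by rewrite deriv1E //; apply/funext => h; rewrite derive1E derive_val.
have k := is_diff_pair k1 k2.
have kf : is_diff ((fun y => (c1 y, c2 y)) t) f df by [].
have [hd hE] := is_diff_comp k kf.
apply: DeriveDef; first exact: diff_derivable.
by rewrite deriveE // hE /= !mul1r.
Qed.

Lemma is_diff_derive (V W : normedModType R) (f df : V -> W) (x v : V) :
  is_diff x f df -> is_derive x v f (df v).
Proof.
move=> [fd fE]; apply: DeriveDef; first exact: diff_derivable.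
by rewrite deriveE // fE.
Qed.

Lemma cont_ext (T V : topologicalType) (f g : T -> V) (x : T) :
  g =1 f -> {for x, continuous f} -> {for x, continuous g}.
Proof. by move=> /funext ->. Qed.

(* Componentwise, so that only real-valued functions are involved. *)
Definition ccont (T : topologicalType) (g : T -> R[i]) (x : T) :=
  {for x, continuous (fun y => Re (g y))} /\ {for x, continuous (fun y => Im (g y))}.

Lemma ccont_cst (T : topologicalType) (a : R[i]) (x : T) : ccont (fun=> a) x.
Proof. by split; exact: cst_continuous. Qed.

Lemma ccontD (T : topologicalType) (g f : T -> R[i]) x :
  ccont g x -> ccont f x -> ccont (fun y => g y + f y) x.
Proof.
move=> [a b] [c d]; split.
  by apply: (cont_ext _ (continuousD a c)) => y; rewrite ReD.
by apply: (cont_ext _ (continuousD b d)) => y; rewrite ImD.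
Qed.

Lemma ccontM (T : topologicalType) (g f : T -> R[i]) x :
  ccont g x -> ccont f x -> ccont (fun y => g y * f y) x.
Proof.
move=> [a b] [c d]; split.
  by apply: (cont_ext _ (continuousB (continuousM a c) (continuousM b d))) => y; rewrite ReM.
by apply: (cont_ext _ (continuousD (continuousM a d) (continuousM b c))) => y; rewrite ImM.
Qed.

Lemma ccontV (T : topologicalType) (g : T -> R[i]) x :
  g x != 0 -> ccont g x -> ccont (fun y => (g y)^-1) x.
Proof.
move=> G0 [a b].
have n0 : Re (g x) ^+ 2 + Im (g x) ^+ 2 != 0 by rewrite gt_eqF // normc2_gt0 G0.
have cn : {for x, continuous (fun y => (Re (g y) ^+ 2 + Im (g y) ^+ 2)^-1)}.
  apply: continuousV => //.
  exact: (continuousD (continuousM a a) (continuousM b b)).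
split; first by apply: (cont_ext _ (continuousM a cn)) => y; rewrite ReV.
by apply: (cont_ext _ (continuousN (continuousM b cn))) => y; rewrite ImV.
Qed.

Lemma cdiff_ccont J G z d : cdiff J G z d -> ccont G z.
Proof.
move=> [[h1 _] [h2 _]].
split; [exact: (differentiable_continuous h1)|exact: (differentiable_continuous h2)].
Qed.

Lemma cdiff_near J G F z d : (\forall y \near z, G y = F y) ->
  cdiff J G z d -> cdiff J F z d.
Proof.
by move=> E [h1 h2]; split; [apply: is_diff_near h1|apply: is_diff_near h2];
  apply: filterS E => y ->.
Qed.

Lemma jcu J : jc J (e_u R) = 1.
Proof. by rewrite /jc /= mulr0 addr0. Qed.

Lemma jcv J : jc J (e_v R) = J.
Proof. by rewrite /jc /= mulr1 add0r. Qed.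

Lemma cdiff_u J G z d : cdiff J G z d ->
  is_derive z (e_u R) (fun y => Re (G y)) (Re d) /\
  is_derive z (e_u R) (fun y => Im (G y)) (Im d).
Proof.
case=> /(is_diff_derive (e_u R)) + /(is_diff_derive (e_u R)).
by rewrite jcu mulr1.
Qed.

Lemma cdiff_v J G z d : cdiff J G z d ->
  is_derive z (e_v R) (fun y => Re (G y)) (Re (J * d)) /\
  is_derive z (e_v R) (fun y => Im (G y)) (Im (J * d)).
Proof.
case=> /(is_diff_derive (e_v R)) + /(is_diff_derive (e_v R)).
by rewrite jcv mulrC.
Qed.

Lemma cdiff_uniq J G z d d' : cdiff J G z d -> cdiff J G z d' -> d = d'.
Proof.
move=> /cdiff_u[h1 h2] /cdiff_u[k1 k2].
by apply: eq_ReIm; [rewrite -(@derive_val _ _ _ _ _ _ _ h1)|rewrite -(@derive_val _ _ _ _ _ _ _ h2)];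
  rewrite derive_val.
Qed.

Lemma cdiff_curve J G (c1 c2 : R -> R) (t d1 d2 : R) d :
  is_derive t 1 c1 d1 -> is_derive t 1 c2 d2 -> cdiff J G (c1 t, c2 t) d ->
  is_derive t 1 (fun s => Re (G (c1 s, c2 s))) (Re (d * jc J (d1, d2))) /\
  is_derive t 1 (fun s => Im (G (c1 s, c2 s))) (Im (d * jc J (d1, d2))).
Proof.
move=> h1 h2 [g1 g2].
by split; [exact: (is_diff_curve h1 h2 g1)|exact: (is_diff_curve h1 h2 g2)].
Qed.

Lemma segment_derive (a b t : R) : is_derive t 1 (fun s => a + s * b) b.
Proof.
have h := is_deriveD (is_derive_cst a t 1) (is_deriveM (is_derive_id t 1) (is_derive_cst b t 1)).
apply: (is_derive_eq h).
by rewrite /GRing.scale /= mulr0 !add0r mulr1.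
Qed.

Lemma diff0_near (f : R * R -> R) z : (\forall y \near z, is_diff y f (fun=> 0)) ->
  \forall y \near z, f y = f z.
Proof.
case: z => x y /near_box[e e0 eP]; apply: (box_near e0) => a b ax bY.
have sm (h t : R) : 0 <= t <= 1 -> `|h| < e -> `|t * h| < e.
  move=> /andP[t0 t1] he; rewrite normrM ger0_norm //.
  by apply: le_lt_trans he; rewrite ler_piMl.
have [t|c _] := mvt (@ltr01 R) (f := fun s => f (x + s * (a - x), y + s * (b - y)))
    (df := fun=> 0).
  move=> tP.
  apply: (is_diff_curve (segment_derive _ _ _) (segment_derive _ _ _)
    (df := fun=> 0)).
  by apply: eP; rewrite addrC addKr; exact: sm.
rewrite mul0r !mul0r !mul1r !addr0 ![_ + (_ - _)]addrC !subrK.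
by move/eqP; rewrite subr_eq0 => /eqP.
Qed.

Lemma cdiff0_const J U G : open U -> connected U ->
  (forall z, U z -> cdiff J G z 0) -> forall z w, U z -> U w -> G z = G w.
Proof.
move=> oU cU G0 z w Uz Uw.
suff h y : U y -> \forall x \near y, G x = G y.
  apply/esym.
  apply: (@connected_near _ U (fun y => G y = G z) z w) => // y Uy.
  by apply: filterS (h _ Uy) => x ->.
move=> Uy; have nU : \forall x \near y, U x by exact: open_nbhs_nbhs.
near=> x; apply: eq_ReIm; near: x.
  apply: (@diff0_near (fun x => Re (G x))); apply: filterS nU => x /G0[h _].
  by apply: (is_diff_ext h) => v; rewrite mul0r.
apply: (@diff0_near (fun x => Im (G x))); apply: filterS nU => x /G0[_ h].
by apply: (is_diff_ext h) => v; rewrite mul0r.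
Unshelve. all: by end_near. Qed.

(** Complex derivatives are counted order by order: no power series is ever used, since every order
    comes from the smoothness of the immersion through the Cauchy-Riemann equations. *)
Fixpoint hol J U (k : nat) G : Prop :=
  match k with
  | 0%N => forall z, U z -> ccont G z
  | j.+1 => exists2 G1, forall z, U z -> cdiff J G z (G1 z) & hol J U j G1
  end.

Lemma holW J U k G : hol J U k.+1 G -> hol J U k G.
Proof.
elim: k G => [|k IH] G /= [G1 h1 h2]; first by move=> z /h1 /cdiff_ccont.
by exists G1 => //; exact: IH.
Qed.

Lemma hol_ext J U k G F : open U -> (forall z, U z -> G z = F z) ->
  hol J U k G -> hol J U k F.
Proof.
move=> oU E.
have nE z : U z -> \forall y \near z, G y = F y.
  move=> Uz; have : \forall y \near z, U y by exact: open_nbhs_nbhs.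
  by apply: filterS => y /E.
case: k => [h z Uz|k [G1 h1 h2]].
  have [c1 c2] := h z Uz; split.
    rewrite /prop_for /continuous_at /= -(E _ Uz); apply: cvg_trans c1; apply: near_eq_cvg.
    by apply: filterS (nE _ Uz) => y ->.
  rewrite /prop_for /continuous_at /= -(E _ Uz); apply: cvg_trans c2; apply: near_eq_cvg.
  by apply: filterS (nE _ Uz) => y ->.
by exists G1 => // z Uz; apply: cdiff_near (nE _ Uz) (h1 _ Uz).
Qed.

Lemma hol_cst J U k (a : R[i]) : hol J U k (fun=> a).
Proof.
elim: k a => [|k IH] a /=; first by move=> z _; apply: cdiff_ccont (cdiff_cst (0 : R[i]) _ _).
by exists (fun=> 0) => // z _; exact: cdiff_cst.
Qed.

Lemma holD J U k G F : hol J U k G -> hol J U k F -> hol J U k (fun z => G z + F z).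
Proof.
elim: k G F => [|k IH] G F /=.
  by move=> h1 h2 z Uz; exact: ccontD (h1 z Uz) (h2 z Uz).
move=> [G1 g1 g2] [F1 f1 f2]; exists (fun z => G1 z + F1 z); last exact: IH.
by move=> z Uz; apply: cdiffD; [exact: g1|exact: f1].
Qed.

Lemma holM J U k G F : hol J U k G -> hol J U k F -> hol J U k (fun z => G z * F z).
Proof.
elim: k G F => [|k IH] G F.
  by move=> h1 h2 z Uz; exact: ccontM (h1 z Uz) (h2 z Uz).
move=> hG hF; have [G1 g1 g2] := hG; have [F1 f1 f2] := hF.
exists (fun z => G1 z * F z + G z * F1 z).
  by move=> z Uz; apply: cdiffM; [exact: g1|exact: f1].
by apply: holD; apply: IH => //; exact: holW.
Qed.

Lemma holN J U k G : hol J U k G -> hol J U k (fun z => - G z).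
Proof.
move=> h; have : hol J U k (fun z => -1 * G z) by apply: holM => //; exact: hol_cst.
by under eq_fun do rewrite mulN1r.
Qed.

Lemma holV J U k G : (forall z, U z -> G z != 0) -> hol J U k G ->
  hol J U k (fun z => (G z)^-1).
Proof.
move=> G0; elim: k G G0 => [|k IH] G G0.
  by move=> h z Uz; exact: ccontV (G0 _ Uz) (h z Uz).
move=> hG; have [G1 g1 g2] := hG.
have hV := IH _ G0 (holW hG).
exists (fun z => - G1 z * ((G z)^-1 * (G z)^-1)).
  move=> z Uz; apply: (cdiff_eq (cdiffV (G0 _ Uz) (g1 _ Uz))).
  by rewrite expr2 invfM.
by apply: holM; [exact: holN|exact: holM].
Qed.

Lemma hol_deriv J U k G G1 : open U -> hol J U k.+1 G ->
  (forall z, U z -> cdiff J G z (G1 z)) -> hol J U k G1.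
Proof.
move=> oU [G2 h1 h2] h; apply: hol_ext h2 => // z Uz.
exact: cdiff_uniq (h1 _ Uz) (h _ Uz).
Qed.

(** * Smooth functions and the Cauchy-Riemann equations *)

Lemma Ck_on_ext (V : normedModType R) k U (f g : R * R -> V) : open U ->
  (forall z, U z -> f z = g z) -> Ck_on k U f -> Ck_on k U g.
Proof.
move=> oU.
have nE (f' g' : R * R -> V) : (forall z, U z -> f' z = g' z) ->
    forall z, U z -> \forall y \near z, f' y = g' y.
  move=> E z Uz; have : \forall y \near z, U y by exact: open_nbhs_nbhs.
  by apply: filterS => y /E.
elim: k f g => [|k IH] f g E /=.
  move=> h z Uz; rewrite /prop_for /continuous_at /= -(E _ Uz); apply: cvg_trans (h _ Uz).
  by apply: near_eq_cvg; apply: filterS (nE _ _ E _ Uz) => y ->.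
move=> [h1 h2 h3]; split.
- by move=> z Uz; have [a b] := h1 _ Uz; split; [apply: near_eq_derivable a|apply: near_eq_derivable b];
    exact: nE.
- apply: IH h2 => z Uz; apply: near_eq_derive; exact: nE.
- apply: IH h3 => z Uz; apply: near_eq_derive; exact: nE.
Qed.

Definition to_pair (c : R[i]) : R * R := (Re c, Im c).

Lemma pair_is_derive (V W1 W2 : normedModType R) (f : V -> W1) (g : V -> W2) (z v : V) (d1 : W1) (d2 : W2) :
  is_derive z v f d1 -> is_derive z v g d2 ->
  is_derive z v (fun y => (f y, g y)) (d1, d2).
Proof.
move=> [f1 f2] [g1 g2].
have a : (h^-1 *: ((f \o shift z) (h *: v) - f z)) @[h --> (0 : R)^'] --> d1.
  by rewrite -f2; case/cvg_ex: f1 => l fl; rewrite /derive (cvg_lim _ fl).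
have b : (h^-1 *: ((g \o shift z) (h *: v) - g z)) @[h --> (0 : R)^'] --> d2.
  by rewrite -g2; case/cvg_ex: g1 => l gl; rewrite /derive (cvg_lim _ gl).
have h : (h^-1 *: (((fun y => (f y, g y)) \o shift z) (h *: v) - (f z, g z)))
   @[h --> (0 : R)^'] --> (d1, d2) by exact: (cvg_pair a b).
by apply: DeriveDef; [apply/cvg_ex; exists (d1, d2)|exact: (cvg_lim (@norm_hausdorff _ _) h)].
Qed.

(** Needed for the smoothness of reparametrizations. The [v]-derivative is [J] times the
    [u]-derivative, so the induction stays among complex differentiable functions. *)
Lemma hol_Ck J U k G : open U -> hol J U k G ->
  Ck_on k U (fun z => to_pair (G z)).
Proof.
move=> oU; elim: k G => [|k IH] G.
  by move=> h z Uz; have [a b] := h z Uz; exact: (cvg_pair a b).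
move=> hG; have [G1 g1 g2] := hG.
have du z : U z -> is_derive z (e_u R) (fun z => to_pair (G z)) (to_pair (G1 z)).
  by move=> Uz; have [a b] := cdiff_u (g1 _ Uz); exact: pair_is_derive.
have dv z : U z -> is_derive z (e_v R) (fun z => to_pair (G z)) (to_pair (J * G1 z)).
  by move=> Uz; have [a b] := cdiff_v (g1 _ Uz); exact: pair_is_derive.
split.
- by move=> z Uz; have a := du _ Uz; have b := dv _ Uz; split.
- apply: (Ck_on_ext oU _ (IH _ g2)) => z Uz; have a := du _ Uz.
  by rewrite /pd_u derive_val.
- have hJ : hol J U k (fun z => J * G1 z) by apply: holM => //; exact: hol_cst.
  apply: (Ck_on_ext oU _ (IH _ hJ)) => z Uz; have a := dv _ Uz.
  by rewrite /pd_v derive_val.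
Qed.

Lemma Ck_derive (V : normedModType R) k U (f : R * R -> V) z : Ck_on k.+1 U f -> U z ->
  is_derive z (e_u R) f (pd_u f z) /\ is_derive z (e_v R) f (pd_v f z).
Proof. by case=> h _ _ /h[a b]; split; apply: DeriveDef. Qed.

Lemma smooth_pd (V : normedModType R) U (f : R * R -> V) : smooth_on U f ->
  smooth_on U (pd_u f) /\ smooth_on U (pd_v f).
Proof. by move=> h; split=> k; case: (h k.+1). Qed.

(** The two equations on partial derivatives are the Cauchy-Riemann equations [G_v = J G_u], split
    into real and imaginary parts. *)
Lemma smooth_cdiff J U G z : open U ->
  smooth_on U (fun y => Re (G y)) -> smooth_on U (fun y => Im (G y)) ->
  (forall z, U z -> pd_v (fun y => Re (G y)) z =
     Re (J * Complex (pd_u (fun y => Re (G y)) z) (pd_u (fun y => Im (G y)) z))) ->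
  (forall z, U z -> pd_v (fun y => Im (G y)) z =
     Im (J * Complex (pd_u (fun y => Re (G y)) z) (pd_u (fun y => Im (G y)) z))) ->
  U z ->
  cdiff J G z (Complex (pd_u (fun y => Re (G y)) z) (pd_u (fun y => Im (G y)) z)).
Proof.
move=> oU s1 s2 r1 r2 Uz; have nU : \forall y \near z, U y by exact: open_nbhs_nbhs.
have D (f : R * R -> R) : smooth_on U f ->
    is_diff z f (fun w => w.1 * pd_u f z + w.2 * pd_v f z).
  move=> s; have [su sv] := smooth_pd s.
  apply: C1_is_diff; [| |exact: (su 0%N _ Uz)|exact: (sv 0%N _ Uz)].
    by apply: filterS nU => y Uy; have [] := Ck_derive (s 1%N) Uy.
  by apply: filterS nU => y Uy; have [] := Ck_derive (s 1%N) Uy.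
split.
  by apply: (is_diff_ext (D _ s1)) => w; rewrite r1 // /jc !(Re_mk, Im_mk, ReImE); ring.
by apply: (is_diff_ext (D _ s2)) => w; rewrite r2 // /jc !(Re_mk, Im_mk, ReImE); ring.
Qed.

Lemma pd_comm U (f : R * R -> R) z : open U -> smooth_on U f -> U z ->
  pd_v (pd_u f) z = pd_u (pd_v f) z.
Proof.
move=> oU s Uz; have nU : \forall y \near z, U y by exact: open_nbhs_nbhs.
have [su sv] := smooth_pd s; have [suu suv] := smooth_pd su.
have [svu svv] := smooth_pd sv.
apply: (@schwarz _ f (pd_u f) (pd_v f)); [|exact: (suv 0%N _ Uz)|exact: (svu 0%N _ Uz)].
apply: filterS nU => y Uy.
have [a b] := Ck_derive (s 1%N) Uy.
have [c d] := Ck_derive (su 1%N) Uy.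
by have [e g] := Ck_derive (sv 1%N) Uy.
Qed.

(** By the symmetry of second derivatives, [G_u] satisfies the Cauchy-Riemann equations whenever [G]
    does, so the argument can be iterated. *)
Lemma smooth_hol J U k G : open U ->
  smooth_on U (fun y => Re (G y)) -> smooth_on U (fun y => Im (G y)) ->
  (forall z, U z -> pd_v (fun y => Re (G y)) z =
     Re (J * Complex (pd_u (fun y => Re (G y)) z) (pd_u (fun y => Im (G y)) z))) ->
  (forall z, U z -> pd_v (fun y => Im (G y)) z =
     Im (J * Complex (pd_u (fun y => Re (G y)) z) (pd_u (fun y => Im (G y)) z))) ->
  hol J U k G.
Proof.
move=> oU; elim: k G => [|k IH] G s1 s2 r1 r2.
  by move=> z Uz; split; [exact: (s1 0%N _ Uz)|exact: (s2 0%N _ Uz)].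
have nU z : U z -> \forall y \near z, U y by move=> Uz; exact: open_nbhs_nbhs.
have [su1 sv1] := smooth_pd s1; have [su2 sv2] := smooth_pd s2.
exists (fun z => Complex (pd_u (fun y => Re (G y)) z) (pd_u (fun y => Im (G y)) z)).
  by move=> z Uz; exact: (smooth_cdiff oU s1 s2 r1 r2 Uz).
pose g1 y := Re (G y); pose g2 y := Im (G y).
apply: IH; [exact: su1|exact: su2| |] => z Uz; have [a1 _] := Ck_derive (su1 1%N) Uz;
  have [a2 _] := Ck_derive (su2 1%N) Uz.
  change (pd_v (pd_u g1) z = Re (J * Complex (pd_u (pd_u g1) z) (pd_u (pd_u g2) z))).
  rewrite (pd_comm oU s1 Uz) ReM Re_mk Im_mk.
  rewrite [LHS](near_eq_derive (e_u R) (filterS r1 (nU _ Uz))).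
  have h := is_deriveB (is_deriveZ (Re J) a1) (is_deriveZ (Im J) a2).
  have hv := @derive_val _ _ _ _ _ _ _ h; rewrite !scaleE in hv.
  apply: etrans hv; apply: (congr1 (fun F : R * R -> R => 'D_(e_u R) F z)).
  by apply/funext => y; rewrite !fctE ReM.
change (pd_v (pd_u g2) z = Im (J * Complex (pd_u (pd_u g1) z) (pd_u (pd_u g2) z))).
rewrite (pd_comm oU s2 Uz) ImM Re_mk Im_mk.
rewrite [LHS](near_eq_derive (e_u R) (filterS r2 (nU _ Uz))).
have h := is_deriveD (is_deriveZ (Re J) a2) (is_deriveZ (Im J) a1).
have hv := @derive_val _ _ _ _ _ _ _ h; rewrite !scaleE in hv.
  apply: etrans hv; apply: (congr1 (fun F : R * R -> R => 'D_(e_u R) F z)).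
by apply/funext => y; rewrite !fctE ImM.
Qed.

End Holomorphic.

(** * Ordinary differential equations *)

Section Picard.
Variable R : realType.

(** The nearest-point retraction of the line onto the interval of centre [c] and radius [d]; it
    turns local data into globally defined functions with the same Lipschitz constants. *)
Definition clamp (c d t : R) : R := Num.min (Num.max t (c - d)) (c + d).

Lemma clamp_dist c d t : 0 <= d -> `|clamp c d t - c| <= d.
Proof.
move=> d0; rewrite /clamp ler_norml.
by case: (leP t (c - d)) => h1; [case: (leP (c - d) (c + d)) => h2|case: (leP t (c + d)) => h2];
  apply/andP; split; lra.
Qed.

Lemma clamp_id c d t : `|t - c| <= d -> clamp c d t = t.
Proof.
by rewrite ler_norml => /andP[h1 h2]; rewrite /clamp max_l ?min_l; lra.
Qed.

Lemma clamp_lip c d s t : 0 <= d -> `|clamp c d s - clamp c d t| <= `|s - t|.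
Proof.
move=> d0; wlog st : s t / s <= t.
  by move=> h; have [/h//|/ltW/h] := leP s t; rewrite distrC (distrC s).
rewrite (ler0_norm (_ : s - t <= 0)) ?subr_le0 // ler_norml /clamp.
by case: (leP s (c - d)) => h1; case: (leP t (c - d)) => h3;
  (try (case: (leP (c - d) (c + d)) => h2)); (try (case: (leP s (c + d)) => h4));
  (try (case: (leP t (c + d)) => h5)); apply/andP; split; lra.
Qed.

Lemma lip_cont (M : R) (f : R -> R) : 0 < M ->
  (forall s t, `|f s - f t| <= M * `|s - t|) -> continuous f.
Proof.
move=> M0 h t; apply/cvgrPdist_lt => e e0.
near=> s; apply: (le_lt_trans (h _ _)).
rewrite mulrC -ltr_pdivlMr //; near: s.
by apply: cvgr_dist_lt => //; rewrite divr_gt0.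
Unshelve. all: by end_near. Qed.

Lemma continuous_pair_comp (F : R * R -> R) (c1 c2 : R -> R) (x : R) :
  {for (c1 x, c2 x), continuous F} -> {for x, continuous c1} ->
  {for x, continuous c2} -> {for x, continuous (fun t => F (c1 t, c2 t))}.
Proof.
move=> hF h1 h2.
have h : {for x, continuous (fun t => (c1 t, c2 t))} by exact: (cvg_pair h1 h2).
exact: (@continuous_comp _ _ _ (fun t => (c1 t, c2 t)) F x h hF).
Qed.

Lemma primitive_exists (g : R -> R) (x0 y0 r : R) : 0 < r -> continuous g ->
  exists2 G : R -> R, G x0 = y0 &
    forall x, `|x - x0| < r -> is_derive x 1 G (g x).
Proof.
move=> r0 cg; pose a := x0 - r; pose u := x0 + r.
pose F x := parameterized_integral (@lebesgue_measure R) a x g.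
exists (fun x => F x + (y0 - F x0)); first by rewrite addrC subrK.
move=> x; rewrite ltr_norml => /andP[h1 h2].
have iu : (@lebesgue_measure R).-integrable `[a, u] (EFin \o g).
  apply: continuous_compact_integrable; first exact: segment_compact.
  exact: continuous_subspaceT.
have xu : x < u by rewrite /u; lra.
have ax : a < x by rewrite /a; lra.
have [Fd FE] := continuous_FTC1_closed xu iu ax (cg x).
have h : is_derive x 1 F (g x) := DeriveDef Fd (etrans (esym (derive1E F x)) FE).
by apply: (is_derive_eq (is_deriveD h (is_derive_cst _ _ _))); rewrite addr0.
Qed.

(** The form in which limits of the iterates are taken: an inequality that holds up to a geometric
    error is exact. *)
Lemma le_geo0 (a c : R) : (forall n, a <= c * 2^-1 ^+ n) -> a <= 0.
Proof.
move=> h; rewrite leNgt; apply/negP => a0.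
have c0 : 0 < c by have := h 0%N; rewrite expr0 mulr1; exact: lt_le_trans.
have [n nP] : exists n, c / a < n%:R.
  exists (Num.bound (c / a)); apply: archi_boundP.
  by rewrite divr_ge0 // ltW.
have := h n; rewrite leNgt => /negP; apply.
have n2 : n%:R <= 2 ^+ n :> R.
  by rewrite -natrX ler_nat; exact/ltnW/ltn_expl.
rewrite exprVn ltr_pdivrMr ?exprn_gt0 //.
rewrite ltr_pdivrMr // in nP; apply: (lt_le_trans nP).
by rewrite mulrC ler_pM2l.
Qed.

(** Picard iteration with both arguments of [F] clamped to the box. The iterates live on the whole
    line and need not be confined; only the limit is shown to stay in the box, where the clamps are
    the identity. *)
Lemma picard (F : R * R -> R) (x0 y0 d M K : R) : 0 < d -> 0 < M -> 0 < K ->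
  (forall a b, `|a - x0| <= d -> `|b - y0| <= d -> {for (a, b), continuous F}) ->
  (forall a b, `|a - x0| <= d -> `|b - y0| <= d -> `|F (a, b)| <= M) ->
  (forall a b b', `|a - x0| <= d -> `|b - y0| <= d -> `|b' - y0| <= d ->
     `|F (a, b) - F (a, b')| <= K * `|b - b'|) ->
  exists r (y : R -> R), [/\ 0 < r, r <= d, y x0 = y0 &
    forall x, `|x - x0| < r -> `|y x - y0| <= d /\ is_derive x 1 y (F (x, y x))].
Proof.
move=> d0 M0 K0 cF bF lF.
pose Ft a b := F (clamp x0 d a, clamp y0 d b).
have Fb a b : `|Ft a b| <= M by apply: bF; apply: clamp_dist; rewrite ltW.
have Fl a b b' : `|Ft a b - Ft a b'| <= K * `|b - b'|.
  apply: le_trans (lF _ _ _ _ _ _) _; try (by apply: clamp_dist; rewrite ltW).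
  by rewrite ler_pM2l // clamp_lip // ltW.
have clc c : continuous (clamp c d).
  by apply: (@lip_cont 1) => // s t; rewrite mul1r clamp_lip // ltW.
have Fc (y : R -> R) : continuous y -> continuous (fun x => Ft x (y x)).
  move=> cy x; apply: continuous_pair_comp; last 2 first.
  - exact: clc.
  - by apply: (@continuous_comp _ _ _ y (clamp y0 d)); [exact: cy|exact: clc].
  by apply: cF; apply: clamp_dist; rewrite ltW.
(* [K r <= 1/2] makes the iteration a contraction by 1/2, and [M r <= d] keeps the limit inside the
   box. *)
pose r := Num.min d (Num.min (2 * K)^-1 (d / M)).
have r0 : 0 < r by rewrite !lt_min d0 invr_gt0 mulr_gt0 // divr_gt0.
have rd : r <= d by rewrite ge_min lexx.
have rK : K * r <= 2^-1.
  have : r <= (2 * K)^-1 by rewrite !ge_min lexx orbT.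
  by rewrite invfM mulrC -ler_pdivlMl // mulrC.
have rM : M * r <= d.
  have : r <= d / M by rewrite !ge_min lexx !orbT.
  by rewrite ler_pdivlMr // mulrC.
(* The primitives are differentiable only on the open interval of radius [r], so functions are
   frozen at a strictly smaller radius. *)
pose r2 := r / 2; have r20 : 0 < r2 by rewrite divr_gt0.
have r2r : r2 < r by rewrite /r2; lra.
have cr t : `|clamp x0 r2 t - x0| < r.
  by apply: le_lt_trans r2r; apply: clamp_dist; rewrite ltW.
have x00 : clamp x0 r2 x0 = x0 by rewrite clamp_id // subrr normr0 ltW.
(* The iteration step: a primitive of [F] along [y], extended by constants outside the radius [r2],
   hence continuous on the whole line. *)
pose step (y z : R -> R) := exists G : R -> R, [/\ forall x, z x = G (clamp x0 r2 x),
  G x0 = y0 & forall x, `|x - x0| < r -> is_derive x 1 G (Ft x (y x))].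
have /choice[T TP] : forall y : R -> R, exists z, continuous y -> step y z.
  move=> y; have [cy|ncy] := pselect (continuous y); last by exists y.
  have [G G0 GP] := primitive_exists x0 y0 r0 (Fc _ cy).
  by exists (G \o clamp x0 r2) => _; exists G.
have between a b t : `|a - x0| < r -> `|b - x0| < r ->
    Num.min a b <= t <= Num.max a b -> `|t - x0| < r.
  rewrite !ltr_norml => /andP[h1 h2] /andP[h3 h4].
  by have [ab|ab] := leP a b => /andP[h5 h6]; apply/andP; split; lra.
have x0r : `|x0 - x0| < r by rewrite subrr normr0.
have Tlip y s t : continuous y -> `|T y s - T y t| <= M * `|s - t|.
  move=> /TP[G [zG G0 GP]]; rewrite !zG.
  have := @mvt_le _ G (fun x => Ft x (y x)) (clamp x0 r2 t) (clamp x0 r2 s) 0 M.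
  rewrite mul0r subr0 => h; apply: le_trans (h _ _) _.
  - by move=> x xP; apply: GP; apply: between xP.
  - by move=> x _; rewrite subr0.
  by rewrite ler_pM2l // clamp_lip // ltW.
have Tcont y : continuous y -> continuous (T y).
  by move=> cy; apply: (lip_cont M0) => s t; exact: Tlip.
have Tcontr y y' e : continuous y -> continuous y' ->
    (forall x, `|y x - y' x| <= e) -> forall x, `|T y x - T y' x| <= e / 2.
  move=> /TP[G [zG G0 GP]] /TP[G' [zG' G0' GP']] ye x; rewrite zG zG'.
  have e0 : 0 <= e by exact: le_trans (ye x0).
  have := @mvt_le _ (fun t => G t - G' t) (fun x => Ft x (y x) - Ft x (y' x))
    x0 (clamp x0 r2 x) 0 (K * e).
  rewrite G0 G0' subrr !subr0 mul0r subr0 => h; apply: le_trans (h _ _) _.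
  - move=> t tP; have tr := between _ _ _ x0r (cr _) tP.
    exact: (is_deriveB (GP _ tr) (GP' _ tr)).
  - by move=> t _; rewrite subr0; apply: le_trans (Fl _ _ _) _; rewrite ler_pM2l.
  have : K * e * `|clamp x0 r2 x - x0| <= K * e * r.
    by apply: ler_wpM2l; rewrite ?mulr_ge0 // ltW.
  move=> /le_trans; apply; rewrite mulrAC [leRHS]mulrC.
  by apply: ler_wpM2r.
have T0 y : continuous y -> T y x0 = y0.
  by move=> /TP[G [zG G0 GP]]; rewrite zG x00.
pose Y n := iter n T (fun=> y0).
have Yc n : continuous (Y n).
  by elim: n => [|n IH]; [exact: cst_continuous|exact: Tcont].
pose B := M * r; have B0 : 0 < B by rewrite mulr_gt0.
have Yd n x : `|Y n.+1 x - Y n x| <= B * 2^-1 ^+ n.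
  elim: n x => [|n IH] x; last first.
    by rewrite exprSr mulrA; exact: (Tcontr (Y n.+1) (Y n) _ (Yc n.+1) (Yc n) IH).
  rewrite expr0 mulr1 /=; have /TP[G [zG G0 GP]] := Yc 0%N; rewrite zG.
  have := @mvt_le _ G (fun x => Ft x (Y 0%N x)) x0 (clamp x0 r2 x) 0 M.
  rewrite mul0r subr0 G0 => h; apply: le_trans (h _ _) _.
  - by move=> t tP; apply: GP; apply: between tP.
  - by move=> t _; rewrite subr0.
  by rewrite ler_pM2l // ltW.
(* The sum of the bounds [B * 2^-1 ^+ k] over all [k >= n], that is the distance from [Y n] to the
   limit. *)
pose c n : R := 2 * B * 2^-1 ^+ n.
have c0 n : 0 <= c n by rewrite !mulr_ge0 ?exprn_ge0 // ltW.
have cS n : c n.+1 = c n / 2 by rewrite /c exprSr mulrA.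
have cB n : B * 2^-1 ^+ n = c n / 2 by rewrite /c; field.
have Ydiff n k x : `|Y (n + k)%N x - Y n x| <= c n - c (n + k)%N.
  elim: k => [|k IH]; first by rewrite addn0 !subrr normr0.
  have := Yd (n + k)%N x; rewrite cB addnS cS => h.
  rewrite -(subrK (Y (n + k)%N x) (Y _ x)) -addrA.
  by apply: (le_trans (ler_normD _ _)); lra.
have Ydist n m x : `|Y m x - Y n x| <= c n + c m.
  have [nm|/ltnW mn] := leqP n m.
    by have := Ydiff n (m - n)%N x; rewrite subnKC //; have := c0 m; lra.
  by have := Ydiff m (n - m)%N x; rewrite subnKC // distrC; have := c0 n; lra.
(* The limit, obtained without Cauchy sequences: all lower bounds [Y n x - c n] lie below all upper
   bounds [Y m x + c m]. *)
pose y x := sup [set Y n x - c n | n in setT].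
have ubS n x : ubound [set Y m x - c m | m in setT] (Y n x + c n).
  by move=> _ [m _ <-]; have := Ydist n m x; rewrite ler_norml => /andP[]; lra.
have yY n x : `|y x - Y n x| <= c n.
  rewrite ler_norml; apply/andP; split.
    have : Y n x - c n <= y x.
      by apply: ub_le_sup; [exists (Y n x + c n); exact: ubS|exists n].
    by lra.
  have : y x <= Y n x + c n.
    by apply: ge_sup; [exists (Y 0%N x - c 0%N); exists 0%N|exact: ubS].
  by lra.
have ylip s t : `|y s - y t| <= M * `|s - t|.
  rewrite -subr_le0; apply: (@le_geo0 _ (4 * B)) => n.
  have h1 := yY n.+1 s; have h2 := yY n.+1 t; have h3 := Tlip (Y n) s t (Yc n).
  have E : y s - y t = (y s - Y n.+1 s) + (Y n.+1 s - Y n.+1 t) - (y t - Y n.+1 t) by ring.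
  have h4 := ler_normB (y s - Y n.+1 s + (Y n.+1 s - Y n.+1 t)) (y t - Y n.+1 t).
  have h5 := ler_normD (y s - Y n.+1 s) (Y n.+1 s - Y n.+1 t).
  rewrite -E in h4; have E2 : 4 * B * 2^-1 ^+ n = 2 * c n by rewrite /c; ring.
  rewrite E2; rewrite -/(Y n.+1) in h3; have := c0 n.
  rewrite cS in h1 h2; move: h1 h2 h3 h4 h5 => /=; lra.
have cy : continuous y by exact: (lip_cont M0 ylip).
have Ty x : T y x = y x.
  apply/eqP; rewrite -subr_eq0 -normr_le0; apply: (@le_geo0 _ (2 * B)) => n.
  have h1 := Tcontr _ _ _ cy (Yc n) (yY n) x; have h2 := yY n.+1 x.
  have := ler_normB (T y x - Y n.+1 x) (y x - Y n.+1 x).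
  have -> : T y x - Y n.+1 x - (y x - Y n.+1 x) = T y x - y x by ring.
  rewrite cS in h2; rewrite -/(c n); move: h1 h2 => /=; lra.
have [G [zG G0 GP]] := TP _ cy.
exists r2, y; split=> //; first exact: le_trans (ltW r2r) rd.
  by rewrite -Ty T0.
move=> x xr; have yd : `|y x - y0| <= d.
  have := ylip x x0; rewrite -(Ty x0) (T0 _ cy) => /le_trans; apply.
  by apply: le_trans rM; rewrite ler_pM2l // ltW // (lt_trans xr).
split=> //.
have -> : F (x, y x) = Ft x (y x).
  by rewrite /Ft !clamp_id // (le_trans (ltW xr)) // (le_trans (ltW r2r)).
apply: near_eq_is_derive (GP _ (lt_trans xr r2r)).
have nx : \forall t \near x, `|t - x0| < r2.
  have : 0 < r2 - `|x - x0| by rewrite subr_gt0.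
  move=> e0; near=> t.
  rewrite -(subrK x t) -addrA; apply: (le_lt_trans (ler_normD _ _)).
  rewrite -ltrBrDr distrC; near: t.
  exact: cvgr_dist_lt.
by apply: filterS nx => t tr; rewrite -Ty zG clamp_id // ltW.
Unshelve. all: by end_near. Qed.

End Picard.

(** * Logarithms on simply connected domains *)

Section Logarithm.
Variable R : realType.
Implicit Types (z w : R * R) (U : set (R * R)) (J d : R[i]) (G W : R * R -> R[i]).

Lemma ccont_comp (T S : topologicalType) (h : T -> S) (g : S -> R[i]) (x : T) :
  {for x, continuous h} -> ccont g (h x) -> ccont (g \o h) x.
Proof. by move=> hc [a b]; split; [exact: continuous_comp hc a|exact: continuous_comp hc b]. Qed.

Lemma ccont_clog (T : topologicalType) (g : T -> R[i]) (x : T) :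
  0 < Re (g x) -> ccont g x -> ccont (fun y => clog (g y)) x.
Proof.
move=> g0 [a b].
have p : {for x, continuous (fun y => (Re (g y), Im (g y)))} by exact: (cvg_pair a b).
have J0 : jc 'i%C (Re (g x), Im (g x)) = g x.
  by apply: eq_ReIm; rewrite /jc !ReImE /=; ring.
have c : ccont (fun q : R * R => clog (jc 'i%C q)) (Re (g x), Im (g x)).
  by apply: cdiff_ccont (cdiff_clog _ (cdiff_jc _ _)); rewrite J0.
have := ccont_comp p c; congr (ccont _ x); apply/funext => y /=; congr clog.
by apply: eq_ReIm; rewrite /jc !ReImE /=; ring.
Qed.

(** The real part of [d] vanishes. If the imaginary part took different values at 0 and 1, the
    intermediate value theorem would give a point where it differs from an end value by some [m] in
    []0, 1]]; then [sin m = 0] with [0 < m < pi], which is impossible. *)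
Lemma cexp_const (d : R -> R[i]) :
  (forall t, 0 <= t <= 1 -> ccont d t) ->
  (forall t, 0 <= t <= 1 -> cexp (d t) = 1) -> d 0 = d 1.
Proof.
move=> cd ed.
have re0 t : 0 <= t <= 1 -> Re (d t) = 0.
  move=> /ed E; have := normc2_cexp (d t); rewrite E /normc2 Re1 Im1.
  rewrite expr0n addr0 expr1n -expRM_natr -[X in X = _]expR0 => /expR_inj/esym/eqP.
  by rewrite mulf_eq0 pnatr_eq0 orbF => /eqP.
have h0 : 0 <= (0 : R) <= 1 by rewrite lexx ler01.
have h1 : 0 <= (1 : R) <= 1 by rewrite lexx ler01.
apply: eq_ReIm; first by rewrite !re0.
pose th t := Im (d t).
have cth : {within `[0 : R, 1], continuous th}.
  by apply: continuous_in_subspaceT => t; rewrite inE /= in_itv /= => /cd[].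
have key a b m : 0 <= a <= 1 -> 0 <= b <= 1 -> th b = th a + m -> 0 < m -> m <= 1 -> False.
  move=> aP bP E m0 m1.
  have Ec : d b = d a + Complex 0 m.
    by apply: eq_ReIm; rewrite !ReImE ?re0 //= ?addr0 // -E.
  have := ed _ bP; rewrite Ec cexpD (ed _ aP) mul1r => /(congr1 (fun u => Im u)) /=.
  rewrite expR0 mul1r => /eqP; apply/negP; rewrite gt_eqF // sin_gt0_pi //.
  by apply/andP; split => //; apply: le_lt_trans m1 _; have := pi_ge2 R; lra.
have [lt01|lt10|//] := ltgtP (th 0) (th 1).
  pose m := Num.min (th 1 - th 0) 1.
  have m0 : 0 < m by rewrite lt_min subr_gt0 lt01 ltr01.
  have m1 : m <= 1 by rewrite ge_min lexx orbT.
  have mt : m <= th 1 - th 0 by rewrite ge_min lexx.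
  have [|c] := @IVT R th 0 1 (th 0 + m) ler01 cth.
    by rewrite (min_l (ltW lt01)) (max_r (ltW lt01)); apply/andP; split; lra.
  rewrite in_itv /= => cP E; exfalso; exact: (key 0 c m).
pose m := Num.min (th 0 - th 1) 1.
have m0 : 0 < m by rewrite lt_min subr_gt0 lt10 ltr01.
have m1 : m <= 1 by rewrite ge_min lexx orbT.
have mt : m <= th 0 - th 1 by rewrite ge_min lexx.
have [|c] := @IVT R th 0 1 (th 1 + m) ler01 cth.
  by rewrite (min_r (ltW lt10)) (max_l (ltW lt10)); apply/andP; split; lra.
rewrite in_itv /= => cP E; exfalso; exact: (key 1 c m).
Qed.

(** Divided by [g x], nearby values lie in the square of half-side 1/2 around 1, where arguments are
    below pi/4, so a quotient of two of them stays in the right half-plane. There the principal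
    logarithm is available; in particular [g] has no zero on [B]. *)
Lemma ratio_near (T : topologicalType) (g : T -> R[i]) (x : T) :
  g x != 0 -> ccont g x ->
  exists2 B : set T, nbhs x B & forall a b, B a -> B b -> 0 < Re (g a / g b).
Proof.
move=> g0 cg.
have [c1 c2] := ccontM cg (ccont_cst (g x)^-1 x).
have E1 : Re (g x * (g x)^-1) = 1 by rewrite mulfV.
have E2 : Im (g x * (g x)^-1) = 0 by rewrite mulfV.
have n1 : \forall y \near x, `|1 - Re (g y / g x)| < 2^-1.
  by move: c1; rewrite /prop_for /continuous_at E1 => /cvgrPdist_lt; apply.
have n2 : \forall y \near x, `|0 - Im (g y / g x)| < 2^-1.
  by move: c2; rewrite /prop_for /continuous_at E2 => /cvgrPdist_lt; apply.
exists [set y | `|1 - Re (g y / g x)| < 2^-1 /\ `|0 - Im (g y / g x)| < 2^-1].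
  exact: filterI.
move=> a b /= [a1 a2] [b1 b2].
have -> : g a / g b = (g a / g x) / (g b / g x).
  by rewrite invfM invrK mulrACA mulVf // mulr1.
move: a1 a2 b1 b2; set u := g a / g x; set v := g b / g x.
rewrite !ltr_norml => /andP[a1 a2] /andP[a3 a4] /andP[b1 b2] /andP[b3 b4].
rewrite ReM ReV ImV.
have v0 : 0 < Re v ^+ 2 + Im v ^+ 2.
  by rewrite ltr_pwDl ?sqr_ge0 // exprn_gt0 //; lra.
have -> : Re u * (Re v / (Re v ^+ 2 + Im v ^+ 2)) -
   Im u * - (Im v / (Re v ^+ 2 + Im v ^+ 2)) =
   (Re u * Re v + Im u * Im v) / (Re v ^+ 2 + Im v ^+ 2) by ring.
apply: divr_gt0 => //.
have h1 : 2^-1 * 2^-1 < Re u * Re v by apply: ltr_pM; lra.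
have h2 : `|Im u * Im v| <= 2^-1 * 2^-1.
  by rewrite normrM; apply: ler_pM => //; rewrite ler_norml; apply/andP; split; lra.
by move: h2; rewrite ler_norml => /andP[]; lra.
Qed.

(** One of the two square roots of [x] lies in the open right half-plane, and twice its principal
    logarithm will do, unless the roots are purely imaginary; then [x = - b^2], with logarithm
    [ln (b^2) + i pi]. *)
Lemma cexp_surj (x : R[i]) : x != 0 -> exists l, cexp l = x.
Proof.
move=> x0; have qE : complex.sqrtc x ^+ 2 = x by exact: sqr_sqrtc.
have pos (q : R[i]) : q ^+ 2 = x -> 0 < Re q -> exists l, cexp l = x.
  by move=> E q0; exists (clog q + clog q); rewrite cexpD clogK // -expr2.
have [lt0|gt0|E] := ltgtP (Re (complex.sqrtc x)) 0; [|exact: pos qE gt0|].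
  by apply: (pos (- complex.sqrtc x)); rewrite ?sqrrN // ReN oppr_gt0.
move: qE x0 E; case: (complex.sqrtc x) => a b /= <- x0 a0.
have b0 : 0 < b ^+ 2.
  rewrite lt0r sqr_ge0 andbT sqrf_eq0; apply: contra x0 => /eqP ->.
  by rewrite a0 expr0n.
exists (Complex (ln (b ^+ 2)) pi).
by apply: eq_ReIm; rewrite ?(Re_cexp, Im_cexp, Re_mk, Im_mk) expr2
  ?(ReM, ImM, Re_mk, Im_mk) lnK ?posrE // ?cospi ?sinpi a0; ring.
Qed.

(* Telescoping along the ray from the origin: the argument of [g] turns by less
   than a quarter on each of the N steps. *)
Lemma square_lift (g : R * R -> R[i]) :
  (forall p, ccont g p) -> (forall p, g p != 0) ->
  exists L : R * R -> R[i], forall p, 0 <= p.1 <= 1 -> 0 <= p.2 <= 1 ->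
    ccont L p /\ cexp (L p) = g p.
Proof.
move=> cg g0; pose I01 : set R := [set` `[0, 1]].
have cK : compact (I01 `*` I01).
  by apply: compact_setX; exact: segment_compact.
have inK p : (I01 `*` I01) p <-> (0 <= p.1 <= 1 /\ 0 <= p.2 <= 1).
  by rewrite /I01 /= !in_itv.
(* A Lebesgue number: compactness of the square makes the radius of [ratio_near] uniform. *)
have [del d0 dP] : exists2 del : R, 0 < del & forall p, (I01 `*` I01) p ->
    forall q, `|q.1 - p.1| < del -> `|q.2 - p.2| < del -> 0 < Re (g q / g p).
  have := (proj1 (compact_near_coveringP _) cK) R (0^'+)
    (fun del p => forall q, `|q.1 - p.1| < del -> `|q.2 - p.2| < del -> 0 < Re (g q / g p)) _.
  case.
    move=> [x y] _; have [B nB BP] := ratio_near (g0 (x, y)) (cg (x, y)).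
    have [e e0 eP] := near_box nB.
    have e2 : 0 < e / 2 by rewrite divr_gt0.
    exists ([set p | `|p.1 - x| < e / 2 /\ `|p.2 - y| < e / 2], [set del : R | del < e / 2]).
      split; first by apply: (box_near e2) => a b.
      exact: nbhs_right_lt.
    move=> [[a b] del] /= [[ax bY] dl] [q1 q2] /= h1 h2.
    apply: BP; apply: eP; try lra.
    - rewrite -(subrK a q1) -addrA; apply: (le_lt_trans (ler_normD _ _)); lra.
    - rewrite -(subrK b q2) -addrA; apply: (le_lt_trans (ler_normD _ _)); lra.
  move=> r /= r0 rP; exists (r / 2); first by rewrite divr_gt0.
  move=> p Kp q; apply: (rP (r / 2)) => //=; last by rewrite divr_gt0.
  by rewrite sub0r normrN ger0_norm; lra.
pose N := (Num.bound del^-1).+1.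
have N0 : (0 : R) < N%:R by rewrite ltr0n.
have Nd : N%:R^-1 < del.
  rewrite -[del]invrK ltf_pV2 ?posrE ?invr_gt0 //.
  apply: (lt_trans (archi_boundP _)); first by rewrite invr_ge0 ltW.
  by rewrite ltr_nat.
have cs (a : R) p : {for p, continuous (fun q : R * R => a *: q)}.
  have h := is_diffZ a (is_diff_id p).
  by apply: differentiable_continuous; apply: ex_diff.
have step k : (k <= N)%N -> exists L : R * R -> R[i],
    forall p, (I01 `*` I01) p -> ccont L p /\ cexp (L p) = g ((k%:R / N%:R : R) *: p).
  elim: k => [|k IH] kN.
    have [l lE] := cexp_surj (g0 (0 *: (0, 0))).
    exists (fun=> l) => p _; split; first exact: ccont_cst.
    by rewrite mul0r lE; congr g; rewrite !scale0r.
  have [L LP] := IH (ltnW kN).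
  exists (fun p => L p + clog (g ((k.+1%:R / N%:R : R) *: p) / g ((k%:R / N%:R : R) *: p))).
  move=> p Kp; have [Lc LE] := LP _ Kp.
  have [p1 p2] := proj1 (inK p) Kp.
  have kN1 : 0 <= (k%:R / N%:R : R) <= 1.
    by apply/andP; split; [exact: divr_ge0|rewrite ler_pdivrMr // mul1r ler_nat ltnW].
  have sc (a t : R) : 0 <= a <= 1 -> 0 <= t <= 1 -> 0 <= a * t <= 1.
    move=> /andP[a0 a1] /andP[t0 t1]; rewrite mulr_ge0 //=.
    by rewrite -[1]mulr1 ler_pM.
  have Kq : (I01 `*` I01) ((k%:R / N%:R : R) *: p).
    by apply/inK; split; apply: sc.
  have cl (t : R) : 0 <= t <= 1 -> `|k.+1%:R / N%:R * t - k%:R / N%:R * t| < del.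
    move=> /andP[t0 t1]; have -> : k.+1%:R / N%:R * t - k%:R / N%:R * t = N%:R^-1 * t.
      by rewrite -natr1; ring.
    rewrite ger0_norm ?mulr_ge0 ?invr_ge0 ?ler0n //; apply: le_lt_trans Nd.
    by rewrite ler_piMr // invr_ge0 ler0n.
  have r0 := dP _ Kq (k.+1%:R / N%:R *: p) (cl _ p1) (cl _ p2).
  have ck (a : R) : ccont (fun q : R * R => g (a *: q)) p by apply: ccont_comp (cs a p) _.
  split.
    apply: ccontD => //; apply: ccont_clog => //.
    by apply: ccontM => //; apply: ccontV.
  by rewrite cexpD LE clogK // mulrC divfK.
have [L LP] := step N (leqnn N); exists L => p p1 p2.
have [|h1 h2] := LP p; first exact/inK.
by split => //; rewrite h2 divff ?gt_eqF // scale1r.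
Qed.

(** Centre and radius 1/2 give the retraction of the line onto the unit interval, used to extend
    paths and homotopies to all real parameters. *)
Lemma clamp01 (t : R) : 0 <= clamp 2^-1 2^-1 t <= 1.
Proof.
have := @clamp_dist _ 2^-1 2^-1 t; rewrite ler_norml invr_ge0 ler0n.
by move=> /(_ isT)/andP[h1 h2]; apply/andP; split; lra.
Qed.

Lemma clamp01_id (t : R) : 0 <= t <= 1 -> clamp 2^-1 2^-1 t = t.
Proof. by move=> /andP[h1 h2]; rewrite clamp_id // ler_norml; apply/andP; split; lra. Qed.

Lemma continuous_clamp01 : continuous (clamp (2^-1 : R) 2^-1).
Proof.
by apply: (@lip_cont _ 1) => // s t; rewrite mul1r clamp_lip // invr_ge0 ler0n.
Qed.

(** A logarithm [L] of [W] is taken on the whole square of the homotopy. On the side [s = 0] it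
    differs from [l] by a constant; the increments of [L] along the sides [t = 0] and [t = 1] agree
    because every stage is a closed loop; on the side [s = 1] it is constant. Hence [L], and with it
    [l], returns to its initial value. *)
Lemma monodromy U W (c : R -> R * R) (l : R -> R[i]) :
  simply_connected U -> (forall z, U z -> ccont W z) -> (forall z, U z -> W z != 0) ->
  continuous c -> (forall t, U (c t)) -> c 0 = c 1 ->
  (forall t, ccont l t) -> (forall t, cexp (l t) = W (c t)) -> l 0 = l 1.
Proof.
move=> sU cW W0 cc Uc c01 cl lE.
have [||//|G [Gc GU G0 [p G1] Gl]] := sU c; [exact: continuous_subspaceT|by []|].
pose cl2 (q : R * R) := (clamp 2^-1 2^-1 q.1, clamp 2^-1 2^-1 q.2) : R * R.
have inA q : ([set` `[0, 1]] `*` [set` `[(0 : R), 1]]) (cl2 q).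
  by rewrite /= !in_itv /= !clamp01.
have cl2c q : {for q, continuous cl2}.
  have f : {for q, continuous (fun q : R * R => clamp 2^-1 2^-1 q.1)}.
    by apply: (@continuous_comp _ _ _ fst (clamp 2^-1 2^-1)); [exact: cvg_fst|exact: continuous_clamp01].
  have s : {for q, continuous (fun q : R * R => clamp 2^-1 2^-1 q.2)}.
    by apply: (@continuous_comp _ _ _ snd (clamp 2^-1 2^-1)); [exact: cvg_snd|exact: continuous_clamp01].
  exact: (cvg_pair f s).
have Hc q : {for q, continuous (G \o cl2)}.
  move/subspace_continuousP : Gc => /(_ _ (inA q)) Gq.
  apply: cvg_comp Gq => B; rewrite /within /= => nB.
  have : nbhs (cl2 q) [set x | ([set` `[0, 1]] `*` [set` `[(0 : R), 1]]) x -> B x] by [].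
  move=> /cl2c h; change (\forall y \near q, B (cl2 y)).
  by apply: filterS (h : \forall y \near q, _ (cl2 y) -> B (cl2 y)) => y; apply; exact: inA.
have HU q : U (G (cl2 q)) by case: (inA q) => h1 h2; exact: GU.
have HE s t : 0 <= s <= 1 -> 0 <= t <= 1 -> G (cl2 (s, t)) = G (s, t).
  by move=> s1 t1; rewrite /cl2 /= !clamp01_id.
have [L LP] := @square_lift (W \o (G \o cl2))
  (fun q => ccont_comp (Hc q) (cW _ (HU q))) (fun q => W0 _ (HU q)).
have h0 : 0 <= (0 : R) <= 1 by rewrite lexx ler01.
have h1 : 0 <= (1 : R) <= 1 by rewrite lexx ler01.
have cNc (f : R -> R[i]) x : ccont f x -> ccont (fun y => - f y) x.
  by move=> [a b]; split; [apply: (cont_ext _ (continuousN a)) => y; rewrite ReN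
    |apply: (cont_ext _ (continuousN b)) => y; rewrite ImN].
have idc : continuous (fun t : R => t) by move=> t; exact: cvg_id.
have cst_t (s t : R) : {for t, continuous (fun t : R => (s, t))}.
  by exact: (cvg_pair (@cst_continuous _ _ s t) (idc t)).
have cst_s (s t : R) : {for s, continuous (fun s : R => (s, t))}.
  by exact: (cvg_pair (idc s) (@cst_continuous _ _ t s)).
have LE s t : 0 <= s <= 1 -> 0 <= t <= 1 -> cexp (L (s, t)) = W (G (s, t)).
  by move=> s1 t1; have [_ ->] := LP (s, t) s1 t1; rewrite /= HE.
have Lt s t : 0 <= s <= 1 -> 0 <= t <= 1 -> ccont (fun t => L (s, t)) t.
  by move=> s1 t1; apply: (ccont_comp (cst_t s t)); have [] := LP (s, t) s1 t1.
have Ls s t : 0 <= s <= 1 -> 0 <= t <= 1 -> ccont (fun s => L (s, t)) s.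
  by move=> s1 t1; apply: (ccont_comp (cst_s s t)); have [] := LP (s, t) s1 t1.
have E1 : L (0, 0) - l 0 = L (0, 1) - l 1.
  apply: (@cexp_const (fun t => L (0, t) - l t)) => t tP.
    by apply: ccontD; [exact: Lt|exact: cNc].
  by rewrite cexpD cexpN LE // lE G0 ?in_itv // divff // W0.
have E2 : L (0, 1) - L (0, 0) = L (1, 1) - L (1, 0).
  apply: (@cexp_const (fun s => L (s, 1) - L (s, 0))) => s sP.
    by apply: ccontD; [exact: Ls|apply: cNc; exact: Ls].
  by rewrite cexpD cexpN !LE // -Gl ?in_itv // divff //; apply: W0; apply: GU; rewrite in_itv.
have E3 : L (1, 0) - L (1, 0) = L (1, 1) - L (1, 0).
  apply: (@cexp_const (fun t => L (1, t) - L (1, 0))) => t tP.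
    by apply: ccontD; [exact: Lt|exact: ccont_cst].
  by rewrite cexpD cexpN !LE // !G1 ?in_itv // divff //; apply: W0; rewrite -(G1 t) ?in_itv //;
    apply: GU; rewrite in_itv.
move: E2; rewrite -E3 subrr => /eqP; rewrite subr_eq0 => /eqP E2.
by move: E1; rewrite E2 => /addrI /oppr_inj.
Qed.

(** A path together with a continuous logarithm of [W] along it. Paths are defined for all real
    times, which avoids one-sided continuity at the end points. *)
Definition path_lift U W (c : R -> R * R) (l : R -> R[i]) :=
  [/\ continuous c, forall t, U (c t), forall t, ccont l t
    & forall t, cexp (l t) = W (c t)].

Lemma path_lift_cat U W c1 l1 c2 l2 :
  path_lift U W c1 l1 -> path_lift U W c2 l2 -> c1 1 = c2 0 ->
  exists c l, path_lift U W c l /\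
    [/\ c 0 = c1 0, c 1 = c2 1, l 0 = l1 0 & l 1 = l2 1 + (l1 1 - l2 0)].
Proof.
move=> [cc1 U1 cl1 E1] [cc2 U2 cl2 E2] E.
(* At every time one of the two parameters rests at the junction, so the concatenation can be
   written as the sum of both paths minus the junction value; this is continuous without any
   gluing. *)
pose a (t : R) := Num.min (2 * t) 1; pose b (t : R) := Num.max (2 * t - 1) 0.
have ca : continuous a.
  apply: (@lip_cont _ 2) => // s t; wlog st : s t / s <= t.
    by move=> h; have [/h//|/ltW/h] := leP s t; rewrite distrC (distrC s).
  rewrite (ler0_norm (_ : s - t <= 0)) ?subr_le0 // ler_norml /a.
  by case: (leP (2 * s) 1); case: (leP (2 * t) 1) => *; apply/andP; split; lra.
have cb : continuous b.
  apply: (@lip_cont _ 2) => // s t; wlog st : s t / s <= t.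
    by move=> h; have [/h//|/ltW/h] := leP s t; rewrite distrC (distrC s).
  rewrite (ler0_norm (_ : s - t <= 0)) ?subr_le0 // ler_norml /b.
  by case: (leP (2 * s - 1) 0); case: (leP (2 * t - 1) 0) => *; apply/andP; split; lra.
have cases t : (b t = 0) \/ (a t = 1).
  rewrite /a /b; have [h|h] := leP (2 * t) 1; last by right.
  by left; rewrite max_r //; lra.
exists (fun t => c1 (a t) + (c2 (b t) - c2 0)), (fun t => l1 (a t) + (l2 (b t) - l2 0)).
have a0 : a 0 = 0 by rewrite /a min_l; lra.
have a1 : a 1 = 1 by rewrite /a min_r; lra.
have b0 : b 0 = 0 by rewrite /b max_r; lra.
have b1 : b 1 = 1 by rewrite /b max_l; lra.
split; last first.
  rewrite a0 a1 b0 b1 !subrr !addr0 E; split=> //; first by rewrite addrC subrK.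
  by rewrite addrCA.
split.
- move=> t; apply: cvgD; first exact: (@continuous_comp _ _ _ a c1 t (ca t) (cc1 _)).
  apply: cvgB; last exact: cvg_cst.
  exact: (@continuous_comp _ _ _ b c2 t (cb t) (cc2 _)).
- move=> t; case: (cases t) => ->; first by rewrite subrr addr0.
  by rewrite E addrC subrK.
- move=> t; apply: ccontD; first exact: (ccont_comp (ca t) (cl1 _)).
  apply: ccontD; first exact: (ccont_comp (cb t) (cl2 _)).
  exact: ccont_cst.
- move=> t; case: (cases t) => ->; first by rewrite !subrr !addr0 E1.
  rewrite !cexpD cexpN !E1 !E2 E [X in _ = W X]addrC subrK.
  by rewrite mulrC divfK // -E2 cexp_neq0.
Qed.

Lemma path_lift_rev U W c l : path_lift U W c l ->
  path_lift U W (fun t => c (1 - t)) (fun t => l (1 - t)).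
Proof.
move=> [cc Uc cl E].
have r (t : R) : {for t, continuous (fun t : R => 1 - t)}.
  by apply: cvgB; [exact: cvg_cst|exact: cvg_id].
split=> // t; first exact: (@continuous_comp _ _ _ _ c t (r t) (cc _)).
exact: (ccont_comp (r t) (cl _)).
Qed.

Lemma clog1 : clog (1 : R[i]) = 0.
Proof.
by apply: eq_ReIm; rewrite /clog /= /normc2 /= ?mul0r ?atan0 // expr0n expr1n addr0 ln1 mul0r.
Qed.

Lemma path_lift_segment U W z1 z2 (la : R[i]) :
  (forall z, U z -> ccont W z) -> cexp la = W z1 ->
  (forall t, 0 <= t <= 1 -> U (z1 + t *: (z2 - z1)) /\
      0 < Re (W (z1 + t *: (z2 - z1)) / W z1)) ->
  exists c l, path_lift U W c l /\
    [/\ c 0 = z1, c 1 = z2, l 0 = la & l 1 = la + clog (W z2 / W z1)].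
Proof.
move=> cW laE h; pose c t := z1 + clamp 2^-1 2^-1 t *: (z2 - z1).
have W1 : W z1 != 0 by rewrite -laE cexp_neq0.
have h0 : 0 <= (0 : R) <= 1 by rewrite lexx ler01.
have h1 : 0 <= (1 : R) <= 1 by rewrite lexx ler01.
have c0 : c 0 = z1 by rewrite /c clamp01_id // scale0r addr0.
have c1 : c 1 = z2 by rewrite /c clamp01_id // scale1r addrC subrK.
have cc : continuous c.
  move=> t; apply: cvgD; first exact: cvg_cst.
  by apply: cvgZr_tmp; exact: continuous_clamp01.
have hc t := h _ (clamp01 t).
exists c, (fun t => la + clog (W (c t) / W z1)); split; last first.
  by rewrite c0 c1 divff // clog1 addr0.
split=> //; first by move=> t; have [] := hc t.
  move=> t; have [Ut Rt] := hc t.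
  apply: ccontD; first exact: ccont_cst.
  apply: ccont_clog => //; apply: ccontM; last exact: ccont_cst.
  exact: (ccont_comp (cc t) (cW _ Ut)).
by move=> t; have [_ Rt] := hc t; rewrite cexpD laE clogK // mulrC divfK.
Qed.

(** [L z] is the final value of a logarithm continued along any path from [z0] to [z]. Two such
    paths, the second one reversed, form a loop, so [monodromy] gives independence of the path. Near
    [z] a straight segment is a legitimate path, whence [L y = L z + clog (W y / W z)], which yields
    the derivative. *)
Lemma log_exists J U W W1 : domain U -> simply_connected U ->
  (forall z, U z -> W z != 0) -> (forall z, U z -> cdiff J W z (W1 z)) ->
  exists L, forall z, U z -> cexp (L z) = W z /\ cdiff J L z (W1 z / W z).
Proof.
move=> [oU cU [z0 U0]] sU W0 dW.
have cW z : U z -> ccont W z by move=> /dW/cdiff_ccont.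
have [l0 l0E] := cexp_surj (W0 _ U0).
pose lift z la := exists c l, path_lift U W c l /\ [/\ c 0 = z0, c 1 = z, l 0 = l0 & l 1 = la].
have lift_uniq z la lb : lift z la -> lift z lb -> la = lb.
  move=> [c1 [l1 [P1 [a1 b1 d1 e1]]]] [c2 [l2 [P2 [a2 b2 d2 e2]]]].
  have [|c [l [[cc Uc cl lE] [h1 h2 h3 h4]]]] := path_lift_cat P1 (path_lift_rev P2).
    by rewrite subr0 b1 b2.
  have := monodromy sU cW W0 cc Uc _ cl lE; rewrite h1 h2 h3 h4 !subr0 subrr a1 a2 d1 d2 e1 e2.
  move=> /(_ erefl)/eqP; rewrite -subr_eq0 opprD addrA subrr sub0r oppr_eq0 subr_eq0.
  by move=> /eqP.
have liftE z la : lift z la -> cexp la = W z.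
  by move=> [c [l [[_ _ _ E] [_ b _ e]]]]; rewrite -e E b.
have pair_near z : U z -> exists2 B : set (R * R), nbhs z B & forall a b la, B a -> B b ->
    lift a la -> lift b (la + clog (W b / W a)) /\ 0 < Re (W b / W a).
  case: z => x y Uz; have [B nB BP] := ratio_near (W0 _ Uz) (cW _ Uz).
  have nU : \forall y \near (x, y), U y by exact: open_nbhs_nbhs.
  have [e e0 eP] := near_box (filterI nB nU).
  exists [set p | `|p.1 - x| < e /\ `|p.2 - y| < e].
    by apply: (box_near e0) => a b.
  move=> [a1 a2] [b1 b2] la [/= ax ay] [bx bY] lla.
  have conv (s t p : R) : `|s - p| < e -> `|t - p| < e -> forall r, 0 <= r <= 1 ->
      `|s + r * (t - s) - p| < e.
    move=> h1 h2 r /andP[r0 r1].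
    have -> : s + r * (t - s) - p = (1 - r) * (s - p) + r * (t - p) by ring.
    apply: (le_lt_trans (ler_normD _ _)); rewrite !normrM (ger0_norm r0).
    rewrite ger0_norm ?subr_ge0 //.
    have k1 : (1 - r) * `|s - p| <= (1 - r) * e by rewrite ler_wpM2l ?subr_ge0 // ltW.
    have k2 : r * `|t - p| <= r * e by rewrite ler_wpM2l // ltW.
    have [r2|r2] := leP r 2^-1.
      have : (1 - r) * `|s - p| < (1 - r) * e by rewrite ltr_pM2l //; lra.
      lra.
    have : r * `|t - p| < r * e by rewrite ltr_pM2l //; lra.
    lra.
  have Ba := eP _ _ ax ay.
  split; last by apply: BP; [exact: (eP _ _ bx bY).1|exact: Ba.1].
  have [t tP|c' [l' [P' [h1 h2 h3 h4]]]] :=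
      @path_lift_segment U W (a1, a2) (b1, b2) la cW (liftE _ _ lla).
    have Bt := eP _ _ (conv _ _ _ ax bx t tP) (conv _ _ _ ay bY t tP).
    by split; [exact: Bt.2|apply: BP; [exact: Bt.1|exact: Ba.1]].
  have [c [l [P [k1 k2 k3 k4]]]] := lla.
  have [|cc [ll [PP [q1 q2 q3 q4]]]] := path_lift_cat P P'; first by rewrite h1.
  exists cc, ll; split=> //; split; rewrite ?q1 ?q2 ?q3 ?q4 ?h2 //.
  by rewrite h4 h3 k4 subrr addr0.
have lift_ex z : U z -> exists la, lift z la.
  move=> Uz; apply: (@connected_near _ U (fun z => exists la, lift z la) z0 z) => //.
    move=> y Uy; have [B nB BP] := pair_near _ Uy.
    have By := nbhs_singleton nB.
    apply: filterS nB => t Bt; split=> -[la h].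
      by exists (la + clog (W y / W t)); have [] := BP _ _ _ Bt By h.
    by exists (la + clog (W t / W y)); have [] := BP _ _ _ By Bt h.
  exists l0, (fun=> z0), (fun=> l0); split=> //; split=> //.
  - exact: cst_continuous.
  - by move=> t; exact: ccont_cst.
have /choice[L LP] : forall z, exists la, U z -> lift z la.
  move=> z; have [/lift_ex[la h]|h] := pselect (U z); first by exists la.
  by exists 0.
exists L => z Uz; split; first exact: liftE (LP _ Uz).
have [B nB BP] := pair_near _ Uz; have Bz := nbhs_singleton nB.
have nU : \forall y \near z, U y by exact: open_nbhs_nbhs.
have E : \forall y \near z, L z + clog (W y / W z) = L y.
  apply: filterS (filterI nB nU) => y [By Uy].
  have [h _] := BP _ _ _ Bz By (LP _ Uz).
  exact: lift_uniq h (LP _ Uy).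
apply: (cdiff_near E).
have q : cdiff J (fun y => W y / W z) z (W1 z / W z).
  by apply: (cdiff_eq (cdiffM (dW _ Uz) (cdiff_cst J (W z)^-1 z))); rewrite mulr0 addr0.
have q0 : 0 < Re (W z / W z) by rewrite divff ?W0 // Re1 ltr01.
apply: (cdiff_eq (cdiffD (cdiff_cst J (L z) z) (cdiff_clog q0 q))).
by rewrite add0r divff ?W0 // divr1.
Qed.

End Logarithm.

(** * Similarities of isotropic space *)

Section IsotropicGeometry.
Variable R : realType.
Implicit Types (Y Z : 'cV[R]_4) (A : 'M[R]_4).

Lemma sum4 (V : zmodType) (f : 'I_4 -> V) :
  \sum_i f i = f (inord 0) + f (inord 1) + f (inord 2) + f (inord 3).
Proof.
rewrite !big_ord_recr big_ord0 /= add0r.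
by congr (f _ + f _ + f _ + f _); apply: val_inj; rewrite /= inordK.
Qed.

Lemma eq_col4 Y Z : (forall k, (k < 4)%N -> Y (inord k) 0 = Z (inord k) 0) -> Y = Z.
Proof.
by move=> h; apply/matrixP => i j; rewrite (ord1 j) -(inord_val i); apply: h.
Qed.

Lemma minkE Y Z : mink Y Z = - (Y (inord 0) 0 * Z (inord 0) 0) +
  Y (inord 1) 0 * Z (inord 1) 0 + Y (inord 2) 0 * Z (inord 2) 0 +
  Y (inord 3) 0 * Z (inord 3) 0.
Proof.
rewrite /mink /lorentz mul_mx_diag mxE sum4 !mxE.
have e k : (k < 4)%N -> ((inord k : 'I_4) == 0) = (k == 0%N).
  by move=> k4; rewrite -val_eqE /= inordK.
by rewrite !e //=; ring.
Qed.

(** The coordinates [x] and [y] are merged into one complex coordinate, on which the linear parts of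
    similarities act by multiplication. *)
Definition pt (l : R) (w : R[i]) : 'cV[R]_4 := iso_pt l (Re w) (Im w).

Lemma ptE l w : [/\ pt l w (inord 0) 0 = l, pt l w (inord 1) 0 = Re w,
  pt l w (inord 2) 0 = Im w & pt l w (inord 3) 0 = l].
Proof. by rewrite !mxE !inordK. Qed.

Lemma isotropicP Y : isotropic_space Y <-> Y (inord 0) 0 = Y (inord 3) 0.
Proof.
rewrite /isotropic_space /= minkE.
have [-> -> -> ->] := ptE 1 0; rewrite !mulr0 !mulr1 !addr0 addrC.
split; first by move/eqP; rewrite subr_eq0 => /eqP.
by move=> ->; rewrite subrr.
Qed.

Lemma isotropic_pt l w : isotropic_space (pt l w).
Proof. by apply/isotropicP; have [-> _ _ ->] := ptE l w. Qed.

Lemma isotropicE Y : isotropic_space Y ->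
  Y = pt (Y (inord 0) 0) (Complex (Y (inord 1) 0) (Y (inord 2) 0)).
Proof.
move=> /isotropicP E.
have [e0 e1 e2 e3] := ptE (Y (inord 0) 0) (Complex (Y (inord 1) 0) (Y (inord 2) 0)).
by apply: eq_col4; case=> [|[|[|[|//]]]] _; rewrite ?e0 ?e1 ?e2 ?e3 -?E.
Qed.

Definition mat4 (a : nat -> nat -> R) : 'M[R]_4 := \matrix_(i, j) a i j.

Lemma mat4E A : A = mat4 (fun i j => A (inord i) (inord j)).
Proof. by apply/matrixP => i j; rewrite mxE !inord_val. Qed.

Lemma det4 (a : nat -> nat -> R) : let m i j k l := a 0%N i * a 1%N j * a 2%N k * a 3%N l in
  \det (mat4 a) =
    m 0%N 1%N 2%N 3%N - m 0%N 1%N 3%N 2%N - m 0%N 2%N 1%N 3%N + m 0%N 2%N 3%N 1%N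
  + m 0%N 3%N 1%N 2%N - m 0%N 3%N 2%N 1%N - m 1%N 0%N 2%N 3%N + m 1%N 0%N 3%N 2%N
  + m 1%N 2%N 0%N 3%N - m 1%N 2%N 3%N 0%N - m 1%N 3%N 0%N 2%N + m 1%N 3%N 2%N 0%N
  + m 2%N 0%N 1%N 3%N - m 2%N 0%N 3%N 1%N - m 2%N 1%N 0%N 3%N + m 2%N 1%N 3%N 0%N
  + m 2%N 3%N 0%N 1%N - m 2%N 3%N 1%N 0%N - m 3%N 0%N 1%N 2%N + m 3%N 0%N 2%N 1%N
  + m 3%N 1%N 0%N 2%N - m 3%N 1%N 2%N 0%N - m 3%N 2%N 0%N 1%N + m 3%N 2%N 1%N 0%N.
Proof.
rewrite /mat4 !(expand_det_row _ ord0) !big_ord_recl !big_ord0 /cofactor.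
rewrite !(expand_det_row _ ord0) !big_ord_recl !big_ord0 /cofactor.
rewrite !(expand_det_row _ ord0) !big_ord_recl !big_ord0 /cofactor.
rewrite !det_mx11 !mxE /= /bump /=.
rewrite !(expr0, expr1, addn0, add0n, addn1, expr2).
ring.
Qed.

Lemma SO31P (a : nat -> nat -> R) :
  (forall i j, (i < 4)%N -> (j < 4)%N ->
    - (a 0%N i * a 0%N j) + a 1%N i * a 1%N j + a 2%N i * a 2%N j + a 3%N i * a 3%N j =
    if i == j then if i == 0%N then -1 else 1 else 0) <->
  (mat4 a)^T *m lorentz R *m mat4 a = lorentz R.
Proof.
have E (i j : 'I_4) : ((mat4 a)^T *m lorentz R *m mat4 a) i j =
   - (a 0%N i * a 0%N j) + a 1%N i * a 1%N j + a 2%N i * a 2%N j + a 3%N i * a 3%N j.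
  rewrite /lorentz mul_mx_diag mxE sum4 !mxE !inordK //.
  have e k : (k < 4)%N -> ((inord k : 'I_4) == 0) = (k == 0%N).
    by move=> k4; rewrite -val_eqE /= inordK.
  by rewrite !e //=; ring.
have E2 (i j : 'I_4) : lorentz R i j =
    if (i : nat) == j then if (i : nat) == 0%N then -1 else 1 else 0.
  by rewrite /lorentz !mxE -!val_eqE /=; case: ifP => // _; case: ifP.
split=> h; first by apply/matrixP => i j; rewrite E E2 h.
move=> i j i4 j4; have /matrixP/(_ (Ordinal i4) (Ordinal j4)) := h.
by rewrite E E2.
Qed.

Lemma mat4_mul (a : nat -> nat -> R) Y (k : nat) : (k < 4)%N ->
  (mat4 a *m Y) (inord k) 0 = a k 0%N * Y (inord 0) 0 + a k 1%N * Y (inord 1) 0 +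
    a k 2%N * Y (inord 2) 0 + a k 3%N * Y (inord 3) 0.
Proof. by move=> k4; rewrite mxE sum4 !mxE !inordK. Qed.

(** [ka] measures the shear that adds a linear function of [(x, y)] to [l]; it stems from the
    Lorentz transformations that fix [p_vec] and act trivially on [(x, y)]. *)
Definition similarity_form (F : 'cV[R]_4 -> 'cV[R]_4) (la : R) (mu ka : R[i])
    (d : R) (de : R[i]) :=
  forall l w, F (pt l w) = pt (la * l + Re (ka * w) + d) (mu * w + de).

Lemma pt_eq Y l w : Y (inord 0) 0 = l -> Y (inord 1) 0 = Re w -> Y (inord 2) 0 = Im w ->
  Y (inord 3) 0 = l -> Y = pt l w.
Proof.
move=> h0 h1 h2 h3; have [e0 e1 e2 e3] := ptE l w.
by apply: eq_col4; case=> [|[|[|[|//]]]] _; rewrite ?e0 ?e1 ?e2 ?e3.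
Qed.

Lemma form_comp F G la mu ka d de la' mu' ka' d' de' :
  similarity_form F la mu ka d de -> similarity_form G la' mu' ka' d' de' ->
  similarity_form (F \o G) (la * la') (mu * mu') (la%:C * ka' + ka * mu')
    (la * d' + Re (ka * de') + d) (mu * de' + de).
Proof.
move=> hF hG l w; rewrite /= hG hF; congr pt; last by ring.
by rewrite !ReImE; ring.
Qed.

Lemma form_translation l0 w0 : similarity_form (fun Y => Y + pt l0 w0) 1 1 0 l0 w0.
Proof.
move=> l w; have [a0 a1 a2 a3] := ptE l w; have [b0 b1 b2 b3] := ptE l0 w0.
rewrite mul0r Re0 !mul1r addr0.
by apply: pt_eq; rewrite mxE ?a0 ?a1 ?a2 ?a3 ?b0 ?b1 ?b2 ?b3 ?ReD ?ImD.
Qed.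

Lemma form_homothety (la : R) : similarity_form (fun Y => la *: Y) la la%:C 0 0 0.
Proof.
move=> l w; have [a0 a1 a2 a3] := ptE l w.
rewrite mul0r Re0 !addr0.
by apply: pt_eq; rewrite mxE ?a0 ?a1 ?a2 ?a3 // !ReImE mul0r ?subr0 ?addr0.
Qed.

(** [A] preserves the orthogonal complement of [p_vec] and induces an isometry of its quotient by
    [p_vec], the plane of [w]. It acts trivially on [p_vec] and on the quotient of the whole space
    by that complement, so the induced isometry has determinant 1: it is a rotation, the
    multiplication by [mu]. *)
Lemma form_linear A : SO31 A -> A *m p_vec R = p_vec R ->
  exists mu ka, normc2 mu = 1 /\ similarity_form (fun Y => A *m Y) 1 mu ka 0 0.
Proof.
rewrite (mat4E A); set a := fun i j : nat => _; clearbody a => -[/SO31P h dA] hp.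
have hpk k : (k < 4)%N -> a k 0%N + a k 3%N = (k == 0%N)%:R + (k == 3%N)%:R.
  move=> k4; have := congr1 (fun Y : 'cV[R]_4 => Y (inord k) 0) hp.
  rewrite mat4_mul // /p_vec; have [-> -> -> ->] := ptE 1 0.
  rewrite !mulr1 !mulr0 !addr0 => ->; rewrite mxE inordK //.
  by move: k4; case: k => [|[|[|[|//]]]] //= _; rewrite ?addr0 ?add0r.
have c0 := hpk 0%N isT; have c1 := hpk 1%N isT; have c2 := hpk 2%N isT; have c3 := hpk 3%N isT.
rewrite /= ?addr0 ?add0r in c0 c1 c2 c3.
(* Both sides are products with [p_vec]: the product of [A e_j] with [A p_vec = p_vec] equals that
   of [e_j] with [p_vec], and [p_vec = e_0 + e_3]. *)
have r j : (j < 4)%N -> a 3%N j - a 0%N j = (j == 3%N)%:R - (j == 0%N)%:R.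
  move=> j4; have h1 := h 0%N j isT j4; have h2 := h 3%N j isT j4.
  have E : a 3%N j - a 0%N j =
    (- (a 0%N 0%N * a 0%N j) + a 1%N 0%N * a 1%N j + a 2%N 0%N * a 2%N j + a 3%N 0%N * a 3%N j) +
    (- (a 0%N 3%N * a 0%N j) + a 1%N 3%N * a 1%N j + a 2%N 3%N * a 2%N j + a 3%N 3%N * a 3%N j).
    transitivity (- ((a 0%N 0%N + a 0%N 3%N) * a 0%N j) + (a 1%N 0%N + a 1%N 3%N) * a 1%N j +
      (a 2%N 0%N + a 2%N 3%N) * a 2%N j + (a 3%N 0%N + a 3%N 3%N) * a 3%N j); last by ring.
    by rewrite c0 c1 c2 c3; ring.
  rewrite E h1 h2.
  by move: j4; case: j {h1 h2 E} => [|[|[|[|//]]]] //= _; ring.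
have r0 := r 0%N isT; have r1 := r 1%N isT; have r2 := r 2%N isT; have r3 := r 3%N isT.
rewrite /= ?subr0 in r0 r1 r2 r3.
have q11 := h 1%N 1%N isT isT; have q22 := h 2%N 2%N isT isT; have q12 := h 1%N 2%N isT isT.
rewrite /= in q11 q22 q12.
rewrite det4 in dA.
have e03 : a 0%N 3%N = 1 - a 0%N 0%N by lra.
have e13 : a 1%N 3%N = - a 1%N 0%N by lra.
have e23 : a 2%N 3%N = - a 2%N 0%N by lra.
have e30 : a 3%N 0%N = a 0%N 0%N - 1 by lra.
have e31 : a 3%N 1%N = a 0%N 1%N by lra.
have e32 : a 3%N 2%N = a 0%N 2%N by lra.
have e33 : a 3%N 3%N = 2 - a 0%N 0%N by lra.
(* The determinant of [A] reduces to that of its middle block. *)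
have D : a 1%N 1%N * a 2%N 2%N - a 1%N 2%N * a 2%N 1%N = 1.
  by rewrite -dA e03 e13 e23 e30 e31 e32 e33; ring.
rewrite e31 in q11 q12; rewrite e32 in q22 q12.
(* For a 2 by 2 matrix this sum is the sum of the squared entries minus twice the determinant, here
   2 - 2; so the block has the shape of a complex multiplication. *)
have S : (a 1%N 1%N - a 2%N 2%N) ^+ 2 + (a 1%N 2%N + a 2%N 1%N) ^+ 2 = 0.
  transitivity ((- (a 0%N 1%N * a 0%N 1%N) + a 1%N 1%N * a 1%N 1%N + a 2%N 1%N * a 2%N 1%N +
       a 0%N 1%N * a 0%N 1%N) + (- (a 0%N 2%N * a 0%N 2%N) + a 1%N 2%N * a 1%N 2%N +
       a 2%N 2%N * a 2%N 2%N + a 0%N 2%N * a 0%N 2%N) -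
       2 * (a 1%N 1%N * a 2%N 2%N - a 1%N 2%N * a 2%N 1%N)); first by ring.
  by rewrite q11 q22 D; ring.
move/eqP: S; rewrite paddr_eq0 ?sqr_ge0 // !sqrf_eq0 => /andP[/eqP s1 /eqP s2].
have e22 : a 2%N 2%N = a 1%N 1%N by lra.
have e12 : a 1%N 2%N = - a 2%N 1%N by lra.
exists (Complex (a 1%N 1%N) (a 2%N 1%N)), (Complex (a 0%N 1%N) (- a 0%N 2%N)); split.
  by rewrite /normc2 Re_mk Im_mk -q11; ring.
move=> l w; have [b0 b1 b2 b3] := ptE l w.
apply: pt_eq; rewrite mat4_mul // b0 b1 b2 b3 ?(ReImE, Re_mk, Im_mk).
- by rewrite e03; ring.
- by rewrite e13 e12; ring.
- by rewrite e23 e22; ring.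
- by rewrite e30 e31 e32 e33; ring.
Qed.

Lemma isometry_form F : isotropic_isometry F ->
  exists mu ka d de, normc2 mu = 1 /\ similarity_form F 1 mu ka d de.
Proof.
elim=> [b /isotropicE ->|A h1 h2|G H _ [mu [ka [d [de [n f]]]]] _ [mu' [ka' [d' [de' [n' f']]]]]].
- exists 1, 0, (b (inord 0) 0), (Complex (b (inord 1) 0) (b (inord 2) 0)).
  split; last exact: form_translation.
  by rewrite /normc2 Re1 Im1; ring.
- by have [mu [ka [n f]]] := form_linear h1 h2; exists mu, ka, 0, 0.
- exists (mu * mu'); do 3 eexists; split; first by rewrite normc2M n n' mulr1.
  by have f2 := form_comp f f'; rewrite mulr1 in f2; exact: f2.
Qed.

Lemma similarity_formP F : isotropic_similarity F ->
  exists la mu ka d de, [/\ la != 0, normc2 mu = la ^+ 2 & similarity_form F la mu ka d de].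
Proof.
elim=> [{}F /isometry_form[mu [ka [d [de [n f]]]]]|la la0|
  G H _ [la [mu [ka [d [de [l0 n f]]]]]] _ [la' [mu' [ka' [d' [de' [l0' n' f']]]]]]].
- by exists 1, mu, ka, d, de; rewrite oner_eq0 expr1n.
- exists la, la%:C, 0, 0, 0; split=> //; first by rewrite normc2C.
  exact: form_homothety.
- exists (la * la'), (mu * mu'); do 3 eexists; split; last exact: form_comp f f'.
    by rewrite mulf_neq0.
  by rewrite normc2M n n' exprMn.
Qed.

(* Acts on isotropic space by [l |-> l + b1 x + b2 y], fixing [x] and [y]. *)
Definition parabolic (b1 b2 : R) : nat -> nat -> R := fun i j =>
  let b := (b1 ^+ 2 + b2 ^+ 2) / 2 in
  nth 0 (nth [::] [:: [:: 1 + b; b1; b2; - b]; [:: b1; 1; 0; - b1]; [:: b2; 0; 1; - b2];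
    [:: b; b1; b2; 1 - b]] i) j.

Definition rotation (c s : R) : nat -> nat -> R := fun i j =>
  nth 0 (nth [::] [:: [:: 1; 0; 0; 0]; [:: 0; c; - s; 0]; [:: 0; s; c; 0];
    [:: 0; 0; 0; 1]] i) j.

Lemma parabolic_isometry b1 b2 : isotropic_isometry (fun Y => mat4 (parabolic b1 b2) *m Y).
Proof.
apply: isometry_linear; first split.
- by apply/SO31P; case=> [|[|[|[|//]]]]; case=> [|[|[|[|//]]]] //= _ _; rewrite /parabolic /=; field.
- by rewrite det4 /parabolic /=; field.
have [b0 e1 e2 e3] := ptE (1 : R) 0; rewrite -[p_vec R]/(pt 1 0).
apply: pt_eq; rewrite mat4_mul // b0 e1 e2 e3 /parabolic /= ?(Re0, Im0); ring.
Qed.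

Lemma rotation_isometry c s : c ^+ 2 + s ^+ 2 = 1 ->
  isotropic_isometry (fun Y => mat4 (rotation c s) *m Y).
Proof.
move=> cs; apply: isometry_linear; first split.
- by apply/SO31P; case=> [|[|[|[|//]]]]; case=> [|[|[|[|//]]]] //= _ _; rewrite /rotation /=; lra.
- by rewrite det4 /rotation /=; lra.
have [b0 e1 e2 e3] := ptE (1 : R) 0; rewrite -[p_vec R]/(pt 1 0).
apply: pt_eq; rewrite mat4_mul // b0 e1 e2 e3 /rotation /= ?(Re0, Im0); ring.
Qed.

(** Converse of [similarity_formP]: the homothety by [la], the rotation by [mu / la], a shear and a
    translation, in this order. *)
Lemma similarity_exists (la : R) (mu ka : R[i]) (d : R) (de : R[i]) :
  la != 0 -> normc2 mu = la ^+ 2 ->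
  exists2 F, isotropic_similarity F & similarity_form F la mu ka d de.
Proof.
move=> la0 n; pose r := mu / la%:C.
have laC : la%:C != 0 :> R[i] by rewrite eq_complex /= (negbTE la0).
have mu0 : mu != 0 by rewrite -normc2_gt0 n exprn_even_gt0.
have rn : Re r ^+ 2 + Im r ^+ 2 = 1.
  have : normc2 (r * la%:C) = la ^+ 2 by rewrite /r divfK.
  rewrite normc2M normc2C /normc2 => /(congr1 (fun u => u / la ^+ 2)) /=.
  by rewrite mulfK ?expf_neq0 // divff // expf_neq0.
(* The shear is applied when [w] has already become [mu w], hence the division by [mu]. *)
pose k := ka / mu.
pose F1 (Y : 'cV[R]_4) := la *: Y.
pose F2 Y := mat4 (rotation (Re r) (Im r)) *m Y.
pose F3 Y := mat4 (parabolic (Re k) (- Im k)) *m Y.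
pose F4 (Y : 'cV[R]_4) := Y + pt d de.
exists (F4 \o (F3 \o (F2 \o F1))).
  apply: similarity_comp.
    by apply: similarity_isometry; apply: isometry_translation; exact: isotropic_pt.
  apply: similarity_comp; first exact/similarity_isometry/parabolic_isometry.
  apply: similarity_comp; first exact/similarity_isometry/rotation_isometry.
  exact: similarity_homothety.
have f1 := form_homothety la : similarity_form F1 _ _ _ _ _.
have f2 : similarity_form F2 1 r 0 0 0.
  move=> l w; have [b0 e1 e2 e3] := ptE l w.
  by apply: pt_eq; rewrite mat4_mul // b0 e1 e2 e3 /rotation /= ?ReImE; ring.
have f3 : similarity_form F3 1 1 k 0 0.
  move=> l w; have [b0 e1 e2 e3] := ptE l w.
  by apply: pt_eq; rewrite mat4_mul // b0 e1 e2 e3 /parabolic /= ?ReImE; ring.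
have f4 := form_translation d de : similarity_form F4 _ _ _ _ _.
have f := form_comp f4 (form_comp f3 (form_comp f2 f1)).
move=> l w; rewrite f; congr pt.
  have -> : (1%:C * (1%:C * (1%:C * 0 + 0 * la%:C) + k * (r * la%:C)) +
     0 * (1 * (r * la%:C))) = ka.
    transitivity (k * (r * la%:C)); first by rewrite rmorph1; ring.
    by rewrite /k /r divfK // divfK.
  by rewrite !(ReImE, mulr0, addr0, mul0r, mul1r); ring.
by rewrite /r; field.
Qed.

End IsotropicGeometry.

(** * Weierstrass data *)

Section Models.
Variable R : realType.
Implicit Types (z w : R * R) (J d : R[i]) (G F : R * R -> R[i]).

Lemma cdiffN J G z d : cdiff J G z d -> cdiff J (fun y => - G y) z (- d).
Proof.
move=> [h1 h2]; split.
  under eq_fun do rewrite ReN.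
  by apply: (is_diff_ext (is_diffN h1)) => w; rewrite mulNr ReN.
under eq_fun do rewrite ImN.
by apply: (is_diff_ext (is_diffN h2)) => w; rewrite mulNr ImN.
Qed.

Lemma cdiffB J G F z d d' : cdiff J G z d -> cdiff J F z d' ->
  cdiff J (fun y => G y - F y) z (d - d').
Proof. by move=> hG hF; exact: cdiffD hG (cdiffN hF). Qed.

Lemma to_complexE z : to_complex z = jc 'i%C z.
Proof. by apply: eq_ReIm; rewrite /jc !ReImE /=; ring. Qed.

Lemma to_complexK (x : R[i]) : to_complex (to_pair x) = x.
Proof. by case: x. Qed.

(** The outer function is differentiated in the standard complex variable, while the inner one may
    belong to either orientation: models are always written with [i], surfaces with [J]. *)
Lemma cdiff_comp J G z d (k : R[i] -> R[i]) k' : 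
  cdiff 'i%C (fun p => k (to_complex p)) (to_pair (G z)) k' ->
  cdiff J G z d -> cdiff J (fun y => k (G y)) z (k' * d).
Proof.
move=> [k1 k2] [g1 g2].
have p := is_diff_pair g1 g2.
have E w : jc 'i%C (Re (d * jc J w), Im (d * jc J w)) = d * jc J w.
  by apply: eq_ReIm; rewrite /jc !ReImE /=; ring.
split.
  have h := is_diff_comp (p : is_diff z (fun y => to_pair (G y)) _) k1.
  have -> : (fun y => Re (k (G y))) =
      (fun q => Re (k (to_complex q))) \o (fun y => to_pair (G y)).
    by apply/funext => y /=; rewrite to_complexK.
  by apply: (is_diff_ext h) => w /=; rewrite E mulrA.
have h := is_diff_comp (p : is_diff z (fun y => to_pair (G y)) _) k2.
have -> : (fun y => Im (k (G y))) =
    (fun q => Im (k (to_complex q))) \o (fun y => to_pair (G y)).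
  by apply/funext => y /=; rewrite to_complexK.
by apply: (is_diff_ext h) => w /=; rewrite E mulrA.
Qed.

Lemma pt_is_derive (l : R * R -> R) G z v (dl : R) (dG : R[i]) :
  is_derive z v l dl -> is_derive z v (fun y => Re (G y)) (Re dG) ->
  is_derive z v (fun y => Im (G y)) (Im dG) ->
  is_derive z v (fun y => pt (l y) (G y)) (pt dl dG).
Proof.
move=> h0 h1 h2.
have hc (i : 'I_4) (j : 'I_1) : is_derive z v (fun y => pt (l y) (G y) i j) (pt dl dG i j).
  under eq_fun do rewrite mxE; rewrite mxE.
  by case: i => -[|[|[|[|//]]]].
have D : derivable (fun y => pt (l y) (G y)) z v.
  by apply/derivable_mxP => i j; have := hc i j => -[].
apply: DeriveDef => //; rewrite derive_mx //.
by apply/matrixP => i j; rewrite mxE; have h := hc i j; rewrite derive_val.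
Qed.

(** [g] and [w] are explicit primitives of [h f] and [f], so that the surface is [l = Re g],
    [x + i y = w]. *)
Definition model (h f g w : R[i] -> R[i]) := forall z, regular_points f z ->
  cdiff 'i%C (fun p => g (to_complex p)) z (h (to_complex z) * f (to_complex z)) /\
  cdiff 'i%C (fun p => w (to_complex p)) z (f (to_complex z)).

Lemma model_surface h f g k : model h f g k ->
  weierstrass_surface h f (fun z => pt (Re (g (to_complex z))) (k (to_complex z))).
Proof.
move=> m z /m[mg mw] /=.
have [gu _] := cdiff_u mg; have [gv _] := cdiff_v mg.
have [wu wu'] := cdiff_u mw; have [wv wv'] := cdiff_v mw.
split; first exact: isotropic_pt.
  apply: (is_derive_eq (pt_is_derive gu wu wu')).
  by rewrite /pt; congr iso_pt; rewrite ?ReImE ?Re_mk ?Im_mk; ring.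
apply: (is_derive_eq (pt_is_derive gv wv wv')).
by rewrite /pt; congr iso_pt; rewrite ?ReImE ?Re_mk ?Im_mk; ring.
Qed.

(** The Weierstrass representation of [X] itself. Only the real differential of [l] is prescribed;
    no global complex primitive of [h f] is involved. *)
Definition surface_data (S : set (R * R)) (X : R * R -> 'cV[R]_4) J (l : R * R -> R)
    (W f h : R * R -> R[i]) :=
  [/\ forall z, S z -> X z = pt (l z) (W z),
      forall z, S z -> f z != 0,
      forall z, S z -> cdiff J W z (f z)
    & forall z, S z -> is_diff z l (fun w => Re (h z * f z * jc J w))].

Lemma cdiff_pair J G z d : cdiff J G z d ->
  is_derive z (e_u R) (fun y => to_pair (G y)) (to_pair d) /\
  is_derive z (e_v R) (fun y => to_pair (G y)) (to_pair (J * d)).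
Proof.
move=> dG; have [a b] := cdiff_u dG; have [a' b'] := cdiff_v dG.
by split; exact: pair_is_derive.
Qed.

Definition imaginary_unit J := Re J = 0 /\ (Im J = 1 \/ Im J = -1).

(** The relations between [f], [h] and the data of the model at [phi] say that [W - mu k0(phi)] and
    [l - Re (la g0(phi) + ka k0(phi))] have zero derivative. The two constants form the translation
    part of the similarity. *)
Lemma piece_intro S X J l W f h h0 f0 g0 k0 (phi phi1 : R * R -> R[i])
    (la : R) (mu ka : R[i]) :
  domain S -> imaginary_unit J -> surface_data S X J l W f h ->
  model h0 f0 g0 k0 -> (forall k, hol J S k phi) ->
  (forall z, S z -> cdiff J phi z (phi1 z)) ->
  la != 0 -> normc2 mu = la ^+ 2 ->
  (forall z, S z -> f0 (phi z) != 0) ->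
  (forall z, S z -> f z = mu * f0 (phi z) * phi1 z) ->
  (forall z, S z -> mu * h z = la%:C * h0 (phi z) + ka) ->
  piece_up_to_similarity S X h0 f0.
Proof.
move=> [oS cS [z0 Sz0]] [J0 J1] [XE f_neq0 dW dl] m hphi dphi la0 n reg fE hE.
have mu0 : mu != 0 by rewrite -normc2_gt0 n exprn_even_gt0.
have mz z : S z -> cdiff J (fun y => g0 (phi y)) z (h0 (phi z) * f0 (phi z) * phi1 z) /\
    cdiff J (fun y => k0 (phi y)) z (f0 (phi z) * phi1 z).
  move=> Sz; have [|mg mw] := m (to_pair (phi z)).
    by rewrite /regular_points /= to_complexK reg.
  rewrite to_complexK in mg mw.
  by split; apply: cdiff_comp => //; exact: dphi.
pose de := W z0 - mu * k0 (phi z0).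
pose d := l z0 - Re (la%:C * g0 (phi z0) + ka * k0 (phi z0)).
have EW z : S z -> W z = mu * k0 (phi z) + de.
  move=> Sz; apply/eqP; rewrite addrC -subr_eq; apply/eqP.
  apply: (@cdiff0_const _ J S (fun y => W y - mu * k0 (phi y))) => // y Sy.
  have [_ mw] := mz _ Sy.
  apply: (cdiff_eq (cdiffB (dW _ Sy) (cdiffM (cdiff_cst J mu _) mw))).
  by rewrite fE //; ring.
have El z : S z -> l z = Re (la%:C * g0 (phi z) + ka * k0 (phi z)) + d.
  move=> Sz; apply/eqP; rewrite addrC -subr_eq; apply/eqP.
  have dz y : S y -> cdiff J (fun y => (l y - Re (la%:C * g0 (phi y) + ka * k0 (phi y)))%:C) y 0.
    move=> Sy; have [mg mw] := mz _ Sy.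
    have [c1 _] := cdiffD (cdiffM (cdiff_cst J la%:C _) mg) (cdiffM (cdiff_cst J ka _) mw).
    have k := is_diffB (dl _ Sy) c1.
    split; last by apply: (is_diff_ext (is_diff_cst _ _)) => w; rewrite mul0r.
    apply: (is_diff_ext k) => w; rewrite !fctE -ReN -ReD; congr Re.
    transitivity ((h y * f y - (la%:C * h0 (phi y) + ka) * (f0 (phi y) * phi1 y)) * jc J w).
      by ring.
    by rewrite -hE // fE //; ring.
  exact: (congr1 (fun u => Re u) (cdiff0_const oS cS dz Sz Sz0)).
have [F simF FE] := similarity_exists ka d de la0 n.
exists (fun z => pt (Re (g0 (to_complex z))) (k0 (to_complex z))), F, (fun z => to_pair (phi z)).
split=> //; first exact: model_surface.
- by move=> k; exact: hol_Ck.
- move=> z Sz; have [pu pv] := cdiff_pair (dphi _ Sz).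
  have p1 : phi1 z != 0.
    (* [f] does not vanish and has the factor [phi1]; this makes [phi] a local diffeomorphism, its
       Jacobian being [Im J] times [normc2 (phi1 z)]. *)
    by have := f_neq0 _ Sz; rewrite fE // mulf_eq0 negb_or => /andP[].
  have [_ eu] := pu; have [_ ev] := pv.
  rewrite /jacobian /pd_u /pd_v eu ev /= !ReImE J0.
  have -> : Re (phi1 z) * (0 * Im (phi1 z) + Im J * Re (phi1 z)) -
    (0 * Re (phi1 z) - Im J * Im (phi1 z)) * Im (phi1 z) = Im J * normc2 (phi1 z).
    by rewrite /normc2; ring.
  apply: mulf_neq0; last by rewrite gt_eqF // normc2_gt0.
  by case: J1 => ->; rewrite ?oppr_eq0 oner_eq0.
- move=> z Sz; split; first by rewrite /regular_points /= to_complexK reg.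
  rewrite to_complexK FE XE // EW // El //.
  by rewrite !ReImE; congr pt; ring.
Qed.

Lemma cdiff_to_complex z : cdiff 'i%C (@to_complex R) z 1.
Proof. by rewrite (funext to_complexE); exact: cdiff_jc. Qed.

Lemma plane_model : model (fun=> 0) (fun=> 1) (fun=> 0) id.
Proof.
move=> z _; split; last exact: cdiff_to_complex.
by apply: (cdiff_eq (cdiff_cst _ _ _)); rewrite mul0r.
Qed.

Lemma trivial_enneper_model : model (fun x => x) (fun=> 1) (fun x => x * x * 2^-1) id.
Proof.
move=> z _; split; last exact: cdiff_to_complex.
apply: (cdiff_eq (cdiffM (cdiffM (cdiff_to_complex z) (cdiff_to_complex z)) (cdiff_cst _ _ _))).
by field.
Qed.

Lemma catenoid_model : model (fun x => cexp x) (fun x => cexp (- x)) id (fun x => - cexp (- x)).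
Proof.
move=> z _; split.
  by apply: (cdiff_eq (cdiff_to_complex z)); rewrite -cexpD subrr cexp0.
apply: (cdiff_eq (cdiffN (cdiff_cexp (cdiffN (cdiff_to_complex z))))).
by ring.
Qed.

Lemma enneper_model : model (fun x => 1 / x) (fun x => x ^+ 2) (fun x => x * x * 2^-1)
  (fun x => x * (x * x) * 3^-1).
Proof.
move=> z; rewrite /regular_points /= expf_eq0 /= => z0.
have c := cdiff_to_complex z.
split.
  by apply: (cdiff_eq (cdiffM (cdiffM c c) (cdiff_cst _ _ _))); field.
by apply: (cdiff_eq (cdiffM (cdiffM c (cdiffM c c)) (cdiff_cst _ _ _))); field.
Qed.

Lemma csinh_double (x : R[i]) : csinh x = 2 * csinh (x / 2) * ccosh (x / 2).
Proof.
rewrite /csinh /ccosh {1 2}(_ : x = x / 2 + x / 2); last by field.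
rewrite opprD !cexpD cexpN; field.
by rewrite cexp_neq0.
Qed.

Lemma ccosh_double (x : R[i]) : ccosh x = 1 + 2 * csinh (x / 2) ^+ 2.
Proof.
rewrite /csinh /ccosh {1 2}(_ : x = x / 2 + x / 2); last by field.
rewrite opprD !cexpD cexpN; field.
by rewrite cexp_neq0.
Qed.

(** Existence takes [alpha] equal to 1: rescaling [z], followed by a homothety, turns the parameters
    [(alpha, beta)] into [(1, beta / alpha)]. *)
Lemma bonnet_model (be : R) : 0 < be -> let a : R[i] := Complex 1 0 in
  let b : R[i] := Complex be 0 in
  model (fun x => a / b * ccoth (a * x / 2))
        (fun x => 2 * b / a ^+ 2 * csinh (a * x / 2) ^+ 2)
        (fun x => ccosh x) (fun x => b * (csinh x - x)).
Proof.
move=> be0 a b z; have a1 : a = 1 by [].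
have b0 : b != 0 by rewrite eq_complex /= gt_eqF.
rewrite /regular_points /= a1 !mul1r expr1n divr1 mulf_eq0 negb_or expf_eq0 /= => /andP[_ s0].
have c := cdiff_to_complex z.
have e1 := cdiff_cexp c; have e2 := cdiff_cexp (cdiffN c).
split.
  apply: (cdiff_eq (cdiffM (cdiffD e1 e2) (cdiff_cst _ _ _))).
  transitivity (csinh (to_complex z)); first by rewrite /csinh; field.
  by rewrite csinh_double /ccoth; field; rewrite s0 b0.
have e4 := cdiffM (cdiffB e1 e2) (cdiff_cst _ 2^-1 z).
apply: (cdiff_eq (cdiffM (cdiff_cst _ b _) (cdiffB e4 c))).
transitivity (b * (ccosh (to_complex z) - 1)); first by rewrite /ccosh; field.
by rewrite ccosh_double; field.
Qed.

End Models.

(** * Integration of the structure equations *)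

Section Cases.
Variable R : realType.
Variables (S : set (R * R)) (X : R * R -> 'cV[R]_4) (J : R[i]) (l : R * R -> R).
Variables (W f h P P1 P2 : R * R -> R[i]).
Hypothesis domS : domain S.
Hypothesis J_unit : imaginary_unit J.
Hypothesis dataS : surface_data S X J l W f h.
Hypothesis hW : forall k, hol J S k W.
Hypothesis hf : forall k, hol J S k f.
Hypothesis hP : forall k, hol J S k P.
Hypothesis hP1 : forall k, hol J S k P1.
Hypothesis dh : forall z, S z -> cdiff J h z (P z * f z).

Let dW z (Sz : S z) : cdiff J W z (f z) := let: And4 _ _ a _ := dataS in a z Sz.

Lemma constant_on (G : R * R -> R[i]) : (forall z, S z -> cdiff J G z 0) ->
  exists a, forall z, S z -> G z = a.
Proof.
case: domS => oS cS [z0 Sz0] dG; exists (G z0) => z Sz.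
exact: (cdiff0_const oS cS dG).
Qed.

(** [h] is then constant and is absorbed by the shear; [W] itself is the parameter. *)
Lemma plane_case : (forall z, S z -> P z = 0) -> exists h0 f0,
  weierstrass_data plane h0 f0 /\ piece_up_to_similarity S X h0 f0.
Proof.
move=> P0; exists (fun=> 0), (fun=> 1); split; first exact: plane_data.
have [a aE] : exists a, forall z, S z -> h z = a.
  by apply: constant_on => z Sz; apply: (cdiff_eq (dh Sz)); rewrite P0 // mul0r.
apply: (@piece_intro _ _ _ _ _ _ _ _ _ _ _ _ W f 1 1 a domS J_unit dataS (@plane_model R)) => //.
- by rewrite /normc2 Re1 Im1; ring.
- by move=> z _; rewrite !mul1r.
- by move=> z Sz; rewrite aE // mulr0 add0r mul1r.
Qed.

Lemma real_complex_neq0 (a : R) : (a%:C != 0 :> R[i]) = (a != 0).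
Proof. by rewrite eq_complex /= eqxx andbT. Qed.

Lemma mul_conj (x : R[i]) : x * conjc x = (normc2 x)%:C.
Proof. by case: x => a b; apply: eq_ReIm; rewrite /normc2 !ReImE /=; ring. Qed.

Lemma trivial_enneper_case (p : R[i]) : p != 0 -> (forall z, S z -> P z = p) ->
  exists h0 f0, weierstrass_data trivial_enneper h0 f0 /\ piece_up_to_similarity S X h0 f0.
Proof.
move=> p0 PE; exists (fun x => x), (fun=> 1); split; first exact: trivial_enneper_data.
pose q := complex.sqrtc p; have qE : q ^+ 2 = p by exact: sqr_sqrtc.
have q0 : q != 0 by apply: contra p0 => /eqP q0; rewrite -qE q0 expr0n.
have n0 : 0 < normc2 q by rewrite normc2_gt0.
pose s := Num.sqrt (normc2 q); have s0 : 0 < s by rewrite sqrtr_gt0.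
have s2 : s ^+ 2 = normc2 q by rewrite sqr_sqrtr // ltW.
have sC : s%:C != 0 :> R[i] by rewrite real_complex_neq0 gt_eqF.
have cq : q * conjc q = s%:C ^+ 2 by rewrite mul_conj -s2 rmorphXn.
(* With [h = p W + a] and the parameter [W / mu], matching requires [mu^2 p = la] and [|mu| = |la|],
   so both moduli equal [1 / |p|]. The phase of [mu] is opposite to that of the root [q] of [p], and
   [s^2 = |p|]. *)
pose mu := conjc q / s%:C ^+ 3.
have muE : mu * mu * p = (s%:C ^+ 2)^-1.
  transitivity ((q * conjc q) ^+ 2 / s%:C ^+ 6); first by rewrite -qE /mu; field.
  by rewrite cq; field.
have mu0 : mu != 0.
  rewrite mulf_neq0 ?invr_eq0 ?expf_neq0 //.
  by apply: contra q0 => /eqP h0; have := cq; rewrite h0 mulr0 => /esym/eqP; rewrite expf_eq0 (negbTE sC).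
have [a aE] : exists a, forall z, S z -> h z - p * W z = a.
  apply: constant_on => z Sz.
  apply: (cdiff_eq (cdiffB (dh Sz) (cdiffM (cdiff_cst J p z) (dW Sz)))).
  by rewrite PE //; ring.
have mW : forall z, S z -> cdiff J (fun z => mu^-1 * W z) z (mu^-1 * f z).
  by move=> z Sz; apply: (cdiff_eq (cdiffM (cdiff_cst J mu^-1 z) (dW Sz))); ring.
apply: (@piece_intro _ _ _ _ _ _ _ _ _ _ _ _ (fun z => mu^-1 * W z)
  (fun z => mu^-1 * f z) (s ^+ 2)^-1 mu (mu * a) domS J_unit dataS (@trivial_enneper_model R)) => //.
- by move=> k; apply: holM => //; exact: hol_cst.
- by rewrite invr_eq0 expf_neq0 // gt_eqF.
- have : normc2 (mu * mu * p) = (s ^+ 2)^-1 ^+ 2.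
    by rewrite muE -rmorphXn -fmorphV normc2C.
  have np : normc2 p = s ^+ 2 * s ^+ 2 by rewrite -qE expr2 normc2M -s2.
  rewrite (normc2M (mu * mu)) (normc2M mu) np => e.
  have n2 : 0 <= normc2 mu by exact: normc2_ge0.
  have : (normc2 mu * s ^+ 2) ^+ 2 = (s ^+ 2)^-1 ^+ 2 by rewrite -e; ring.
  have h1 : 0 <= normc2 mu * s ^+ 2 by rewrite mulr_ge0 // sqr_ge0.
  have h2 : 0 <= (s ^+ 2)^-1 by rewrite invr_ge0 sqr_ge0.
  move/eqP; rewrite (eqrXn2 _ h1 h2) // => /eqP e2.
  have s20 : s ^+ 2 != 0 by rewrite expf_neq0 // gt_eqF.
  by apply: (mulIf s20); rewrite e2; field; rewrite gt_eqF.
- by move=> z _; rewrite mulr1 mulVKf.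
- move=> z Sz; have -> : h z = p * W z + a by rewrite -(aE _ Sz); ring.
  have -> : ((s ^+ 2)^-1)%:C = mu * mu * p by rewrite muE fmorphV rmorphXn.
  by field.
Qed.

Hypothesis P_neq0 : forall z, S z -> P z != 0.
Hypothesis dP : forall z, S z -> cdiff J P z (P1 z * f z).
Hypothesis dP1 : forall z, S z -> cdiff J P1 z (P2 z * f z).
Variable c : R.
Hypothesis ode : forall z, S z -> 4 * P z * P2 z = 7 * P1 z ^+ 2 - 8 * c%:C * P z ^+ 3.

Let P2E z : S z -> P2 z = (7 * P1 z ^+ 2 - 8 * c%:C * P z ^+ 3) / (4 * P z).
Proof. by move=> Sz; rewrite -ode //; field; exact: P_neq0. Qed.

(** [D] has the same derivative as [h], because [P1^2 = 8 c P^3]. On the catenoid [h0] is the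
    exponential, so the parameter is a logarithm of [D]; its derivative [P1 f / (2 P)] then leaves
    only [mu = 1 / (2 c)]. *)
Lemma catenoid_case : simply_connected S -> c != 0 ->
  (forall z, S z -> P1 z ^+ 2 = 8 * c%:C * P z ^+ 3) ->
  exists h0 f0, weierstrass_data catenoid h0 f0 /\ piece_up_to_similarity S X h0 f0.
Proof.
move=> scS c0 E; exists (fun x => cexp x), (fun x => cexp (- x)); split; first exact: catenoid_data.
have cC : c%:C != 0 :> R[i] by rewrite real_complex_neq0.
have P10 z : S z -> P1 z != 0.
  move=> Sz; have : P1 z ^+ 2 != 0 by rewrite E // !mulf_neq0 ?expf_neq0 ?P_neq0 ?pnatr_eq0.
  by rewrite sqrf_eq0.
have P2E' z : S z -> P2 z = 3 * P1 z ^+ 2 / (2 * P z).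
  by move=> Sz; rewrite P2E // -E //; field; exact: P_neq0.
pose D z := P1 z * (P z)^-1 * (4 * c%:C)^-1.
have dD z : S z -> cdiff J D z (P1 z ^+ 2 / (2 * P z ^+ 2) * (4 * c%:C)^-1 * f z).
  move=> Sz; have Pz := P_neq0 Sz.
  apply: (cdiff_eq (cdiffM (cdiffM (dP1 Sz) (cdiffV Pz (dP Sz))) (cdiff_cst J (4 * c%:C)^-1 z))).
  by rewrite P2E' //; field; rewrite cC Pz.
have D0 z : S z -> D z != 0.
  by move=> Sz; rewrite !mulf_neq0 ?invr_eq0 ?mulf_neq0 ?P10 ?P_neq0 ?pnatr_eq0.
have [L LP] := log_exists domS scS D0 dD.
have dL z : S z -> cdiff J L z (P1 z * (P z)^-1 * 2^-1 * f z).
  move=> Sz; have [_ h1] := LP _ Sz; apply: (cdiff_eq h1).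
  by rewrite /D; field; rewrite cC P_neq0 // P10.
have [a aE] : exists a, forall z, S z -> h z - D z = a.
  apply: constant_on => z Sz; apply: (cdiff_eq (cdiffB (dh Sz) (dD _ Sz))).
  by rewrite E //; field; rewrite cC P_neq0.
have cC2 : ((2 * c)^-1)%:C = (2 * c%:C)^-1 :> R[i].
  by rewrite fmorphV rmorphM rmorph_nat.
apply: (@piece_intro _ _ _ _ _ _ _ _ _ _ _ _ L (fun z => P1 z * (P z)^-1 * 2^-1 * f z)
  (2 * c)^-1 ((2 * c)^-1)%:C (((2 * c)^-1)%:C * a) domS J_unit dataS (@catenoid_model R)) => //.
- move=> k; apply: holW; exists (fun z => P1 z * (P z)^-1 * 2^-1 * f z) => //.
  apply: holM => //; apply: holM; last exact: hol_cst.
  by apply: holM => //; exact: holV.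
- by rewrite invr_eq0 mulf_neq0.
- by rewrite normc2C.
- by move=> z _; exact: cexp_neq0.
- move=> z Sz; have [e _] := LP _ Sz; rewrite cexpN e /D cC2; field.
  by rewrite cC P_neq0 // P10.
- move=> z Sz; have [e _] := LP _ Sz; rewrite e -(aE _ Sz); ring.
Qed.

Lemma enneper_case (e : R[i]) : c = 0 -> e != 0 ->
  (forall z, S z -> P1 z ^+ 4 = e * P z ^+ 7) ->
  exists h0 f0, weierstrass_data enneper h0 f0 /\ piece_up_to_similarity S X h0 f0.
Proof.
move=> c0 e0 E; exists (fun x => 1 / x), (fun x => x ^+ 2); split; first exact: enneper_data.
have P10 z : S z -> P1 z != 0.
  move=> Sz; have : P1 z ^+ 4 != 0 by rewrite E // !mulf_neq0 ?expf_neq0 ?P_neq0.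
  by rewrite expf_eq0.
have P2E' z : S z -> P2 z = 7 * P1 z ^+ 2 / (4 * P z).
  by move=> Sz; rewrite P2E // c0 mulr0 mul0r subr0.
pose s := Num.sqrt (normc2 e); have s0 : 0 < s by rewrite sqrtr_gt0 normc2_gt0.
have s2 : s ^+ 2 = normc2 e by rewrite sqr_sqrtr // normc2_ge0.
(* Matching [f] with [mu phi^2 phi1] amounts to [mu^2 = - la^3 e / 256]; together with [|mu| = |la|]
   this gives [la = 256 / |e|], where [s = |e|]. *)
pose la := 256 / s; have la0 : 0 < la by rewrite divr_gt0 ?ltr0n.
have laC : la%:C != 0 :> R[i] by rewrite real_complex_neq0 gt_eqF.
pose mu := complex.sqrtc (- (la%:C ^+ 3 * e / 256)).
have muE : mu ^+ 2 = - (la%:C ^+ 3 * e / 256) by exact: sqr_sqrtc.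
have mu0 : mu != 0.
  rewrite -sqrf_eq0 muE oppr_eq0 !mulf_neq0 ?expf_neq0 ?invr_eq0 ?pnatr_eq0 //.
(* By the equation for [P2], [h] is [4 P^2 / P1] up to a constant; [q] makes [mu h] equal to
   [la / phi] up to a constant. *)
pose q := la%:C / (4 * mu).
pose phi z := q * (P1 z * (P z ^+ 2)^-1).
pose phi1 z := - (la%:C / (16 * mu)) * (P1 z ^+ 2 / P z ^+ 3) * f z.
have dphi z : S z -> cdiff J phi z (phi1 z).
  move=> Sz; have Pz := P_neq0 Sz; have Pz2 : P z * P z != 0 by rewrite mulf_neq0.
  have d := cdiffM (cdiff_cst J q z) (cdiffM (dP1 Sz) (cdiffV Pz2 (cdiffM (dP Sz) (dP Sz)))).
  have -> : phi = (fun y => q * (P1 y * (P y * P y)^-1)) by apply/funext => y; rewrite /phi expr2.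
  apply: (cdiff_eq d); rewrite /phi1 /q P2E' //; field.
  by rewrite mu0 Pz.
have phi0 z : S z -> phi z != 0.
  move=> Sz; rewrite /phi /q !mulf_neq0 ?invr_eq0 ?mulf_neq0 ?expf_neq0 ?P10 ?P_neq0 ?pnatr_eq0 //.
have [a aE] : exists a, forall z, S z -> h z - 4 * ((P z * P z) * (P1 z)^-1) = a.
  apply: constant_on => z Sz.
  have d := cdiffM (cdiff_cst J 4 z) (cdiffM (cdiffM (dP Sz) (dP Sz)) (cdiffV (P10 _ Sz) (dP1 Sz))).
  apply: (cdiff_eq (cdiffB (dh Sz) d)).
  by rewrite P2E' //; field; rewrite P10 // P_neq0.
apply: (@piece_intro _ _ _ _ _ _ _ _ _ _ _ _ phi phi1 la mu (mu * a) domS J_unit dataS (@enneper_model R)) => //.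
- move=> k; apply: holM; first exact: hol_cst.
  apply: holM => //; apply: holV; first by move=> z Sz; rewrite expf_neq0 ?P_neq0.
  by rewrite (_ : (fun z => P z ^+ 2) = (fun z => P z * P z)); [exact: holM|apply/funext => z; rewrite expr2].
- by rewrite gt_eqF.
- have : normc2 (mu ^+ 2) = la ^+ 4.
    have -> : mu ^+ 2 = (- (la ^+ 3 / 256))%:C * e.
      have -> : (- (la ^+ 3 / 256))%:C = - (la%:C ^+ 3 / 256) :> R[i].
        by rewrite rmorphN /= rmorphM /= (rmorphXn (real_complex R)) fmorphV rmorph_nat.
      by rewrite muE; ring.
    rewrite normc2M normc2C -s2 /la; field.
    by rewrite gt_eqF.
  rewrite expr2 normc2M -expr2 (exprM la 2 2) => /eqP.
  by rewrite eqrXn2 ?normc2_ge0 ?sqr_ge0 // => /eqP.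
- by move=> z Sz; rewrite expf_neq0 // phi0.
- move=> z Sz; have Pz := P_neq0 Sz.
  transitivity ((- (la%:C ^+ 3 * e / 256)) / mu ^+ 2 * f z).
    by rewrite muE divff ?mul1r // -muE expf_neq0.
  transitivity (- (la%:C ^+ 3 / 256) * (P1 z ^+ 4 / P z ^+ 7) / mu ^+ 2 * f z).
    by rewrite E //; field; rewrite mu0 Pz.
  by rewrite /phi /phi1 /q; field; rewrite mu0 Pz.
- move=> z Sz; have -> : h z = 4 * ((P z * P z) * (P1 z)^-1) + a by rewrite -(aE _ Sz); ring.
  by rewrite /phi /q; field; rewrite mu0 laC P_neq0 // P10.
Qed.

(** Lets [coth (x / 2) = H] be solved through the exponential of [x] alone, without choosing a
    logarithm. *)
Lemma coth_half (x H : R[i]) : H - 1 != 0 -> H + 1 != 0 ->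
  cexp x = (H + 1) / (H - 1) ->
  ccoth (x / 2) = H /\ csinh (x / 2) ^+ 2 = (H ^+ 2 - 1)^-1.
Proof.
move=> Hm Hp E; set e := cexp (x / 2).
have e0 : e != 0 by exact: cexp_neq0.
have e2 : e * e = (H + 1) / (H - 1).
  by rewrite -E /e -cexpD; congr cexp; field.
have sE : csinh (x / 2) = (e * e - 1) / (2 * e) by rewrite /csinh cexpN -/e; field.
have cE : ccosh (x / 2) = (e * e + 1) / (2 * e) by rewrite /ccosh cexpN -/e; field.
have k1 : e * e - 1 = 2 / (H - 1) by rewrite e2; field.
have k2 : e * e + 1 = 2 * H / (H - 1) by rewrite e2; field.
split; first by rewrite /ccoth sE cE k1 k2; field; rewrite e0 Hm.
rewrite sE k1; transitivity (((H - 1) ^+ 2 * (e * e))^-1); first by field; rewrite e0 Hm.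
by rewrite e2; congr (_^-1); field.
Qed.

(** [H] has [W]-derivative [- 2 c nu P], so [h] is an affine function of [H]. As the data of the
    model have [h0] proportional to [coth (z / 2)], the parameter must satisfy
    [H = coth (phi / 2)]. *)
Lemma bonnet_case (e : R[i]) : c != 0 -> e != 0 ->
  (forall z, S z -> (P1 z ^+ 2 - 8 * c%:C * P z ^+ 3) ^+ 2 = e * P z ^+ 7) ->
  exists h0 f0, weierstrass_data bonnet h0 f0 /\ piece_up_to_similarity S X h0 f0.
Proof.
move=> c0 e0 E.
have cC : c%:C != 0 :> R[i] by rewrite real_complex_neq0.
pose De z := P1 z ^+ 2 - 8 * c%:C * P z ^+ 3.
have De0 z : S z -> De z != 0.
  by move=> Sz; rewrite -sqrf_eq0 E // mulf_neq0 // expf_neq0 // P_neq0.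
(* This normalization of [e] makes [H^2 = P1^2 / (8 c P^3)], and [H^2 - 1], the inverse square of
   [sinh (phi / 2)], equal to [De / (8 c P^3)]. *)
pose nu := complex.sqrtc (e / (512 * c%:C ^+ 3)).
have nuE : nu ^+ 2 = e / (512 * c%:C ^+ 3) by exact: sqr_sqrtc.
have nu0 : nu != 0.
  rewrite -sqrf_eq0 nuE; apply: (mulf_neq0 e0); rewrite invr_eq0.
  by apply: mulf_neq0; [rewrite pnatr_eq0|exact: expf_neq0].
have eE : e = 512 * c%:C ^+ 3 * nu ^+ 2 by rewrite nuE; field.
have E' z : S z -> De z ^+ 2 = 512 * c%:C ^+ 3 * nu ^+ 2 * P z ^+ 7 by move=> Sz; rewrite E // eE.
pose la := - (2 * c)^-1.
have la0 : la != 0 by rewrite oppr_eq0 invr_eq0 mulf_neq0.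
have laC : la%:C = - (2 * c%:C)^-1 by rewrite /la rmorphN /= fmorphV rmorphM /= rmorph_nat.
pose s := Num.sqrt (normc2 nu); have s0 : 0 < s by rewrite sqrtr_gt0 normc2_gt0.
have s2 : s ^+ 2 = normc2 nu by rewrite sqr_sqrtr // normc2_ge0.
(* [be] is determined by [|mu| = |la|], since [mu = nu / be] and [s = |nu|]. *)
pose be := s / `|la|; have be0 : 0 < be by rewrite divr_gt0 // normr_gt0.
have beC : be%:C != 0 :> R[i] by rewrite real_complex_neq0 gt_eqF.
pose mu := nu / be%:C.
pose H z := - (8 * c%:C * nu) * (P1 z * (P z * P z) * (De z)^-1).
have H2 z : S z -> H z ^+ 2 = P1 z ^+ 2 / (8 * c%:C * P z ^+ 3).
  move=> Sz; have Pz := P_neq0 Sz.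
  transitivity (64 * c%:C ^+ 2 * nu ^+ 2 * P1 z ^+ 2 * P z ^+ 4 / De z ^+ 2).
    by rewrite /H; field; rewrite De0.
  by rewrite E' //; field; rewrite nu0 cC Pz.
have H21 z : S z -> H z ^+ 2 - 1 = De z / (8 * c%:C * P z ^+ 3).
  by move=> Sz; rewrite H2 // /De; field; rewrite cC P_neq0.
have H210 z : S z -> H z ^+ 2 - 1 != 0.
  move=> Sz; rewrite H21 // mulf_neq0 ?De0 // invr_eq0 !mulf_neq0 ?expf_neq0 ?P_neq0 ?pnatr_eq0 //.
have Hfac z : (H z - 1) * (H z + 1) = H z ^+ 2 - 1 by ring.
have Hm z : S z -> H z - 1 != 0.
  by move=> Sz; have := H210 _ Sz; rewrite -Hfac mulf_eq0 negb_or => /andP[].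
have Hp z : S z -> H z + 1 != 0.
  by move=> Sz; have := H210 _ Sz; rewrite -Hfac mulf_eq0 negb_or => /andP[].
have dDe z : S z -> cdiff J De z ((2 * P1 z * P2 z - 24 * c%:C * P z ^+ 2 * P1 z) * f z).
  move=> Sz; have -> : De = (fun y => P1 y * P1 y - 8 * c%:C * (P y * (P y * P y))).
    by apply/funext => y; rewrite /De; ring.
  apply: (cdiff_eq (cdiffB (cdiffM (dP1 Sz) (dP1 Sz))
    (cdiffM (cdiff_cst J (8 * c%:C) z) (cdiffM (dP Sz) (cdiffM (dP Sz) (dP Sz)))))).
  by ring.
have dH z : S z -> cdiff J H z (- (2 * c%:C * nu * P z) * f z).
  move=> Sz; have Pz := P_neq0 Sz; have Dz := De0 _ Sz.
  apply: (cdiff_eq (cdiffM (cdiff_cst J (- (8 * c%:C * nu)) z)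
    (cdiffM (cdiffM (dP1 Sz) (cdiffM (dP Sz) (dP Sz))) (cdiffV Dz (dDe _ Sz))))).
  rewrite P2E //; rewrite /De in Dz *; field.
  by rewrite Dz Pz.
have key z : S z -> 8 * c%:C * nu ^+ 2 * P z / (H z ^+ 2 - 1) ^+ 2 = 1.
  move=> Sz; have Pz := P_neq0 Sz; rewrite H21 //.
  transitivity (512 * c%:C ^+ 3 * nu ^+ 2 * P z ^+ 7 / De z ^+ 2); first by field; rewrite cC Pz De0.
  by rewrite -E' // divff // expf_neq0 // De0.
have [a aE] : exists a, forall z, S z -> h z - - (2 * c%:C * nu)^-1 * H z = a.
  apply: constant_on => z Sz.
  apply: (cdiff_eq (cdiffB (dh Sz) (cdiffM (cdiff_cst J (- (2 * c%:C * nu)^-1) z) (dH _ Sz)))).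
  by field; rewrite nu0 cC.
(* The model satisfies [w = be (sinh z - z)], hence [z = sinh z - w / be]; here
   [sinh phi = 2 H / (H^2 - 1)], and [w / be] corresponds to [W / nu] up to a constant. So the
   parameter is explicit, up to the additive constant [k] fixed below. *)
pose psi z := 2 * (H z * (H z * H z - 1)^-1) - nu^-1 * W z.
pose phi1 z := - (2 / (H z ^+ 2 - 1)) * (- (2 * c%:C * nu * P z)) * f z.
have HH0 z : S z -> H z * H z - 1 != 0 by move=> Sz; rewrite -expr2 H210.
have dpsi z : S z -> cdiff J psi z (phi1 z).
  move=> Sz; have Hz := HH0 _ Sz.
  apply: (cdiff_eq (cdiffB (cdiffM (cdiff_cst J 2 z) (cdiffM (dH _ Sz)
    (cdiffV Hz (cdiffB (cdiffM (dH _ Sz) (dH _ Sz)) (cdiff_cst J 1 z)))))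
    (cdiffM (cdiff_cst J nu^-1 z) (dW Sz)))).
  rewrite /phi1; have Hz' := H210 _ Sz.
  have -> : nu^-1 * f z = nu^-1 * (8 * c%:C * nu ^+ 2 * P z / (H z ^+ 2 - 1) ^+ 2) * f z.
    by rewrite key // mulr1.
  by field; rewrite nu0 Hz'.
have [K KE] : exists K, forall z, S z -> cexp (psi z) * ((H z - 1) * (H z + 1)^-1) = K.
  apply: constant_on => z Sz; have Hz := Hp _ Sz; have Hz' := Hm _ Sz.
  apply: (cdiff_eq (cdiffM (cdiff_cexp (dpsi _ Sz)) (cdiffM (cdiffB (dH _ Sz) (cdiff_cst J 1 z))
    (cdiffV Hz (cdiffD (dH _ Sz) (cdiff_cst J 1 z)))))).
  by rewrite /phi1 -Hfac; field; rewrite Hz Hz'.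
have [z0 Sz0] : S !=set0 by case: domS.
have K0 : K != 0.
  by rewrite -(KE _ Sz0) !mulf_neq0 ?cexp_neq0 ?Hm ?invr_eq0 ?Hp.
have [k kE] := cexp_surj K0.
pose phi z := psi z - k.
have phiE z : S z -> cexp (phi z) = (H z + 1) / (H z - 1).
  move=> Sz; rewrite /phi cexpD cexpN kE -(KE _ Sz); field.
  by rewrite cexp_neq0 Hm // Hp.
have dphi z : S z -> cdiff J phi z (phi1 z).
  by move=> Sz; apply: (cdiff_eq (cdiffB (dpsi _ Sz) (cdiff_cst J k z))); rewrite subr0.
have hH n : hol J S n H.
  apply: holM; first exact: hol_cst.
  apply: holM; first by apply: holM => //; exact: holM.
  apply: holV => //.
  have -> : De = (fun y => P1 y * P1 y + - (8 * c%:C * (P y * (P y * P y)))).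
    by apply/funext => y; rewrite /De; ring.
  apply: holD; first exact: holM.
  by apply: holN; apply: holM; [exact: hol_cst|apply: holM => //; exact: holM].
have hphi n : hol J S n phi.
  apply: holD; last exact: hol_cst.
  apply: holD; last by apply: holN; apply: holM => //; exact: hol_cst.
  apply: holM; first exact: hol_cst.
  apply: holM => //; apply: holV => //.
  by apply: holD; [exact: holM|exact: hol_cst].
have a1 : Complex 1 0 = 1 :> R[i] by [].
have bE : Complex be 0 = be%:C :> R[i] by [].
do 2 eexists; split; first exact: (bonnet_data ltr01 be0).
have cs z : S z -> ccoth (Complex 1 0 * phi z / 2) = H z /\
    csinh (Complex 1 0 * phi z / 2) ^+ 2 = (H z ^+ 2 - 1)^-1.
  by move=> Sz; rewrite a1 mul1r; apply: coth_half; [exact: Hm|exact: Hp|exact: phiE].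
apply: (@piece_intro _ _ _ _ _ _ _ _ _ _ _ _ phi phi1 la mu (mu * a) domS J_unit dataS (bonnet_model be0)) => //.
- rewrite /mu normc2M -s2.
  have -> : normc2 (be%:C)^-1 = be ^- 2 by rewrite -fmorphV normc2C exprVn.
  rewrite /be expr_div_n real_normK ?num_real //; field.
  by rewrite la0 gt_eqF.
- move=> z Sz; have [_ ->] := cs _ Sz.
  rewrite bE a1 expr1n divr1 !mulf_neq0 ?pnatr_eq0 // invr_eq0 H210 //.
- move=> z Sz; have [_ ->] := cs _ Sz; have Hz := H210 _ Sz.
  rewrite bE a1 expr1n divr1 /mu /phi1.
  transitivity (8 * c%:C * nu ^+ 2 * P z / (H z ^+ 2 - 1) ^+ 2 * f z); first by rewrite key ?mul1r.
  by field; rewrite beC Hz.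
- move=> z Sz; have [-> _] := cs _ Sz.
  rewrite bE a1 laC /mu; have -> : h z = - (2 * c%:C * nu)^-1 * H z + a by rewrite -(aE _ Sz); ring.
  by field; rewrite nu0 cC beC.
Qed.

End Cases.

(** * Structure of zero mean curvature surfaces *)

Section SurfaceStructure.
Variable R : realType.
Implicit Types (z w : R * R) (J d : R[i]).

Lemma Ck_coord m n k (U : set (R * R)) (f : R * R -> 'M[R]_(m.+1, n.+1)) i j :
  open U -> Ck_on k U f -> Ck_on k U (fun z => f z i j).
Proof.
move=> oU; elim: k f => [|k IH] f.
  move=> h z Uz; have c : {for f z, continuous (fun M : 'M[R]_(m.+1, n.+1) => M i j)}.
    exact: differentiable_continuous (differentiable_coord _ _ _).
  exact: (@continuous_comp _ _ _ f (fun M => M i j) z (h z Uz) c).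
move=> [h1 h2 h3]; split.
- by move=> z Uz; have [/derivable_mxP a /derivable_mxP b] := h1 z Uz.
- apply: (Ck_on_ext oU _ (IH _ h2)) => z Uz; have [a _] := h1 z Uz.
  by rewrite /pd_u derive_mx // mxE.
- apply: (Ck_on_ext oU _ (IH _ h3)) => z Uz; have [_ b] := h1 z Uz.
  by rewrite /pd_v derive_mx // mxE.
Qed.

Lemma pd_coord m n (U : set (R * R)) (f : R * R -> 'M[R]_(m.+1, n.+1)) i j z :
  smooth_on U f -> U z ->
  pd_u f z i j = pd_u (fun y => f y i j) z /\ pd_v f z i j = pd_v (fun y => f y i j) z.
Proof.
move=> s Uz; have [[a _] [b _]] := Ck_derive (s 1%N) Uz.
by split; [rewrite /pd_u (derive_mx a) mxE|rewrite /pd_v (derive_mx b) mxE].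
Qed.

Lemma smooth_is_diff (U : set (R * R)) (f : R * R -> R) z : open U -> smooth_on U f -> U z ->
  is_diff z f (fun w => w.1 * pd_u f z + w.2 * pd_v f z).
Proof.
move=> oU s Uz; have nU : \forall y \near z, U y by exact: open_nbhs_nbhs.
have [su sv] := smooth_pd s.
apply: C1_is_diff; [| |exact: (su 0%N _ Uz)|exact: (sv 0%N _ Uz)].
  by apply: filterS nU => y Uy; have [] := Ck_derive (s 1%N) Uy.
by apply: filterS nU => y Uy; have [] := Ck_derive (s 1%N) Uy.
Qed.

Lemma smooth_scale (U : set (R * R)) (f : R * R -> R) (a : R) : open U -> smooth_on U f ->
  smooth_on U (fun z => a * f z).
Proof.
move=> oU s k; elim: k f s => [|k IH] f s.
  move=> z Uz; apply: (cont_ext (f := (fun=> a) \* f)) => //.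
  by apply: continuousM; [exact: cst_continuous|exact: (s 0%N)].
have [su sv] := smooth_pd s.
have D z : U z -> is_derive z (e_u R) (fun z => a * f z) (a * pd_u f z) /\
    is_derive z (e_v R) (fun z => a * f z) (a * pd_v f z).
  move=> Uz; have [hu hv] := Ck_derive (s 1%N) Uz.
  by split; [exact: (is_deriveZ a hu)|exact: (is_deriveZ a hv)].
split.
- by move=> z /D[[? _] [? _]].
- by apply: (Ck_on_ext oU _ (IH _ su)) => z /D[h _]; rewrite /pd_u derive_val.
- by apply: (Ck_on_ext oU _ (IH _ sv)) => z /D[_ h]; rewrite /pd_v derive_val.
Qed.

(** Orthogonal vectors of equal length in the plane differ by a quarter turn. Its sense is the sign
    of the determinant [D], and [D^2 = E^2]. *)
Lemma rotation_dichotomy (a b c d E : R) : 0 < E -> a ^+ 2 + b ^+ 2 = E ->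
  c ^+ 2 + d ^+ 2 = E -> a * c + b * d = 0 ->
  let D := a * d - c * b in
  D != 0 /\ (0 < D -> c = - b /\ d = a) /\ (D < 0 -> c = b /\ d = - a).
Proof.
move=> E0 e1 e2 e3 D.
have D2 : D ^+ 2 = E ^+ 2.
  transitivity ((a ^+ 2 + b ^+ 2) * (c ^+ 2 + d ^+ 2) - (a * c + b * d) ^+ 2); first by rewrite /D; ring.
  by rewrite e1 e2 e3; ring.
have cE : E * c = - D * b.
  transitivity ((a * c + b * d) * a - D * b); last by rewrite e3; ring.
  by rewrite -e1 /D; ring.
have dE : E * d = D * a.
  transitivity ((a * c + b * d) * b + D * a); last by rewrite e3; ring.
  by rewrite -e1 /D; ring.
have E_neq0 : E != 0 by rewrite gt_eqF.
have := D2; move/eqP; rewrite eqf_sqr => /orP[/eqP DE|/eqP DE].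
  split; first by rewrite DE.
  split; last by rewrite DE => h; move: E0; rewrite ltNge ltW.
  move=> _; split; apply: (mulfI E_neq0); first by rewrite cE DE; ring.
  by rewrite dE DE.
split; first by rewrite DE oppr_eq0.
split; first by rewrite DE oppr_gt0 => h; move: E0; rewrite ltNge ltW.
move=> _; split; apply: (mulfI E_neq0); first by rewrite cE DE; ring.
by rewrite dE DE; ring.
Qed.

Variables (S : set (R * R)) (X n : R * R -> 'cV[R]_4) (omega : R * R -> R).
Hypothesis domS : domain S.
Hypothesis immX : spacelike_immersion S X.
Hypothesis confX : conformal_coordinates S X omega.
Hypothesis gaussX : lightlike_gauss_map S X n.
Hypothesis zmcX : zero_mean_curvature S X n omega.

Let openS : open S := let: And3 a _ _ := domS in a.
Let smX : smooth_on S X := let: And3 a _ _ := immX in a.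
Let l z := X z (inord 0) 0.
Let W z := Complex (X z (inord 1) 0) (X z (inord 2) 0).
(** [f] and [g] are [W_u] and [W_v]; conformality will give [g = J f], which makes [f] the complex
    derivative of [W]. *)
Let f z := Complex (pd_u (fun y => Re (W y)) z) (pd_u (fun y => Im (W y)) z).
Let g z := Complex (pd_v (fun y => Re (W y)) z) (pd_v (fun y => Im (W y)) z).

Let smc k : smooth_on S (fun z => X z (inord k) 0).
Proof. by move=> j; exact: Ck_coord. Qed.

Let nearS z : S z -> \forall y \near z, S y.
Proof. by move=> Sz; exact: open_nbhs_nbhs. Qed.

Lemma pd_isotropic (Y : R * R -> 'cV[R]_4) z : smooth_on S Y ->
  (forall z, S z -> isotropic_space (Y z)) -> S z ->
  isotropic_space (pd_u Y z) /\ isotropic_space (pd_v Y z).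
Proof.
move=> sY iY Sz.
have E : \forall y \near z, Y y (inord 0) 0 = Y y (inord 3) 0.
  by apply: filterS (nearS Sz) => y /iY/isotropicP.
split; apply/isotropicP.
  exact: etrans (pd_coord _ _ sY Sz).1 (etrans (near_eq_derive _ E) (esym (pd_coord _ _ sY Sz).1)).
exact: etrans (pd_coord _ _ sY Sz).2 (etrans (near_eq_derive _ E) (esym (pd_coord _ _ sY Sz).2)).
Qed.

Let sXu : smooth_on S (pd_u X) := (smooth_pd smX).1.
Let sXv : smooth_on S (pd_v X) := (smooth_pd smX).2.
Let isoX : forall z, S z -> isotropic_space (X z) := let: And3 _ b _ := immX in b.

Lemma mink_isotropic (Y Z : 'cV[R]_4) : isotropic_space Y -> isotropic_space Z ->
  mink Y Z = Y (inord 1) 0 * Z (inord 1) 0 + Y (inord 2) 0 * Z (inord 2) 0.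
Proof.
by move=> /isotropicP h1 /isotropicP h2; rewrite minkE h1 h2; ring.
Qed.

Lemma isotropic_lin (A B : 'cV[R]_4) (a b : R) : isotropic_space A -> isotropic_space B ->
  isotropic_space (a *: A + b *: B).
Proof.
by move=> /isotropicP h1 /isotropicP h2; apply/isotropicP; rewrite !mxE h1 h2.
Qed.

Lemma isotropic_differential z w : S z -> isotropic_space (differential X z w).
Proof.
by move=> Sz; have [iu iv] := pd_isotropic smX isoX Sz; exact: isotropic_lin.
Qed.

Lemma first_formE z w w' : S z -> first_form X z w w' =
  (w.1 * Re (f z) + w.2 * Re (g z)) * (w'.1 * Re (f z) + w'.2 * Re (g z)) +
  (w.1 * Im (f z) + w.2 * Im (g z)) * (w'.1 * Im (f z) + w'.2 * Im (g z)).
Proof.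
move=> Sz; rewrite /first_form mink_isotropic; try exact: isotropic_differential.
have a1 : pd_u X z (inord 1) 0 = Re (f z) := (pd_coord _ _ smX Sz).1.
have a2 : pd_u X z (inord 2) 0 = Im (f z) := (pd_coord _ _ smX Sz).1.
have b1 : pd_v X z (inord 1) 0 = Re (g z) := (pd_coord _ _ smX Sz).2.
have b2 : pd_v X z (inord 2) 0 = Im (g z) := (pd_coord _ _ smX Sz).2.
rewrite /differential; move: a1 a2 b1 b2.
by move: (pd_u X z) (pd_v X z) (f z) (g z) => A B F G a1 a2 b1 b2; rewrite !mxE a1 a2 b1 b2.
Qed.

Lemma conformalE z : S z -> [/\ normc2 (f z) = expR (2 * omega z),
  normc2 (g z) = expR (2 * omega z) & Re (f z) * Re (g z) + Im (f z) * Im (g z) = 0].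
Proof.
move=> Sz.
have h a b : (a * Re (f z) + b * Re (g z)) * (a * Re (f z) + b * Re (g z)) +
    (a * Im (f z) + b * Im (g z)) * (a * Im (f z) + b * Im (g z)) =
    expR (2 * omega z) * (a ^+ 2 + b ^+ 2).
  exact: etrans (esym (first_formE (a, b) (a, b) Sz)) (confX (a, b) Sz).
have h1 := h 1 0; have h2 := h 0 1; have h3 := h 1 1; move: h1 h2 h3 => {h}.
rewrite /normc2; move: (f z) (g z) (expR _) => F G E.
move: (Re F) (Im F) (Re G) (Im G) => a b c d h1 h2 h3.
have e1 : a ^+ 2 + b ^+ 2 = E.
  by transitivity (E * (1 ^+ 2 + 0 ^+ 2)); [rewrite -h1|]; ring.
have e2 : c ^+ 2 + d ^+ 2 = E.
  by transitivity (E * (0 ^+ 2 + 1 ^+ 2)); [rewrite -h2|]; ring.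
split=> //; apply: (mulfI (_ : 2 != 0)); first by rewrite pnatr_eq0.
transitivity (E * (1 ^+ 2 + 1 ^+ 2) - (a ^+ 2 + b ^+ 2) - (c ^+ 2 + d ^+ 2)).
  by rewrite -h3; ring.
by rewrite e1 e2; ring.
Qed.

(** The determinant of [W_u] and [W_v] is continuous and has no zero, so its sign, and with it [J],
    is the same on the whole connected domain. *)
Lemma orientation : exists2 J, imaginary_unit J & forall z, S z -> g z = J * f z.
Proof.
have [_ cS [z0 Sz0]] := domS.
pose D z := Re (f z) * Im (g z) - Re (g z) * Im (f z).
have rd z : S z -> D z != 0 /\ (0 < D z -> Re (g z) = - Im (f z) /\ Im (g z) = Re (f z)) /\
    (D z < 0 -> Re (g z) = Im (f z) /\ Im (g z) = - Re (f z)).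
  move=> Sz; have [e1 e2 e3] := conformalE Sz.
  exact: (rotation_dichotomy (expR_gt0 _) e1 e2 e3).
have cD z : S z -> {for z, continuous D}.
  move=> Sz; have [su1 sv1] := smooth_pd (smc 1); have [su2 sv2] := smooth_pd (smc 2).
  exact: continuousB (continuousM (su1 0%N _ Sz) (sv2 0%N _ Sz))
    (continuousM (sv1 0%N _ Sz) (su2 0%N _ Sz)).
have near_sign z : S z -> \forall y \near z, (0 < D y) <-> (0 < D z).
  move=> Sz; have [D0 _] := rd _ Sz.
  have e0 : 0 < `|D z| by rewrite normr_gt0.
  have /cvgrPdist_lt/(_ _ e0) := cD _ Sz; apply: filterS => y.
  move: (D z) (D y) D0 => a b a0.
  by rewrite ltr_norml; case: (ltrgt0P a) a0 => // Dz _ /andP[h1 h2]; split => // h; lra.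
have sign z : S z -> (0 < D z) <-> (0 < D z0).
  move=> Sz; apply: (@connected_near _ S (fun z => (0 < D z) <-> (0 < D z0)) z0 z) => // y Sy.
  by apply: filterS (near_sign _ Sy) => t ht; rewrite ht.
have [D0|D0] := ltP 0 (D z0).
  exists 'i%C; first by split=> //; left.
  move=> z Sz; have [_ [h _]] := rd _ Sz; have [e1 e2] := h ((sign _ Sz).2 D0).
  move: (f z) (g z) e1 e2 => F G e1 e2.
  by apply: eq_ReIm; [rewrite e1|rewrite e2]; rewrite ?ReM ?ImM Re_mk Im_mk; ring.
exists (- 'i%C); first by split; [rewrite ReN oppr0|right].
move=> z Sz; have [n0 [_ h]] := rd _ Sz.
have Dz : D z < 0.
  rewrite lt_neqAle n0 leNgt; apply/negP => /(sign _ Sz).1; rewrite ltNge D0 //.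
have [e1 e2] := h Dz.
move: (f z) (g z) e1 e2 => F G e1 e2.
by apply: eq_ReIm; [rewrite e1|rewrite e2]; rewrite ?ReM ?ImM ReN ImN Re_mk Im_mk; ring.
Qed.

(** Since [W] is complex differentiable its components are harmonic and drop out of [L + N], so zero
    mean curvature says that [l] is harmonic. Its complex gradient, divided by [f], is [h]. Tangency
    identifies the Gauss map with [- h], and this turns the second fundamental form into the real
    part of [h1 f dz^2]. *)
Lemma surface_structure : exists (J : R[i]) (l : R * R -> R) (W f h h1 : R * R -> R[i]),
  [/\ imaginary_unit J, surface_data S X J l W f h,
      forall k, [/\ hol J S k W, hol J S k f & hol J S k h],
      forall z, S z -> cdiff J h z (h1 z)
    & forall z, S z -> [/\ forall w w', first_form X z w w' =
        normc2 (f z) * (w.1 * w'.1 + w.2 * w'.2),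
        coefL X n z = Re (h1 z * f z), coefM X n z = Re (J * (h1 z * f z))
      & coefN X n z = - Re (h1 z * f z)]].
Proof.
have [J Jim gE] := orientation.
have [J0 J1] := Jim.
have J2 : Im J * Im J = 1 by case: J1 => ->; ring.
have JJ : J * J = -1 by apply: eq_ReIm; rewrite ?ReImE J0 ?J2; ring.
have r1 z : S z -> pd_v (fun y => Re (W y)) z = Re (J * f z) by move=> Sz; rewrite -gE.
have r2 z : S z -> pd_v (fun y => Im (W y)) z = Im (J * f z) by move=> Sz; rewrite -gE.
have hW k : hol J S k W by exact: (@smooth_hol _ J S k W openS (smc 1) (smc 2) r1 r2).
have dW z : S z -> cdiff J W z (f z) by move=> Sz; exact: (@smooth_cdiff _ J S W z openS (smc 1) (smc 2) r1 r2 Sz).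
have hf k : hol J S k f by apply: hol_deriv (hW k.+1) dW.
have [f1 df _] := hf 1%N.
have f0 z : S z -> f z != 0.
  by move=> Sz; have [e _ _] := conformalE Sz; rewrite -normc2_gt0 e expR_gt0.
have [slu slv] := smooth_pd (smc 0 : smooth_on S l).
(* [A = l_u - J l_v], twice the complex derivative of [l]; the Cauchy-Riemann equations for [A] are
   the harmonicity of [l] and the symmetry of its second derivatives. *)
pose A z := Complex (pd_u l z) (- Im J * pd_v l z).
have duu k z : S z -> pd_u (pd_u X) z (inord k) 0 = pd_u (pd_u (fun y => X y (inord k) 0)) z.
  move=> Sz; apply: (etrans (pd_coord _ _ sXu Sz).1); apply: near_eq_derive.
  by apply: filterS (nearS Sz) => y Sy; exact: (pd_coord _ _ smX Sy).1.
have dvu k z : S z -> pd_v (pd_u X) z (inord k) 0 = pd_v (pd_u (fun y => X y (inord k) 0)) z.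
  move=> Sz; apply: (etrans (pd_coord _ _ sXu Sz).2); apply: near_eq_derive.
  by apply: filterS (nearS Sz) => y Sy; exact: (pd_coord _ _ smX Sy).1.
have dvv k z : S z -> pd_v (pd_v X) z (inord k) 0 = pd_v (pd_v (fun y => X y (inord k) 0)) z.
  move=> Sz; apply: (etrans (pd_coord _ _ sXv Sz).2); apply: near_eq_derive.
  by apply: filterS (nearS Sz) => y Sy; exact: (pd_coord _ _ smX Sy).2.
have isou z : S z -> isotropic_space (pd_u X z) by move=> Sz; have [] := pd_isotropic smX isoX Sz.
have isov z : S z -> isotropic_space (pd_v X z) by move=> Sz; have [] := pd_isotropic smX isoX Sz.
(* On isotropic vectors the outer components of [n] enter only through [- n_0 + n_3], which the
   normalization against [p_vec] sets to 1. *)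
have mn z Y : S z -> isotropic_space Y -> mink Y (n z) =
    Y (inord 0) 0 + Y (inord 1) 0 * n z (inord 1) 0 + Y (inord 2) 0 * n z (inord 2) 0.
  move=> Sz /isotropicP iY; have [_ _ np] := gaussX Sz.
  move: np; rewrite !minkE -iY; have [-> -> -> ->] := ptE (1 : R) 0 => np.
  rewrite /= !mulr0 !addr0 !mulr1 in np.
  transitivity (Y (inord 0) 0 * (- n z (inord 0) 0 + n z (inord 3) 0) +
    Y (inord 1) 0 * n z (inord 1) 0 + Y (inord 2) 0 * n z (inord 2) 0); first by ring.
  by rewrite np mulr1.
have Wuu z : S z -> pd_u (pd_u (fun y => X y (inord 1) 0)) z = Re (f1 z) /\
    pd_u (pd_u (fun y => X y (inord 2) 0)) z = Im (f1 z).
  by move=> /df/cdiff_u[a b]; rewrite -(@derive_val _ _ _ _ _ _ _ a) -(@derive_val _ _ _ _ _ _ _ b).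
have Wvu z : S z -> pd_v (pd_u (fun y => X y (inord 1) 0)) z = Re (J * f1 z) /\
    pd_v (pd_u (fun y => X y (inord 2) 0)) z = Im (J * f1 z).
  by move=> /df/cdiff_v[a b]; rewrite -(@derive_val _ _ _ _ _ _ _ a) -(@derive_val _ _ _ _ _ _ _ b).
have Wvv z : S z -> pd_v (pd_v (fun y => X y (inord 1) 0)) z = - Re (f1 z) /\
    pd_v (pd_v (fun y => X y (inord 2) 0)) z = - Im (f1 z).
  move=> Sz; have [a b] := cdiff_v (cdiffM (cdiff_cst J J z) (df _ Sz)).
  have E : J * (0 * f z + J * f1 z) = - f1 z by rewrite mul0r add0r mulrA JJ mulN1r.
  rewrite E in a b; rewrite -ReN -ImN -(@derive_val _ _ _ _ _ _ _ a) -(@derive_val _ _ _ _ _ _ _ b).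
  split; apply: near_eq_derive; apply: filterS (nearS Sz) => y Sy; first exact: r1.
  exact: r2.
pose n1 z := n z (inord 1) 0; pose n2 z := n z (inord 2) 0.
have mnE z (Y : 'cV[R]_4) (a b c : R) : S z -> isotropic_space Y -> Y (inord 0) 0 = a ->
    Y (inord 1) 0 = b -> Y (inord 2) 0 = c -> mink Y (n z) = a + b * n1 z + c * n2 z.
  by move=> Sz iY <- <- <-; exact: mn.
have cL z : S z -> coefL X n z = pd_u (pd_u l) z + Re (f1 z) * n1 z + Im (f1 z) * n2 z.
  move=> Sz; apply: mnE => //; first exact: (pd_isotropic sXu isou Sz).1.
  - exact: duu.
  - exact: etrans (duu 1 z Sz) (Wuu z Sz).1.
  - exact: etrans (duu 2 z Sz) (Wuu z Sz).2.
have cM z : S z -> coefM X n z =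
    pd_v (pd_u l) z + Re (J * f1 z) * n1 z + Im (J * f1 z) * n2 z.
  move=> Sz; apply: mnE => //; first exact: (pd_isotropic sXu isou Sz).2.
  - exact: dvu.
  - exact: etrans (dvu 1 z Sz) (Wvu z Sz).1.
  - exact: etrans (dvu 2 z Sz) (Wvu z Sz).2.
have cN z : S z -> coefN X n z = pd_v (pd_v l) z - Re (f1 z) * n1 z - Im (f1 z) * n2 z.
  move=> Sz; rewrite -!mulNr; apply: mnE => //; first exact: (pd_isotropic sXv isov Sz).2.
  - exact: dvv.
  - exact: etrans (dvv 1 z Sz) (Wvv z Sz).1.
  - exact: etrans (dvv 2 z Sz) (Wvv z Sz).2.
have LN z : S z -> coefL X n z + coefN X n z = 0.
  move=> Sz; have := zmcX Sz; rewrite /mean_curvature.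
  move: (coefL X n z + coefN X n z) => t /eqP.
  by rewrite !mulf_eq0 invr_eq0 pnatr_eq0 /= gt_eqF ?expR_gt0 //= => /eqP.
have lap z : S z -> pd_u (pd_u l) z + pd_v (pd_v l) z = 0.
  move=> Sz; have := LN _ Sz; rewrite cL // cN //.
  move: (pd_u (pd_u l) z) (pd_v (pd_v l) z) => a b h.
  by rewrite -[RHS]h; ring.
have hA k : hol J S k A.
  apply: smooth_hol => //; first exact: smooth_scale.
    move=> z Sz; rewrite /A /=.
    have [a _] := Ck_derive (slv 1%N) Sz.
    have h := is_deriveZ (- Im J) a.
    have -> : pd_u (fun y => - Im J * pd_v l y) z = - Im J * pd_u (pd_v l) z.
      exact: (@derive_val _ _ _ _ _ _ _ h).
    change (pd_v (pd_u l) z = Re (J * Complex (pd_u (pd_u l) z) (- Im J * pd_u (pd_v l) z))).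
    rewrite (pd_comm openS (smc 0) Sz) ReM Re_mk Im_mk J0.
    move: (pd_u (pd_v l) z) => q.
    by transitivity (Im J * Im J * q); [rewrite J2 mul1r|ring].
  move=> z Sz; rewrite /A /=.
  have [_ b] := Ck_derive (slv 1%N) Sz.
  have h := is_deriveZ (- Im J) b.
  have -> : pd_v (fun y => - Im J * pd_v l y) z = - Im J * pd_v (pd_v l) z.
    exact: (@derive_val _ _ _ _ _ _ _ h).
  change (- Im J * pd_v (pd_v l) z = Im (J * Complex (pd_u (pd_u l) z)
    (pd_u (fun y => - Im J * pd_v l y) z))).
  rewrite ImM Re_mk J0 mul0r add0r.
  have := lap _ Sz; move: (pd_u (pd_u l) z) (pd_v (pd_v l) z) => p q /eqP.
  by rewrite addr_eq0 => /eqP ->; ring.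
have [A1 dA _] := hA 1%N.
have luu z : S z -> pd_u (pd_u l) z = Re (A1 z) /\ pd_v (pd_u l) z = Re (J * A1 z).
  move=> Sz; have [a _] := cdiff_u (dA _ Sz); have [b _] := cdiff_v (dA _ Sz).
  by rewrite -(@derive_val _ _ _ _ _ _ _ a) -(@derive_val _ _ _ _ _ _ _ b).
pose h z := A z * (f z)^-1.
have hh k : hol J S k h by apply: holM => //; exact: holV.
have [h1 dh _] := hh 1%N.
have hfE z : S z -> h z * f z = A z by move=> Sz; rewrite /h mulfVK // f0.
have A1E z : S z -> A1 z = h1 z * f z + h z * f1 z.
  move=> Sz; apply: cdiff_uniq (dA _ Sz) _.
  apply: cdiff_near (cdiffM (dh _ Sz) (df _ Sz)).
  by apply: filterS (nearS Sz) => y /hfE.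
(* Orthogonality of [n] to [X_u] and [X_v] becomes the single complex equation [A + N f = 0]. *)
pose N z := Complex (n z (inord 1) 0) (- n z (inord 2) 0).
have NE z : S z -> N z = - h z.
  move=> Sz; have [_ gd _] := gaussX Sz.
  have gu := gd (1, 0); have gv := gd (0, 1).
  rewrite mn in gu; [|exact: Sz|exact: isotropic_differential].
  rewrite mn in gv; [|exact: Sz|exact: isotropic_differential].
  have c0 : pd_u X z (inord 0) 0 = pd_u l z := (pd_coord _ _ smX Sz).1.
  have d0 : pd_v X z (inord 0) 0 = pd_v l z := (pd_coord _ _ smX Sz).2.
  have c1 : pd_u X z (inord 1) 0 = Re (f z) := (pd_coord _ _ smX Sz).1.
  have c2 : pd_u X z (inord 2) 0 = Im (f z) := (pd_coord _ _ smX Sz).1.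
  have d1 : pd_v X z (inord 1) 0 = Re (J * f z) := etrans (pd_coord _ _ smX Sz).2 (r1 z Sz).
  have d2 : pd_v X z (inord 2) 0 = Im (J * f z) := etrans (pd_coord _ _ smX Sz).2 (r2 z Sz).
  have gu' : pd_u l z + Re (f z) * n z (inord 1) 0 + Im (f z) * n z (inord 2) 0 = 0.
    rewrite -[RHS]gu /differential; move: c0 c1 c2.
    by move: (pd_u X z) (pd_v X z) => B C <- <- <-; rewrite !mxE /= !mul1r !mul0r !addr0.
  have gv' : pd_v l z + Re (J * f z) * n z (inord 1) 0 + Im (J * f z) * n z (inord 2) 0 = 0.
    rewrite -[RHS]gv /differential; move: d0 d1 d2.
    by move: (pd_u X z) (pd_v X z) => B C <- <- <-; rewrite !mxE /= !mul1r !mul0r !add0r.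
  have e1 : Re (A z + N z * f z) = 0.
    rewrite -[RHS]gu' ReD ReM /A /N !Re_mk !Im_mk.
    by move: (pd_u l z) (f z) => a b; ring.
  have e2 : Im (A z + N z * f z) = 0.
    have : Im J * Im (A z + N z * f z) = 0.
      transitivity (- (Im J * Im J * pd_v l z + Re (J * f z) * n z (inord 1) 0 + Im (J * f z) * n z (inord 2) 0)).
        rewrite ImD !ImM ReM /A /N !Re_mk !Im_mk J0.
        by move: (pd_v l z) (f z) => a b; ring.
      by rewrite J2 mul1r gv' oppr0.
    move/eqP; rewrite mulf_eq0 => /orP[|/eqP//] /eqP JI0.
    by move: J2; rewrite JI0 mul0r => /esym/eqP; rewrite oner_eq0.
  have AN : A z + N z * f z = 0 by exact: eq_ReIm.
  apply: (mulIf (f0 _ Sz)); rewrite mulNr hfE //.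
  by apply/eqP; rewrite -addr_eq0 addrC AN.
exists J, l, W, f, h, h1; split=> //.
- split=> //.
    by move=> z Sz; rewrite [LHS](isotropicE (isoX Sz)).
  move=> z Sz; apply: (is_diff_ext (smooth_is_diff openS (smc 0) Sz)) => v.
  rewrite hfE //; have ReA : Re (A z) = pd_u l z by [].
  have ImA : Im (A z) = - Im J * pd_v l z by [].
  move: (A z) (pd_u l z) (pd_v l z) ReA ImA => B a b ReA ImA.
  rewrite /jc !ReImE ReA ImA J0.
  transitivity (v.1 * a + Im J * Im J * v.2 * b); last by ring.
  by rewrite J2 mul1r.
- move=> z Sz; have [e1 e2 e3] := conformalE Sz.
  have Nz := NE _ Sz.
  have n1E : n1 z = - Re (h z) by rewrite -ReN -Nz.
  have n2E : n2 z = Im (h z).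
    by rewrite -[RHS]opprK -ImN -Nz /N Im_mk opprK.
  have LE : coefL X n z = Re (h1 z * f z).
    rewrite cL // (luu _ Sz).1 A1E // n1E n2E.
    by move: (h z) (f1 z) (h1 z) (f z) => a b c d; rewrite !ReImE; ring.
  split=> //.
  + move=> v v'; rewrite first_formE // gE //.
    move: (f z) => F; rewrite /normc2 !ReImE J0.
    transitivity ((Re F ^+ 2 + Im F ^+ 2) * (v.1 * v'.1 + Im J * Im J * (v.2 * v'.2))).
      by ring.
    by rewrite J2 mul1r.
  + rewrite cM // (luu _ Sz).2 A1E // n1E n2E.
    by move: (h z) (f1 z) (h1 z) (f z) => a b c d; rewrite !ReImE; ring.
  + have := LN _ Sz; rewrite LE addrC => /eqP; rewrite addr_eq0.
    by move=> /eqP.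
Qed.

End SurfaceStructure.

(** * Planar curvature lines *)

Section CurvatureLines.
Variable R : realType.
Implicit Types (z w : R * R) (J d : R[i]).

(** The cross product in the coordinates [(l, x, y)]; it provides the linear equation of a plane. *)
Lemma cross_product_neq0 (Y1 Y2 : 'cV[R]_4) : isotropic_space Y1 -> isotropic_space Y2 ->
  \rank (row_mx Y1 Y2) = 2%N ->
  exists v : R * R * R, v != 0 /\
    (v.1.1 * Y1 (inord 0) 0 + v.1.2 * Y1 (inord 1) 0 + v.2 * Y1 (inord 2) 0 = 0) /\
    (v.1.1 * Y2 (inord 0) 0 + v.1.2 * Y2 (inord 1) 0 + v.2 * Y2 (inord 2) 0 = 0).
Proof.
move=> i1 i2 rk.
pose a k := Y1 (inord k) 0; pose b k := Y2 (inord k) 0.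
pose v : R * R * R := (a 1%N * b 2%N - a 2%N * b 1%N, a 2%N * b 0%N - a 0%N * b 2%N,
  a 0%N * b 1%N - a 1%N * b 0%N).
exists v; split; last by rewrite /v /= -/(a 0%N) -/(a 1%N) -/(a 2%N) -/(b 0%N) -/(b 1%N) -/(b 2%N); split; ring.
apply/eqP => -[v0 v1 v2].
have lin (Z : 'cV[R]_4) : isotropic_space Z -> Z (inord 0) 0 = 0 -> Z (inord 1) 0 = 0 ->
    Z (inord 2) 0 = 0 -> Z = 0.
  move=> /isotropicP h z0 z1 z2; apply: eq_col4.
  by case=> [|[|[|[|//]]]] _; rewrite [RHS]mxE // -h.
have dep (s t : R) : s *: Y1 + t *: Y2 = 0 -> s = 0 /\ t = 0.
  move=> E; have /row_freeP[B BE] : row_free (row_mx Y1 Y2)^T by rewrite -row_leq_rank mxrank_tr rk.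
  have : row_mx s%:M t%:M *m (row_mx Y1 Y2)^T = 0 :> 'rV[R]_4.
    rewrite tr_row_mx mul_row_col !mul_scalar_mx.
    by apply: trmx_inj; rewrite linearD !linearZ /= !trmxK E trmx0.
  move=> /(congr1 (fun M => M *m B)); rewrite -mulmxA BE mulmx1 mul0mx => h.
  have h1 : s%:M = 0 :> 'M[R]_1 by rewrite -(row_mxKl s%:M t%:M) h linear0.
  have h2 : t%:M = 0 :> 'M[R]_1 by rewrite -(row_mxKr s%:M t%:M) h linear0.
  have /matrixP/(_ 0 0) := h1; have /matrixP/(_ 0 0) := h2; rewrite !mxE /= !mulr1n.
  by move=> -> ->.
have comb (s t : R) : s * a 0%N + t * b 0%N = 0 -> s * a 1%N + t * b 1%N = 0 ->
    s * a 2%N + t * b 2%N = 0 -> s = 0 /\ t = 0.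
  move=> h0 h1 h2; apply: dep; apply: lin.
  - by apply/isotropicP; rewrite !mxE; move/isotropicP : i1 => ->; move/isotropicP : i2 => ->.
  - by rewrite !mxE.
  - by rewrite !mxE.
  - by rewrite !mxE.
(* If the cross product vanishes, each [b_k Y1 - a_k Y2] is 0, because its coordinates are
   components of that product up to sign. Independence kills all [a_k] and [b_k], and then [Y1 = 0]
   contradicts it. *)
have [b0 a0] : b 0%N = 0 /\ - a 0%N = 0 by apply: comb; lra.
have [b1 a1] : b 1%N = 0 /\ - a 1%N = 0 by apply: comb; lra.
have [b2 a2] : b 2%N = 0 /\ - a 2%N = 0 by apply: comb; lra.
have [] : (1 : R) = 0 /\ (0 : R) = 0 by apply: comb; lra.
by move/eqP; rewrite oner_eq0.
Qed.

Lemma affine_plane_eq (Pl : set 'cV[R]_4) : affine_plane Pl ->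
  exists (a d : R) (b : R[i]), (a != 0 \/ b != 0) /\
    forall l x, Pl (pt l x) -> a * l + Re (b * x) = d.
Proof.
move=> [Y0 [Y1 [Y2 [i0 i1 i2 rk ->]]]].
have [[[v0 v1] v2] /= [vn [e1 e2]]] := cross_product_neq0 i1 i2 rk.
exists v0, (v0 * Y0 (inord 0) 0 + v1 * Y0 (inord 1) 0 + v2 * Y0 (inord 2) 0), (Complex v1 (- v2)).
split.
  have [v00|] := eqVneq v0 0; last by left.
  right; apply: contra vn => /eqP[h1 /eqP]; rewrite oppr_eq0 => /eqP h2.
  by rewrite v00 h1 h2.
move=> l x [s [t E]].
have [p0 p1 p2 _] := ptE l x.
have c k : pt l x (inord k) 0 = Y0 (inord k) 0 + s * Y1 (inord k) 0 + t * Y2 (inord k) 0.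
  by rewrite E !mxE.
rewrite -{1}p0 ReM Re_mk Im_mk -p1 -p2 !c.
transitivity (v0 * Y0 (inord 0) 0 + v1 * Y0 (inord 1) 0 + v2 * Y0 (inord 2) 0 +
  s * (v0 * Y1 (inord 0) 0 + v1 * Y1 (inord 1) 0 + v2 * Y1 (inord 2) 0) +
  t * (v0 * Y2 (inord 0) 0 + v1 * Y2 (inord 1) 0 + v2 * Y2 (inord 2) 0)); first by ring.
by rewrite e1 e2; ring.
Qed.

Lemma deriv_along_zero (g dg : R -> R) (a b t : R) : a < t < b ->
  (forall s, a < s < b -> g s = 0) -> is_derive t 1 g (dg t) -> dg t = 0.
Proof.
move=> tab g0 gd; rewrite -(@derive_val _ _ _ _ _ _ _ gd).
rewrite (@near_eq_derive _ _ _ _ (fun=> 0)); first by rewrite derive_cst.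
have : t \in `]a, b[ by rewrite in_itv.
by move=> /near_in_itvoo; apply: filterS => s; rewrite in_itv /= => /g0.
Qed.

Lemma dist_between (a b t c d : R) : `|a - c| <= d -> `|b - c| <= d ->
  Num.min a b <= t <= Num.max a b -> `|t - c| <= d.
Proof.
by rewrite !ler_norml; case: (leP a b) => _ /andP[? ?] /andP[? ?] /andP[? ?];
  apply/andP; split; lra.
Qed.

(* The three vanishing real parts are the first three derivatives, along a curvature
   line, of the equation of a plane containing it. *)
Lemma planarity_algebra (s a : R) (Psi phi dphi : R[i]) : s != 0 ->
  Re Psi = 0 -> Re (a%:C * s%:C + Psi * phi) = 0 ->
  Re ((a%:C * s%:C + Psi * phi) * phi + Psi * dphi) = 0 ->
  (Psi = 0 -> a != 0) -> Im (dphi + phi ^+ 2 / 2) = 0.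
Proof.
move=> s0 h1 h2 h3 h4.
rewrite !ReImE h1 in h2; rewrite !ReImE h1 in h3.
have [q0|q0] := eqVneq (Im Psi) 0.
  have P0 : Psi = 0 by exact: eq_ReIm.
  have := h4 P0; rewrite q0 in h2.
  have : a * s = 0 by lra.
  by move/eqP; rewrite mulf_eq0 (negbTE s0) orbF => ->.
have e : a * s = Im Psi * Im phi by lra.
have : Im Psi * (Im dphi + Re phi * Im phi) = 0.
  have -> : Im Psi * (Im dphi + Re phi * Im phi) =
    - ((a * s - 0 * 0 + (0 * Re phi - Im Psi * Im phi)) * Re phi -
     (a * 0 + 0 * s + (0 * Im phi + Im Psi * Re phi)) * Im phi +
     (0 * Re dphi - Im Psi * Im dphi)) by rewrite e; ring.
  by rewrite h3 oppr0.
move/eqP; rewrite mulf_eq0 (negbTE q0) /= => /eqP e2.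
rewrite ImD expr2 -[RHS]e2; congr (_ + _).
have -> : phi * phi / 2 = phi * phi * (2^-1)%:C by rewrite fmorphV rmorph_nat.
by rewrite !ReImE; field.
Qed.

End CurvatureLines.

(** * Reality of the curvature quotient *)

Section PlanarCurvatureLines.
Variable R : realType.
Implicit Types (z : R * R) (J : R[i]).
Variables (S : set (R * R)) (X n : R * R -> 'cV[R]_4) (J : R[i]) (l : R * R -> R).
Variables (W f h f1 P P1 P2 : R * R -> R[i]).
Hypothesis openS : open S.
Hypothesis J_unit : imaginary_unit J.
Hypothesis dataS : surface_data S X J l W f h.
Hypothesis first_formE : forall z, S z -> forall w w',
  first_form X z w w' = normc2 (f z) * (w.1 * w'.1 + w.2 * w'.2).
Hypothesis coefLE : forall z, S z -> coefL X n z = Re (P z * f z * f z).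
Hypothesis coefME : forall z, S z -> coefM X n z = Re (J * (P z * f z * f z)).
Hypothesis coefNE : forall z, S z -> coefN X n z = - Re (P z * f z * f z).
Hypothesis planar : planar_curvature_lines S X n.
Hypothesis df : forall z, S z -> cdiff J f z (f1 z).
Hypothesis dh : forall z, S z -> cdiff J h z (P z * f z).
Hypothesis dP : forall z, S z -> cdiff J P z (P1 z * f z).
Hypothesis dP1 : forall z, S z -> cdiff J P1 z (P2 z * f z).
Hypothesis cf1 : forall z, S z -> ccont f1 z.

Let f_neq0 z (Sz : S z) : f z != 0 := let: And4 _ a _ _ := dataS in a z Sz.
Let dW z (Sz : S z) : cdiff J W z (f z) := let: And4 _ _ a _ := dataS in a z Sz.

Lemma imaginary_unitE : Re J = 0 /\ Im J * Im J = 1.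
Proof.
by case: J_unit => J0 J1; split=> //; case: J1 => ->; ring.
Qed.

(** The second fundamental form is [Re (Q w w')] with [Q = P f^2]. If [Q V^2] is real, then [Q V] is
    a real multiple of the conjugate of [V], and pairing with that conjugate is the induced metric
    up to a factor. *)
Lemma principal_of_real (z : R * R) (V : R[i]) (s : R) (w : R * R) : S z ->
  s != 0 -> P z * f z * f z * (V * V) = s%:C -> Re V != 0 -> jc J w = V / (Re V)%:C ->
  principal_direction X n z w.
Proof.
move=> Sz s0 QV V0 wE; have [J0 J2] := imaginary_unitE.
have Vn : V != 0 by apply: contra V0 => /eqP ->.
have w1 : w.1 = 1.
  have := congr1 (fun u => Re u) wE; rewrite -fmorphV /jc !ReImE J0 !(mul0r, mulr0, subr0, addr0) => ->.
  by rewrite divff.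
split; first by apply: contra_eq_neq w1 => ->; rewrite eq_sym oner_eq0.
exists (s / (normc2 V * normc2 (f z))) => w'.
rewrite first_formE // /second_form coefLE // coefME // coefNE //.
have nf : normc2 (f z) != 0 by rewrite gt_eqF // normc2_gt0 f_neq0.
have nV : normc2 V != 0 by rewrite gt_eqF // normc2_gt0.
transitivity (s / normc2 V * (w.1 * w'.1 + w.2 * w'.2)); last by field; rewrite nf nV.
move: (P z * f z * f z) QV => Q QV.
have E : Q * jc J w = (s / normc2 V)%:C * conjc (jc J w).
  have Vc : conjc V * V = (normc2 V)%:C.
    by case: V {QV V0 wE Vn nV} => a b; apply: eq_ReIm; rewrite /normc2 !ReImE /=; ring.
  have cV : conjc V != 0 by rewrite conjc_eq0.
  have QE : Q = s%:C / (V * V) by rewrite -QV mulfK // mulf_neq0.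
  have ReVC : (Re V)%:C != 0 :> R[i] by rewrite eq_complex /= (negbTE V0).
  have -> : conjc (jc J w) = conjc V / (Re V)%:C.
    by rewrite wE rmorphM fmorphV; congr (_ / _); exact: conjc_real.
  rewrite wE QE rmorphM fmorphV /= -Vc; field.
  by rewrite cV ReVC Vn.
transitivity (Re (Q * jc J w * jc J w')).
  rewrite /jc !ReImE J0.
  transitivity (Re Q * (w.1 * w'.1) - Im J * Im Q * (w.1 * w'.2 + w.2 * w'.1) -
     Im J * Im J * Re Q * (w.2 * w'.2)); last by ring.
  by rewrite J2; ring.
rewrite E /jc.
have -> : conjc (w.1%:C + J * w.2%:C) = w.1%:C - J * w.2%:C.
  by apply: eq_ReIm; rewrite ?ReImE; case: J J0 {J2 E wE} => a b /= ->; ring.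
rewrite !ReImE J0.
transitivity (s / normc2 V * (w.1 * w'.1 + Im J * Im J * (w.2 * w'.2))).
  by ring.
by rewrite J2 mul1r.
Qed.

Lemma curvature_real z0 : S z0 -> P z0 != 0 ->
  Im ((7 * P1 z0 ^+ 2 - 4 * P z0 * P2 z0) / (8 * P z0 ^+ 3)) = 0.
Proof.
case: z0 => x0 y0; set z0 := (x0, y0) => Sz0 P0.
have [J0 J2] := imaginary_unitE.
(* The sign [s] selects one of the two orthogonal families of curvature lines; multiplication of the
   root by [i] exchanges them. At least one is transverse to the [v]-axis at [z0], and its line is a
   graph over [u]. *)
have [s [q [s1 qE q0]]] : exists (s : R) (q : R[i]), [/\ s = 1 \/ s = -1,
    q * q = s%:C / P z0 & Re (q / f z0) != 0].
  pose q := complex.sqrtc (P z0)^-1.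
  have qE : q * q = (P z0)^-1 by rewrite -expr2; exact: sqr_sqrtc.
  have [Re0|Re_neq0] := eqVneq (Re (q / f z0)) 0; last first.
    by exists 1, q; split=> //; [left|rewrite qE mul1r].
  exists (-1), ('i%C * q); split=> //; first by right.
    by rewrite mulrACA qE -expr2 sqr_i rmorphN1.
  rewrite -mulrA ReM Re_mk Im_mk mul0r mul1r sub0r oppr_eq0.
  apply/negP => /eqP Im0; have : q / f z0 = 0 by exact: eq_ReIm.
  move/eqP; rewrite mulf_eq0 invr_eq0 (negbTE (f_neq0 Sz0)) orbF => /eqP q0.
  by move/eqP: qE; rewrite q0 mul0r eq_sym invr_eq0 (negbTE P0).
have s0 : s != 0 by case: s1 => ->; rewrite ?oppr_eq0 oner_eq0.
pose r z := P z * (P z0)^-1.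
(* The branch of the square root of [s / P] near [z0] that takes the value [q] at [z0]. *)
pose F z := q * cexp (- 2^-1 * clog (r z)).
pose V z := F z * (f z)^-1.
pose phi z := - 2^-1 * (F z * (P1 z * (P z)^-1)).
pose V1 z := phi z * f z * (f z)^-1 + F z * (- f1 z / f z ^+ 2).
pose good z := [/\ S z, P z != 0 & 0 < Re (r z)].
have dr z : S z -> cdiff J r z (P1 z * f z * (P z0)^-1).
  by move=> Sz; apply: (cdiff_eq (cdiffM (dP Sz) (cdiff_cst J (P z0)^-1 z))); rewrite mulr0 addr0.
have F2 z : good z -> F z * F z = s%:C / P z.
  move=> [Sz Pz rz]; rewrite /F.
  have e : cexp (- 2^-1 * clog (r z)) * cexp (- 2^-1 * clog (r z)) = (r z)^-1.
    rewrite -cexpD; have -> : - 2^-1 * clog (r z) + - 2^-1 * clog (r z) = - clog (r z) by field.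
    by rewrite cexpN clogK.
  by rewrite mulrACA e qE /r; field; rewrite Pz P0.
have dF z : good z -> cdiff J F z (phi z * f z).
  move=> [Sz Pz rz].
  apply: (cdiff_eq (cdiffM (cdiff_cst J q z) (cdiff_cexp (cdiffM (cdiff_cst J (- 2^-1) z) (cdiff_clog rz (dr _ Sz)))))).
  by rewrite /phi /F /r; field; rewrite Pz P0.
have dV z : good z -> cdiff J V z (V1 z).
  by move=> gz; have [Sz Pz rz] := gz; exact: (cdiffM (dF _ gz) (cdiffV (f_neq0 Sz) (df Sz))).
pose phi1 z := - 2^-1 * (phi z * f z * (P1 z * (P z)^-1) +
   F z * (P2 z * f z * (P z)^-1 + P1 z * (- (P1 z * f z) / P z ^+ 2))).
have dphi z : good z -> cdiff J phi z (phi1 z).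
  move=> gz; have [Sz Pz rz] := gz.
  apply: (cdiff_eq (cdiffM (cdiff_cst J (- 2^-1) z) (cdiffM (dF _ gz)
    (cdiffM (dP1 Sz) (cdiffV Pz (dP Sz)))))).
  by rewrite /phi1 mul0r add0r.
have gz0 : good z0 by split=> //; rewrite /r divff // Re1.
have F0 : F z0 = q.
  by rewrite /F /r divff // clog1 mulr0 cexp0 mulr1.
have V0 : Re (V z0) != 0 by rewrite /V F0.
(* The slope of [V] in the real coordinates: the [v]-component of [V] is [Im J * Im V]. *)
pose m z := Im J * (Im (V z) * (Re (V z))^-1).
pose mv z := Im J * (Im (J * V1 z) * (Re (V z))^-1 - Im (V z) * (Re (J * V1 z) / Re (V z) ^+ 2)).
have dm z : good z -> Re (V z) != 0 -> {for z, continuous m} /\ is_derive z (e_v R) m (mv z).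
  move=> gz Vz; have [d1 d2] := dV _ gz.
  have dmm : is_diff z m (fun w => Im J * (Im (V1 z * jc J w) * (Re (V z))^-1 -
      Im (V z) * (Re (V1 z * jc J w) / Re (V z) ^+ 2))).
    apply: (is_diff_ext (is_diffZ (Im J) (is_diffM d2 (is_diff_inv d1 Vz)))) => w.
    by rewrite !fctE !scaleE; field.
  have [dd _] := dmm; split; first exact: differentiable_continuous dd.
  by apply: (is_derive_eq (is_diff_derive (e_v R) dmm)); rewrite jcv /mv ![_ * J]mulrC.
have cV1 : ccont V1 z0.
  have cF : ccont F z0 := cdiff_ccont (dF _ gz0).
  have cf : ccont f z0 := cdiff_ccont (df Sz0).
  have cfV : ccont (fun z => (f z)^-1) z0 := ccontV (f_neq0 Sz0) cf.
  have cphi := cdiff_ccont (dphi _ gz0).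
  apply: (ccontD (ccontM (ccontM cphi cf) cfV)).
  have -> : (fun z => F z * (- f1 z / f z ^+ 2)) =
      (fun z => F z * (-1 * f1 z * ((f z)^-1 * (f z)^-1))).
    by apply/funext => z; rewrite mulN1r expr2 invfM.
  exact: (ccontM cF (ccontM (ccontM (ccont_cst _ _) (cf1 Sz0)) (ccontM cfV cfV))).
have cmv : {for z0, continuous mv}.
  have [cV cV'] := cdiff_ccont (dV _ gz0).
  have [cJ cJ'] := ccontM (ccont_cst J z0) cV1.
  have cR : {for z0, continuous (fun z => (Re (V z))^-1)} by exact: continuousV.
  have c1 := continuousM cJ' cR; have c2 := continuousM cV' (continuousM cJ (continuousM cR cR)).
  apply: (cont_ext _ (continuousM (@cst_continuous _ _ (Im J) z0) (continuousB c1 c2))) => z.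
  by rewrite /mv /cst /= !fctE expr2 invfM.
have nS : \forall z \near z0, S z by exact: open_nbhs_nbhs.
have nP : \forall z \near z0, P z != 0.
  have [B nB BP] := ratio_near P0 (cdiff_ccont (dP Sz0)); have Bz0 := nbhs_singleton nB.
  apply: filterS nB => z Bz; have := BP _ _ Bz Bz0.
  by apply: contraTneq => ->; rewrite mul0r Re0 ltxx.
have nr : \forall z \near z0, 0 < Re (r z).
  have [B nB BP] := ratio_near P0 (cdiff_ccont (dP Sz0)); have Bz0 := nbhs_singleton nB.
  by apply: filterS nB => z Bz; exact: BP.
have nV : \forall z \near z0, Re (V z) != 0.
  have [cV _] := cdiff_ccont (dV _ gz0).
  have e0 : 0 < `|Re (V z0)| by rewrite normr_gt0.
  move/cvgrPdist_lt : cV => /(_ _ e0); apply: filterS => z.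
  by apply: contraTneq => ->; rewrite subr0 ltxx.
have nm : \forall z \near z0, `|m z0 - m z| < 1.
  by have [cm _] := dm _ gz0 V0; move/cvgrPdist_lt : cm; apply.
have nmv : \forall z \near z0, `|mv z0 - mv z| < 1 by move/cvgrPdist_lt : cmv; apply.
have [e e0 eP] := near_box (filterI (filterI nS (filterI nP nr)) (filterI nV (filterI nm nmv))).
pose d := e / 2; have d0 : 0 < d by rewrite divr_gt0.
have de (t u : R) : `|t - u| <= d -> `|t - u| < e by move=> /le_lt_trans; apply; rewrite /d; lra.
have box a b : `|a - x0| <= d -> `|b - y0| <= d -> [/\ good (a, b), Re (V (a, b)) != 0,
    `|m z0 - m (a, b)| < 1 & `|mv z0 - mv (a, b)| < 1].
  by move=> /de ad /de bd; have [[? [? ?]] [? [? ?]]] := eP _ _ ad bd.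
have M0 : 0 < `|m z0| + 1 by rewrite ltr_wpDl.
have K0 : 0 < `|mv z0| + 1 by rewrite ltr_wpDl.
have bnd (a b : R) : `|a - b| < 1 -> `|b| <= `|a| + 1.
  by rewrite distrC => h1; have := ler_normD (b - a) a; rewrite subrK; lra.
have [|||rr [y [r0 rd yx0 yP]]] := @picard R m x0 y0 d (`|m z0| + 1) (`|mv z0| + 1) d0 M0 K0.
- by move=> a b ad bd; have [gz Vz _ _] := box _ _ ad bd; have [] := dm _ gz Vz.
- by move=> a b ad bd; have [_ _ h1 _] := box _ _ ad bd; exact: bnd.
- move=> a b b' ad bd bd'.
  have := @mvt_le _ (fun t => m (a, t)) (fun t => mv (a, t)) b' b 0 (`|mv z0| + 1).
  rewrite mul0r subr0; apply.
    move=> t tb; have td := dist_between bd' bd tb.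
    have [gz Vz _ _] := box _ _ ad td; have [_ dd] := dm _ gz Vz.
    exact/is_derive_v.
  move=> t tb; have td := dist_between bd' bd tb.
  by have [_ _ _ h1] := box _ _ ad td; rewrite subr0; exact: bnd.
pose c t := (t, y t) : R * R.
have inI t : x0 - rr < t < x0 + rr -> `|t - x0| < rr.
  by rewrite ltr_distl.
have gc t : x0 - rr < t < x0 + rr -> good (c t) /\ Re (V (c t)) != 0.
  move=> /inI tr; have [yd _] := yP _ tr.
  by have [] := box t (y t) (le_trans (ltW tr) rd) yd.
have dy t : x0 - rr < t < x0 + rr -> is_derive t 1 y (m (c t)).
  by move=> /inI tr; have [_] := yP _ tr.
have jcE t : x0 - rr < t < x0 + rr -> jc J (1, m (c t)) = V (c t) / (Re (V (c t)))%:C.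
  move=> tr; have [_ Vz] := gc _ tr; rewrite /m; move: (V (c t)) Vz => v v0.
  apply: eq_ReIm; rewrite -fmorphV /jc !ReImE J0; first by field.
  rewrite mul0r !add0r mulr0 add0r mulrA J2 mul1r //.
have dc t : x0 - rr < t < x0 + rr -> is_derive t 1 c (1, m (c t)).
  by move=> tr; have h1 := dy _ tr; exact: (pair_is_derive (is_derive_id t 1) h1).
have x0I : x0 - rr < x0 < x0 + rr by rewrite gtrBl ltrDl r0.
have ab : x0 - rr < x0 + rr by have /andP[] := x0I; exact: lt_trans.
have nI t : x0 - rr < t < x0 + rr -> \forall u \near t, x0 - rr < u < x0 + rr.
  move=> tr; have : t \in `](x0 - rr), (x0 + rr)[ by rewrite in_itv.
  by move=> /near_in_itvoo; apply: filterS => u; rewrite in_itv.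
have dc1 t : x0 - rr < t < x0 + rr -> derive1 c t = (1, m (c t)).
  by move=> tr; have h1 := dc _ tr; rewrite derive1E derive_val.
have cl : curvature_line S X n (x0 - rr) (x0 + rr) c.
  move=> t tr; have [gz Vz] := gc _ tr; have [Sz Pz rz] := gz.
  split=> //.
  - by have [] := dc _ tr.
  - have cc : {for t, continuous (fun u => (1, m (c u)) : R * R)}.
      have h1 := dy _ tr; have yc : {for t, continuous y}.
        by apply: differentiable_continuous; apply/derivable1_diffP.
      have [cm _] := dm _ gz Vz.
      have cm' := continuous_pair_comp cm (@cvg_id _ (nbhs t)) yc.
      exact: (cvg_pair (@cst_continuous _ _ (1 : R) t) cm').
    rewrite /prop_for /continuous_at (dc1 _ tr); apply: cvg_trans cc.
    by apply: near_eq_cvg; apply: filterS (nI _ tr) => u /dc1.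
  - rewrite (dc1 _ tr); apply: (@principal_of_real _ (V (c t)) s) => //; last exact: jcE.
    have := F2 _ gz; rewrite /V => FE.
    transitivity (P (c t) * (F (c t) * F (c t))); first by field; exact: f_neq0.
    by rewrite FE mulrC divfK.
have [Pl aPl XPl] := planar ab cl.
have [a [dd [b [ab0 Pleq]]]] := affine_plane_eq aPl.
have [XE _ _ dl] := dataS.
(* The derivative of [a l + Re (b W)] along [V] is [Re ((a h + b) f V)], and [f V = F]; hence
   [Psi]. *)
pose k z := a%:C * h z + b.
pose Psi z := k z * F z.
have dk z : S z -> cdiff J k z (a%:C * (P z * f z)).
  move=> Sz; apply: (cdiff_eq (cdiffD (cdiffM (cdiff_cst J a%:C z) (dh Sz)) (cdiff_cst J b z))).
  by rewrite mul0r add0r addr0.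
have dPsi z : good z -> cdiff J Psi z (a%:C * (P z * f z) * F z + k z * (phi z * f z)).
  by move=> gz; have [Sz _ _] := gz; exact: (cdiffM (dk _ Sz) (dF _ gz)).
(* The velocity of the curve is [V] divided by the real number [Re V], a factor that drops out of
   the equation. *)
have along (G G1 : R * R -> R[i]) : (forall z, good z -> cdiff J G z (G1 z)) ->
    (forall t, x0 - rr < t < x0 + rr -> Re (G (c t)) = 0) ->
    forall t, x0 - rr < t < x0 + rr -> Re (G1 (c t) * V (c t)) = 0.
  move=> dG G0 t tr; have [gz Vz] := gc _ tr.
  have [h1 _] := cdiff_curve (is_derive_id t 1) (dy _ tr) (dG _ gz).
  have := deriv_along_zero (dg := fun t => Re (G1 (c t) * jc J (1, m (c t)))) tr G0 h1.
  rewrite /= jcE // mulrA -fmorphV ReM ReC ImC mulr0 subr0 => /eqP.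
  by rewrite mulf_eq0 invr_eq0 (negbTE Vz) orbF => /eqP.
have E0 t : x0 - rr < t < x0 + rr -> Re (Psi (c t)) = 0.
  move=> tr; have [gz Vz] := gc _ tr; have [Sz Pz rz] := gz.
  have h1 := is_diff_curve (is_derive_id t 1) (dy _ tr) (dl _ Sz).
  have [h2 _] := cdiff_curve (is_derive_id t 1) (dy _ tr) (cdiffM (cdiff_cst J b _) (dW Sz)).
  have h3 := is_deriveB (is_deriveD (is_deriveZ a h1) h2) (is_derive_cst dd t 1).
  have z1 : forall u, x0 - rr < u < x0 + rr ->
     (a *: (fun u => l (u, y u)) + (fun u => Re (b * W (u, y u))) - cst dd) u = 0.
    move=> u ur; have [[Su _ _] _] := gc _ ur; rewrite !fctE scaleE.
    by apply/eqP; rewrite subr_eq0; apply/eqP; apply: Pleq; rewrite -(XE (c u)) //; exact: XPl.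
  have e1 : a * Re (h (c t) * f (c t) * jc J (1, m (c t))) +
      Re ((0 * W (c t) + b * f (c t)) * jc J (1, m (c t))) = 0.
    exact: etrans (esym (subr0 _)) (deriv_along_zero (dg := fun=> _) tr z1 h3).
  rewrite mul0r add0r jcE // in e1.
  have : Re ((k (c t) * f (c t)) * V (c t)) * (Re (V (c t)))^-1 = 0.
    rewrite -e1 -/(c t) /k; move: (V (c t)) (h (c t)) (f (c t)) Vz => v hh ff v0.
    by rewrite -fmorphV !ReImE; ring.
  move/eqP; rewrite mulf_eq0 invr_eq0 (negbTE Vz) orbF => /eqP <-.
  by congr Re; rewrite /Psi /V; field; exact: f_neq0.
(* Here [P F^2 = s] removes [P] and [f] from the derivative of [Psi] along [V]; [phi] is the
   derivative of [F] with respect to [W]. *)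
have E1V t : x0 - rr < t < x0 + rr ->
    (a%:C * (P (c t) * f (c t)) * F (c t) + k (c t) * (phi (c t) * f (c t))) * V (c t) =
    a%:C * s%:C + Psi (c t) * phi (c t).
  move=> tr; have [gz Vz] := gc _ tr; have [Sz Pz rz] := gz; have := F2 _ gz => FE.
  transitivity (a%:C * (P (c t) * (F (c t) * F (c t))) + Psi (c t) * phi (c t)).
    by rewrite /Psi /V; field; exact: f_neq0.
  by rewrite FE; congr (_ * _ + _); rewrite mulrC divfK.
have E1 t : x0 - rr < t < x0 + rr -> Re (a%:C * s%:C + Psi (c t) * phi (c t)) = 0.
  by move=> tr; rewrite -E1V //; exact: (along _ _ dPsi E0).
have E2 t : x0 - rr < t < x0 + rr -> Re ((a%:C * s%:C + Psi (c t) * phi (c t)) * phi (c t) +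
    Psi (c t) * (phi1 (c t) * V (c t))) = 0.
  move=> tr; have [gz Vz] := gc _ tr.
  have := along (fun z => a%:C * s%:C + Psi z * phi z) _ _ E1 _ tr.
  move=> /(_ (fun z => (a%:C * (P z * f z) * F z + k z * (phi z * f z)) * phi z + Psi z * phi1 z)).
  rewrite mulrDl -[X in Re (X + _)]mulrAC E1V // -mulrA; apply => z gz'.
  apply: (cdiff_eq (cdiffD (cdiff_cst J _ z) (cdiffM (dPsi _ gz') (dphi _ gz')))).
  by rewrite add0r.
have c0 : c x0 = z0 by rewrite /c yx0.
have := planarity_algebra s0 (E0 _ x0I) (E1 _ x0I) (E2 _ x0I); rewrite c0.
(* If [a = 0], the plane still has [b] nonzero, and [Psi z0 = b q] with [q] nonzero. *)
have ka : Psi z0 = 0 -> a != 0.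
  move=> P0'; apply/eqP => a0; case: ab0 => [/eqP//|/negP[]].
  move/eqP: P0'; rewrite /Psi /k a0 mul0r add0r mulf_eq0 F0 => /orP[//|/eqP q00].
  by move: q0; rewrite q00 mul0r Re0 eqxx.
move=> /(_ ka).
have -> : phi1 z0 * V z0 + phi z0 ^+ 2 / 2 =
    s%:C * ((7 * P1 z0 ^+ 2 - 4 * P z0 * P2 z0) / (8 * P z0 ^+ 3)).
  transitivity (F z0 * F z0 * ((7 * P1 z0 ^+ 2 - 4 * P z0 * P2 z0) / (8 * P z0 ^+ 2))).
    by rewrite /phi1 /V /phi; field; rewrite P0 f_neq0.
  by rewrite F2 //; field.
move: (_ / _) => C; rewrite ImM mul0r addr0 => /eqP; rewrite mulf_eq0 (negbTE s0) /=.
by move/eqP.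
Qed.

End PlanarCurvatureLines.

(** * Vanishing of the Hopf differential *)

Section Dichotomy.
Variable R : realType.
Implicit Types (z w : R * R).

(** Up to the first zero [t0] of [y] the function [expR (K * t) * y t] does not decrease, so it
    cannot reach 0. The bound at [t] is demanded only when [y] is positive on all of [[0, t]],
    because for the Hopf differential it depends on the whole way from the starting point. *)
Lemma gronwall_pos (y dy : R -> R) (K : R) :
  (forall t : R, 0 <= t <= 1 -> is_derive t 1 y (dy t)) -> 0 < y 0 ->
  (forall t : R, 0 <= t <= 1 -> (forall s : R, 0 <= s <= t -> 0 < y s) -> `|dy t| <= K * y t) ->
  0 < y 1.
Proof.
move=> yd y0 yK; rewrite ltNge; apply/negP => y1.
pose A := [set t : R | 0 <= t <= 1 /\ y t <= 0].
have A1 : A 1 by split => //; rewrite ler01 lexx.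
have A0 : lbound A 0 by move=> t [/andP[]].
have hA : has_inf A by split; [exists 1|exists 0].
pose t0 := inf A.
have t00 : 0 <= t0 by apply: lb_le_inf => //; exists 1.
have t01 : t0 <= 1 by apply: ge_inf => //; exists 0.
have pos s : 0 <= s < t0 -> 0 < y s.
  move=> /andP[s0 st]; rewrite ltNge; apply/negP => ys.
  have : t0 <= s by apply: ge_inf; [exists 0|split=> //; rewrite s0 (le_trans (ltW st))].
  by rewrite leNgt st.
have yt0 : y t0 <= 0.
  rewrite leNgt; apply/negP => yt.
  have [yder _] : is_derive t0 1 y (dy t0) by apply: yd; rewrite t00.
  have cy : {for t0, continuous y}.
    by apply: differentiable_continuous; apply/derivable1_diffP.
  move/cvgrPdist_lt : cy => /(_ _ yt) /nbhs_ballP[d /= d0 dP].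
  have [s [sA ys] st] := inf_adherent d0 hA.
  have ts : t0 <= s by apply: ge_inf => //; exists 0.
  have := dP s; rewrite /ball /= distrC ger0_norm ?subr_ge0 // ltrBlDl => /(_ st).
  move=> h; have := le_lt_trans (ler_norm _) h; lra.
have t0p : 0 < t0.
  by rewrite lt_neqAle t00 andbT; apply: contraTneq y0 => e0; rewrite -leNgt [X in y X]e0.
have [|c /andP[c0 ct]] := @mvt _ (fun t => expR (K * t) * y t)
    (fun t => expR (K * t) * K * y t + expR (K * t) * dy t) _ _ t0p.
  move=> t /andP[h0 h1]; have yt : is_derive t 1 y (dy t) by apply: yd; rewrite h0 (le_trans h1).
  have ds : is_derive t 1 (fun s : R => K * s) K.
    by apply: (is_derive_eq (is_deriveZ K (is_derive_id t 1))); rewrite scaleE mulr1.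
  have de := is_derive1_comp (is_derive_expR (K * t)) ds.
  by apply: (is_derive_eq (is_deriveM de yt)); rewrite !scaleE /=; ring.
rewrite mulr0 expR0 mul1r subr0 => e.
have pc : 0 < y c by apply: pos; rewrite ltW.
have h : `|dy c| <= K * y c.
  apply: yK; first by rewrite ltW //= (le_trans (ltW ct)).
  by move=> s /andP[s0 sc]; apply: pos; rewrite s0 (le_lt_trans sc).
have h2 : 0 <= K * y c + dy c by have := ler_norm (- dy c); rewrite normrN; lra.
have h3 : 0 <= expR (K * t0) * y t0 - y 0.
  rewrite e; apply: mulr_ge0 => //.
  by rewrite -mulrA -mulrDr mulr_ge0 // expR_ge0.
have h4 : expR (K * t0) * y t0 <= 0 by rewrite mulr_ge0_le0 // expR_ge0.
by lra.
Qed.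

Lemma normc2X (x : R[i]) k : normc2 (x ^+ k) = normc2 x ^+ k.
Proof. by elim: k => [|k IH]; rewrite ?expr0 ?exprS ?normc2M ?IH // /normc2 Re1 Im1; ring. Qed.

Lemma normc2D_le (x y : R[i]) : normc2 (x + y) <= 2 * normc2 x + 2 * normc2 y.
Proof.
rewrite /normc2 !ReImE; have := sqr_ge0 (Re x - Re y); have := sqr_ge0 (Im x - Im y).
by rewrite !expr2; lra.
Qed.

Lemma segment_bound (g : R * R -> R) z1 z2 :
  (forall t : R, 0 <= t <= 1 -> {for (z1.1 + t * (z2.1 - z1.1), z1.2 + t * (z2.2 - z1.2)), continuous g}) ->
  exists M, forall t : R, 0 <= t <= 1 -> g (z1.1 + t * (z2.1 - z1.1), z1.2 + t * (z2.2 - z1.2)) <= M.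
Proof.
move=> cg.
have [|c _ cP] := @EVT_max R (fun t => g (z1.1 + t * (z2.1 - z1.1), z1.2 + t * (z2.2 - z1.2))) 0 1 ler01.
  apply: continuous_subspace_itv => t; rewrite in_itv /= => t01.
  apply: continuous_pair_comp; first exact: cg.
    by apply: differentiable_continuous; apply/derivable1_diffP; have [] := segment_derive z1.1 (z2.1 - z1.1) t.
  by apply: differentiable_continuous; apply/derivable1_diffP; have [] := segment_derive z1.2 (z2.2 - z1.2) t.
by eexists => t t01; apply: cP; rewrite in_itv.
Qed.

Variables (S : set (R * R)) (J : R[i]) (f P P1 P2 P3 : R * R -> R[i]).
Hypothesis domS : domain S.
Hypothesis J_unit : imaginary_unit J.
Hypothesis cf : forall z, S z -> ccont f z.
Hypothesis dP : forall z, S z -> cdiff J P z (P1 z * f z).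
Hypothesis dP1 : forall z, S z -> cdiff J P1 z (P2 z * f z).
Hypothesis dP2 : forall z, S z -> cdiff J P2 z (P3 z * f z).
Let C z := (7 * P1 z ^+ 2 - 4 * P z * P2 z) / (8 * P z ^+ 3).
Hypothesis C_real : forall z, S z -> P z != 0 -> Im (C z) = 0.

(** [C] is real near [z], so its complex derivative multiplied by any direction is real; the
    directions 1 and [J] leave only 0. *)
Lemma curvature_quotient_cdiff z : S z -> P z != 0 -> cdiff J C z 0.
Proof.
move=> Sz Pz.
have [C1 dC] : exists C1, cdiff J C z C1.
  have p3 : 8 * (P z * (P z * P z)) != 0 by rewrite !mulf_neq0 ?pnatr_eq0.
  have -> : C = fun y => (7 * (P1 y * P1 y) - 4 * (P y * P2 y)) * (8 * (P y * (P y * P y)))^-1.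
    by apply/funext => y; rewrite /C; congr (_ / _); ring.
  have d1 := dP1 Sz; have d := dP Sz; have d2 := dP2 Sz.
  eexists; exact (cdiffM (cdiffB (cdiffM (cdiff_cst J 7 z) (cdiffM d1 d1))
    (cdiffM (cdiff_cst J 4 z) (cdiffM d d2)))
    (cdiffV p3 (cdiffM (cdiff_cst J 8 z) (cdiffM d (cdiffM d d))))).
have nC : \forall w \near z, Im (C w) = 0.
  have [B nB BP] := ratio_near Pz (cdiff_ccont (dP Sz)); have Bz := nbhs_singleton nB.
  have nS : \forall w \near z, S w by apply: open_nbhs_nbhs; split => //; have [] := domS.
  apply: filterS (filterI nB nS) => w [Bw Sw]; apply: C_real => //.
  by have := BP _ _ Bw Bz; apply: contraTneq => ->; rewrite mul0r Re0 ltxx.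
have [_ dIm] := dC.
have dIm0 : is_diff z (fun w => Im (C w)) (fun=> 0).
  by apply: (@is_diff_near _ _ _ (cst 0)); apply: filterS nC => w.
have E w : Im (C1 * jc J w) = 0.
  have a := is_diff_derive w dIm; have b := is_diff_derive w dIm0.
  by rewrite -(@derive_val _ _ _ _ _ _ _ a) (@derive_val _ _ _ _ _ _ _ b).
have [J0 J1] := J_unit.
apply: (cdiff_eq dC); apply: eq_ReIm; last by have := E (e_u R); rewrite jcu mulr1.
have := E (e_v R); rewrite jcv ImM J0 mulr0 addr0 => /eqP; rewrite mulf_eq0.
by case: J1 => ->; rewrite ?oppr_eq0 oner_eq0 orbF => /eqP.
Qed.

(** Substituting [P2] from [C = c], the [W]-derivative of [D = P1^2 - 8 c P^3] becomes
    [7 P1 D / (2 P)], so the logarithmic derivatives of [D^2] and [P^7] coincide. *)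
Lemma energy_cdiff (c : R[i]) z : S z -> P z != 0 -> C z = c ->
  cdiff J (fun y => (P1 y ^+ 2 - 8 * c * P y ^+ 3) ^+ 2 / P y ^+ 7) z 0.
Proof.
move=> Sz Pz Cz.
pose D y := P1 y * P1 y - 8 * c * (P y * (P y * P y)).
pose Q y := P y * (P y * P y) * (P y * (P y * (P y * P y))).
have -> : (fun y => (P1 y ^+ 2 - 8 * c * P y ^+ 3) ^+ 2 / P y ^+ 7) =
    fun y => D y * D y * (Q y)^-1.
  by apply/funext => y; rewrite /D /Q; congr (_ / _); ring.
have d1 := dP1 Sz; have d := dP Sz.
have dD := cdiffB (cdiffM d1 d1) (cdiffM (cdiff_cst J (8 * c) z) (cdiffM d (cdiffM d d))).
have Q0 : Q z != 0 by rewrite /Q !mulf_neq0.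
have dQ := cdiffM (cdiffM d (cdiffM d d)) (cdiffM d (cdiffM d (cdiffM d d))).
apply: (cdiff_eq (cdiffM (cdiffM dD dD) (cdiffV Q0 dQ))).
have P2E : P2 z = (7 * P1 z ^+ 2 - 8 * c * P z ^+ 3) / (4 * P z).
  by rewrite -Cz /C; field; rewrite Pz.
by rewrite P2E /D /Q; field; rewrite Pz.
Qed.

(** The values of [c] and [e] at [z1] persist exactly as far as [P] has had no zero since [z1],
    which is what the conditional bound in [gronwall_pos] allows for. The bounding constant is
    computed from these initial values and from bounds of [P] and [f] on the segment. *)
Lemma nonvanishing_segment z1 z2 :
  (forall t : R, 0 <= t <= 1 -> S (z1.1 + t * (z2.1 - z1.1), z1.2 + t * (z2.2 - z1.2))) ->
  P z1 != 0 -> P z2 != 0.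
Proof.
move=> segS P0.
set v := (z2.1 - z1.1, z2.2 - z1.2) : R * R.
pose g t : R * R := (z1.1 + t * (z2.1 - z1.1), z1.2 + t * (z2.2 - z1.2)).
have g0 : g 0 = z1 by rewrite /g !mul0r !addr0; case: z1 {segS P0 v g}.
have g1 : g 1 = z2 by rewrite /g !mul1r ![_ + (_ - _)]addrC !subrK; case: z2 {segS v g g0}.
have curve (G : R * R -> R[i]) d t : cdiff J G (g t) d ->
    is_derive t 1 (fun s => Re (G (g s))) (Re (d * jc J v)) /\
    is_derive t 1 (fun s => Im (G (g s))) (Im (d * jc J v)).
  by move=> dG; exact: (cdiff_curve (segment_derive _ _ _) (segment_derive _ _ _) dG).
have const (G : R * R -> R[i]) (t : R) : 0 <= t ->
    (forall s, 0 <= s <= t -> cdiff J G (g s) 0) -> G (g t) = G z1.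
  rewrite le_eqVlt => /orP[/eqP <-|t0] dG; first by rewrite g0.
  by apply: eq_ReIm; apply/eqP; rewrite -subr_eq0 -g0; apply/eqP;
    [have [s _ ->] := mvt t0 (fun s st => (curve _ _ _ (dG s st)).1)
    |have [s _ ->] := mvt t0 (fun s st => (curve _ _ _ (dG s st)).2)];
    rewrite mul0r ?Re0 ?Im0 mul0r.
have cn (G : R * R -> R[i]) z : ccont G z -> {for z, continuous (fun y => normc2 (G y))}.
  by move=> [c1 c2]; apply: (cont_ext _ (continuousD (continuousM c1 c1) (continuousM c2 c2))) => y;
    rewrite /normc2 !fctE !expr2.
have [M MP] : exists M, forall t : R, 0 <= t <= 1 -> normc2 (P (g t)) <= M.
  by apply: (@segment_bound (fun z => normc2 (P z))) => t t01; apply: cn; apply: cdiff_ccont (dP (segS _ t01)).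
have [B BP] : exists B, forall t : R, 0 <= t <= 1 -> normc2 (f (g t)) <= B.
  by apply: (@segment_bound (fun z => normc2 (f z))) => t t01; apply: cn; apply: cf (segS _ t01).
pose c := C z1.
pose e := (P1 z1 ^+ 2 - 8 * c * P z1 ^+ 3) ^+ 2 / P z1 ^+ 7.
have I0 : 0 <= (0 : R) <= 1 by rewrite lexx ler01.
have M0 : 0 <= M := le_trans (normc2_ge0 _) (MP _ I0).
have B0 : 0 <= B := le_trans (normc2_ge0 _) (BP _ I0).
(* From [D^2 = e P^7] and [normc2 P <= M]: the seventh power of [normc2 P] is at most [M^3] times
   the fourth, whence [normc2 D <= s * normc2 P ^+ 2]. *)
pose s := Num.sqrt (normc2 e * M ^+ 3).
have s0 : 0 <= s := sqrtr_ge0 _.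
have s2 : s ^+ 2 = normc2 e * M ^+ 3 by rewrite sqr_sqrtr // mulr_ge0 ?normc2_ge0 // exprn_ge0.
(* From [P1^2 = D + 8 c P^3], with 128 = 2 * 64 and 64 the squared modulus of 8; it gives
   [normc2 P1 <= K1 * normc2 P]. *)
pose K1 := Num.sqrt (2 * s + 128 * normc2 c * M).
have K10 : 0 <= K1 := sqrtr_ge0 _.
have K12 : K1 ^+ 2 = 2 * s + 128 * normc2 c * M.
  by rewrite sqr_sqrtr // addr_ge0 // ?mulr_ge0 // normc2_ge0.
pose q := B * normc2 (jc J v).
have q0 : 0 <= q by rewrite mulr_ge0 ?normc2_ge0.
(* By the Cauchy-Schwarz inequality the square of the derivative of [normc2 P] is at most 4 times
   [normc2 P] times the squared modulus of the derivative of [P], itself at most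
   [K1 * normc2 P * q]. *)
pose K := Num.sqrt (4 * (K1 * q)).
have K2 : K ^+ 2 = 4 * (K1 * q) by rewrite sqr_sqrtr // mulr_ge0 // mulr_ge0.
rewrite -g1 -normc2_gt0.
apply: (@gronwall_pos (fun t => normc2 (P (g t)))
  (fun t => 2 * (Re (P (g t)) * Re (P1 (g t) * f (g t) * jc J v) +
     Im (P (g t)) * Im (P1 (g t) * f (g t) * jc J v))) K).
- move=> t t01; have [d1 d2] := curve _ _ _ (dP (segS _ t01)).
  apply: (is_derive_eq (is_deriveD (is_deriveM d1 d1) (is_deriveM d2 d2))).
  by rewrite !scaleE; ring.
- by rewrite g0 normc2_gt0.
move=> t t01 pos; have /andP[t0 t1] := t01.
have Sg r : 0 <= r <= t -> S (g r).
  by move=> /andP[r0 rt]; apply: segS; rewrite r0 (le_trans rt).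
have Pg r : 0 <= r <= t -> P (g r) != 0 by move=> /pos; rewrite normc2_gt0.
have CE r : 0 <= r <= t -> C (g r) = c.
  move=> /andP[r0 rt]; apply: const => // u /andP[u0 ur].
  by apply: curvature_quotient_cdiff; [apply: Sg|apply: Pg]; rewrite u0 (le_trans ur).
have tt : 0 <= t <= t by rewrite t0 lexx.
have EE : (P1 (g t) ^+ 2 - 8 * c * P (g t) ^+ 3) ^+ 2 = e * P (g t) ^+ 7.
  have -> : e = (P1 (g t) ^+ 2 - 8 * c * P (g t) ^+ 3) ^+ 2 / P (g t) ^+ 7.
    rewrite /e; symmetry.
    apply: (const (fun y => (P1 y ^+ 2 - 8 * c * P y ^+ 3) ^+ 2 / P y ^+ 7)) => // r rt.
    by apply: energy_cdiff; [exact: Sg|exact: Pg|exact: CE].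
  by rewrite divfK // expf_neq0 // Pg.
set p := P (g t) in EE *; set p1 := P1 (g t) in EE *.
have pM : normc2 p <= M by exact: MP.
have n0 := normc2_ge0 p.
pose D := p1 ^+ 2 - 8 * c * p ^+ 3.
have D2 : normc2 D ^+ 2 = normc2 e * normc2 p ^+ 7 by rewrite -!normc2X -normc2M -EE normc2X.
have Dle : normc2 D <= s * normc2 p ^+ 2.
  rewrite -(@ler_pXn2r _ 2%N) ?nnegrE ?normc2_ge0 ?mulr_ge0 ?sqr_ge0 //.
  rewrite D2 exprMn s2 -exprM -mulrA (exprD _ 3 4) ler_wpM2l ?normc2_ge0 //.
  by rewrite ler_wpM2r ?exprn_ge0 // lerXn2r // nnegrE.
have p1le : normc2 p1 <= K1 * normc2 p.
  rewrite -(@ler_pXn2r _ 2%N) ?nnegrE ?normc2_ge0 ?mulr_ge0 //.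
  rewrite exprMn K12 -normc2X.
  have -> : p1 ^+ 2 = D + 8 * c * p ^+ 3 by rewrite /D subrK.
  apply: (le_trans (normc2D_le _ _)).
  rewrite (normc2M (8 * c)) (normc2M 8 c) normc2X.
  have -> : normc2 (8 : R[i]) = 64.
    by rewrite -[8]/((8%:R)) -(rmorph_nat (real_complex R)) normc2C; ring.
  have h : normc2 p ^+ 3 <= M * normc2 p ^+ 2 by rewrite exprS ler_wpM2r ?sqr_ge0.
  have := ler_wpM2l (normc2_ge0 c) h; rewrite mulrA; move: Dle; lra.
rewrite -(@ler_pXn2r _ 2%N) ?nnegrE ?mulr_ge0 ?sqrtr_ge0 //.
rewrite real_normK ?num_real // [X in _ <= X]exprMn K2.
set d := p1 * f (g t) * jc J v.
have dle : normc2 d <= K1 * normc2 p * q.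
  rewrite /d !normc2M -mulrA; apply: ler_pM; rewrite ?mulr_ge0 ?normc2_ge0 //.
  by rewrite ler_wpM2r ?normc2_ge0 // BP.
have cs : (Re p * Re d + Im p * Im d) ^+ 2 <= normc2 p * normc2 d.
  have := sqr_ge0 (Re p * Im d - Im p * Re d); rewrite /normc2; move: (Re p) (Im p) (Re d) (Im d).
  by move=> x1 x2 x3 x4; rewrite !expr2 => h; rewrite -subr_ge0; apply: le_trans h _;
    rewrite le_eqVlt; apply/orP; left; apply/eqP; ring.
have := ler_wpM2l n0 dle.
have -> : (2 * (Re p * Re d + Im p * Im d)) ^+ 2 = 4 * (Re p * Re d + Im p * Im d) ^+ 2 by ring.
have -> : 4 * (K1 * q) * normc2 p ^+ 2 = 4 * (normc2 p * (K1 * normc2 p * q)) by ring.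
by lra.
Qed.

(** Any two points of a small square are joined by a segment inside it, traversed in either
    direction, so being nonzero is a locally constant property of [P]. *)
Lemma dichotomy : (forall z, S z -> P z = 0) \/ (forall z, S z -> P z != 0).
Proof.
have [oS cS _] := domS.
have [[z0 Sz0 P0]|all0] := pselect (exists2 z, S z & P z != 0); last first.
  by left=> z Sz; apply/eqP; apply/negPn/negP => Pz; apply: all0; exists z.
right=> z Sz.
apply: (@connected_near _ S (fun z => P z != 0) z0) => // -[x y] Sxy.
have [d d0 dS] : exists2 d : R, 0 < d & forall a b, `|a - x| < d -> `|b - y| < d -> S (a, b).
  by apply: near_box; exact: open_nbhs_nbhs.
have conv (a b t d' : R) : `|a| < d' -> `|b| < d' -> 0 <= t <= 1 -> `|a + t * (b - a)| < d'.
  rewrite !ltr_norml => /andP[a1 a2] /andP[b1 b2] /andP[t0 t1].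
  have t1' : 0 <= 1 - t by rewrite subr_ge0.
  case: (leP a b) => [ab|/ltW ba].
    have ab' : 0 <= b - a by rewrite subr_ge0.
    by have := mulr_ge0 t0 ab'; have := mulr_ge0 t1' ab'; rewrite mulrBl mul1r; lra.
  have ba' : 0 <= a - b by rewrite subr_ge0.
  have -> : t * (b - a) = - (t * (a - b)) by ring.
  by have := mulr_ge0 t0 ba'; have := mulr_ge0 t1' ba'; rewrite mulrBl mul1r; lra.
have seg (a b a' b' t : R) : `|a - x| < d -> `|b - y| < d -> `|a' - x| < d -> `|b' - y| < d ->
    0 <= t <= 1 -> S (a + t * (a' - a), b + t * (b' - b)).
  move=> h1 h2 h3 h4 t01; apply: dS.
    have -> : a + t * (a' - a) - x = (a - x) + t * ((a' - x) - (a - x)) by ring.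
    exact: conv.
  have -> : b + t * (b' - b) - y = (b - y) + t * ((b' - y) - (b - y)) by ring.
  exact: conv.
apply: (@box_near _ _ x y d) => // a b ax bY.
have xx : `|x - x| < d by rewrite subrr normr0.
have yy : `|y - y| < d by rewrite subrr normr0.
by split; apply: nonvanishing_segment => t t01; exact: seg.
Qed.

Lemma curvature_ode : (forall z, S z -> P z != 0) -> exists (c : R) (e : R[i]),
  (forall z, S z -> 4 * P z * P2 z = 7 * P1 z ^+ 2 - 8 * c%:C * P z ^+ 3) /\
  (forall z, S z -> (P1 z ^+ 2 - 8 * c%:C * P z ^+ 3) ^+ 2 = e * P z ^+ 7).
Proof.
move=> Pn; have [oS cS [z0 Sz0]] := domS.
pose E (c : R[i]) y := (P1 y ^+ 2 - 8 * c * P y ^+ 3) ^+ 2 / P y ^+ 7.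
have CE z : S z -> C z = C z0.
  move=> Sz; apply: (cdiff0_const oS cS _ Sz Sz0) => y Sy.
  by apply: curvature_quotient_cdiff => //; exact: Pn.
have cE : (Re (C z0))%:C = C z0.
  by apply: eq_ReIm => //; rewrite ImC C_real // Pn.
exists (Re (C z0)), (E (C z0) z0); rewrite cE; split=> z Sz; have Pz := Pn _ Sz.
  by rewrite -(CE _ Sz) /C; field.
rewrite -(@cdiff0_const _ J S (E (C z0)) oS cS _ _ _ Sz Sz0).
  by rewrite /E divfK // expf_neq0.
by move=> y Sy; apply: energy_cdiff => //; [exact: Pn|exact: CE].
Qed.

End Dichotomy.

(** * Uniqueness *)

Section Uniqueness.
Variable R : realType.
Implicit Types (z w : R * R).

(** [q], [q1], [q2] play for the model the roles of [P], [P1], [P2]. The derivative [f'] is recorded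
    because it makes [f] continuous and the regular points a neighbourhood of each of their
    points. *)
Definition jet_model (h f f' q q1 q2 : R[i] -> R[i]) := forall z, regular_points f z ->
  let Z := to_complex z in
  [/\ cdiff 'i%C (fun p => f (to_complex p)) z (f' Z),
      cdiff 'i%C (fun p => h (to_complex p)) z (q Z * f Z),
      cdiff 'i%C (fun p => q (to_complex p)) z (q1 Z * f Z)
    & cdiff 'i%C (fun p => q1 (to_complex p)) z (q2 Z * f Z)].

Lemma is_derive_coord (Y : R * R -> 'cV[R]_4) z v D i :
  is_derive z v Y D -> is_derive z v (fun y => Y y i 0) (D i 0).
Proof.
move=> [dY YE]; have dYi : derivable (fun y => Y y i 0) z v.
  by move/derivable_mxP : dY => /(_ i 0).
by apply: DeriveDef => //; rewrite -YE derive_mx // mxE.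
Qed.

(** An arbitrary surface with the given data has, by definition, only two directional derivatives at
    regular points; continuity of [f] and [h f] upgrades them to differentials. *)
Lemma weierstrass_diff h f f' q q1 q2 Y : jet_model h f f' q q1 q2 ->
  weierstrass_surface h f Y -> exists (l : R * R -> R) (W : R * R -> R[i]),
  forall z, regular_points f z -> [/\ Y z = pt (l z) (W z),
    cdiff 'i%C W z (f (to_complex z))
  & is_diff z l (fun w => Re (h (to_complex z) * f (to_complex z) * jc 'i%C w))].
Proof.
move=> jm wY.
pose l z := Y z (inord 0) 0.
pose W z := Complex (Y z (inord 1) 0) (Y z (inord 2) 0).
exists l, W => z rz.
have nr : \forall y \near z, regular_points f y.
  have [df _ _ _] := jm _ rz.
  have [B nB BP] := ratio_near (rz : (fun p => f (to_complex p)) z != 0) (cdiff_ccont df).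
  have Bz := nbhs_singleton nB; apply: filterS nB => y By.
  by have := BP _ _ By Bz; apply: contraTneq => ->; rewrite mul0r Re0 ltxx.
have [df dh _ _] := jm _ rz.
have [cf1 cf2] := cdiff_ccont df.
have [ch1 ch2] := ccontM (cdiff_ccont dh) (cdiff_ccont df).
have part k (F1 F2 : R * R -> R) :
    (forall y, regular_points f y -> is_derive y (e_u R) (fun y => Y y (inord k) 0) (F1 y) /\
       is_derive y (e_v R) (fun y => Y y (inord k) 0) (F2 y)) ->
    {for z, continuous F1} -> {for z, continuous F2} ->
    is_diff z (fun y => Y y (inord k) 0) (fun w => w.1 * F1 z + w.2 * F2 z).
  by move=> FF c1 c2; apply: C1_is_diff => //; apply: filterS nr => y /FF[].
have nc (g : R * R -> R) : {for z, continuous g} -> {for z, continuous (fun y => - g y)}.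
  exact: continuousN.
have iso0 a b c : iso_pt a b c (inord 0) 0 = a by have [] := ptE a (Complex b c).
have iso1 a b c : iso_pt a b c (inord 1) 0 = b by have [] := ptE a (Complex b c).
have iso2 a b c : iso_pt a b c (inord 2) 0 = c by have [] := ptE a (Complex b c).
split.
- by have [iso _ _] := wY _ rz; rewrite {1}(isotropicE iso).
- split.
    apply: (is_diff_ext (part 1%N (fun y => Re (f (to_complex y))) (fun y => - Im (f (to_complex y))) _ cf1 (nc _ cf2))).
      move=> y /wY[_ du dv]; have := is_derive_coord (inord 1) du; have := is_derive_coord (inord 1) dv.
      rewrite !iso1 => d1 d2; split; first exact: d2.
      by apply: (is_derive_eq d1); rewrite !ReImE ?Re_mk ?Im_mk; ring.
    by move=> w; rewrite /jc !ReImE /=; ring.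
  apply: (is_diff_ext (part 2%N (fun y => Im (f (to_complex y))) (fun y => Re (f (to_complex y))) _ cf2 cf1)).
    move=> y /wY[_ du dv]; have := is_derive_coord (inord 2) du; have := is_derive_coord (inord 2) dv.
    rewrite !iso2 => d1 d2.
    by split; [apply: (is_derive_eq d2)|apply: (is_derive_eq d1)]; rewrite !ReImE ?Re_mk ?Im_mk; ring.
  by move=> w; rewrite /jc !ReImE /=; ring.
- apply: (is_diff_ext (part 0%N (fun y => Re (h (to_complex y) * f (to_complex y)))
    (fun y => - Im (h (to_complex y) * f (to_complex y))) _ ch1 (nc _ ch2))).
    move=> y /wY[_ du dv]; have := is_derive_coord (inord 0) du; have := is_derive_coord (inord 0) dv.
    rewrite !iso0 => d1 d2; split; first exact: d2.
    by apply: (is_derive_eq d1); move: (_ * f _) => x; rewrite !ReImE ?Re_mk ?Im_mk; ring.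
  by move=> w; move: (_ * f _) => x; rewrite /jc !ReImE /=; ring.
Qed.

Lemma is_derive_fst_snd (V W1 W2 : normedModType R) (f : V -> W1 * W2) (z v : V) D :
  is_derive z v f D -> is_derive z v (fun y => (f y).1) D.1 /\
  is_derive z v (fun y => (f y).2) D.2.
Proof.
move=> [fD fE].
have c : (h^-1 *: ((f \o shift z) (h *: v) - f z)) @[h --> (0 : R)^'] --> D.
  by rewrite -fE; case/cvg_ex: fD => l fl; rewrite /derive (cvg_lim _ fl).
have cf : {for D, continuous (fst : W1 * W2 -> W1)}.
  by have [d _] := @is_diff_fst R W1 W2 D; exact: differentiable_continuous d.
have cs : {for D, continuous (snd : W1 * W2 -> W2)}.
  by have [d _] := @is_diff_snd R W1 W2 D; exact: differentiable_continuous d.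
have a : (h^-1 *: (((fun y => (f y).1) \o shift z) (h *: v) - (f z).1)) @[h --> (0 : R)^'] --> D.1.
  exact: (continuous_cvg _ cf c).
have b : (h^-1 *: (((fun y => (f y).2) \o shift z) (h *: v) - (f z).2)) @[h --> (0 : R)^'] --> D.2.
  exact: (continuous_cvg _ cs c).
by split; apply: DeriveDef; [apply/cvg_ex; exists D.1; exact: a
  |exact: (cvg_lim (@norm_hausdorff _ _) a)
  |apply/cvg_ex; exists D.2; exact: b|exact: (cvg_lim (@norm_hausdorff _ _) b)].
Qed.

Lemma smooth_pair_is_diff U (phi : R * R -> R * R) z : open U -> smooth_on U phi -> U z ->
  is_diff z phi (fun w => w.1 *: pd_u phi z + w.2 *: pd_v phi z).
Proof.
move=> oU s Uz; have nU : \forall y \near z, U y by exact: open_nbhs_nbhs.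
have [su sv] := smooth_pd s; have cu := su 0%N _ Uz; have cv := sv 0%N _ Uz.
have c1 (g : R * R -> R * R) : {for z, continuous g} -> {for z, continuous (fun y => (g y).1)}.
  have [d _] := @is_diff_fst R R R (g z).
  by move=> c; exact: (continuous_cvg _ (differentiable_continuous d) c).
have c2 (g : R * R -> R * R) : {for z, continuous g} -> {for z, continuous (fun y => (g y).2)}.
  have [d _] := @is_diff_snd R R R (g z).
  by move=> c; exact: (continuous_cvg _ (differentiable_continuous d) c).
have n1 : \forall y \near z, is_derive y (e_u R) (fun x => (phi x).1) (pd_u phi y).1 /\
    is_derive y (e_u R) (fun x => (phi x).2) (pd_u phi y).2.
  by apply: filterS nU => y Uy; have [du _] := Ck_derive (s 1%N) Uy; exact: is_derive_fst_snd.
have n2 : \forall y \near z, is_derive y (e_v R) (fun x => (phi x).1) (pd_v phi y).1 /\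
    is_derive y (e_v R) (fun x => (phi x).2) (pd_v phi y).2.
  by apply: filterS nU => y Uy; have [_ dv] := Ck_derive (s 1%N) Uy; exact: is_derive_fst_snd.
have d1 : is_diff z (fun y : R * R => (phi y).1) (fun w => w.1 * (pd_u phi z).1 + w.2 * (pd_v phi z).1) .
  exact: C1_is_diff (filterS (fun y => @proj1 _ _) n1) (filterS (fun y => @proj1 _ _) n2)
  (c1 _ cu) (c1 _ cv).
have d2 : is_diff z (fun y : R * R => (phi y).2) (fun w => w.1 * (pd_u phi z).2 + w.2 * (pd_v phi z).2) .
  exact: C1_is_diff (filterS (fun y => @proj2 _ _) n1) (filterS (fun y => @proj2 _ _) n2)
  (c2 _ cu) (c2 _ cv).
have E : (fun y => ((phi y).1, (phi y).2)) = phi by apply/funext => y; case: (phi y).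
have k := is_diff_pair d1 d2; rewrite E in k.
by apply: (is_diff_ext k) => w.
Qed.

Lemma eq_linear (J x y : R[i]) : imaginary_unit J ->
  (forall w, Re (x * jc J w) = Re (y * jc J w)) -> x = y.
Proof.
move=> [J0 J1] E; have := E (e_u R); have := E (e_v R); rewrite jcu jcv !mulr1 !ReM J0 !mulr0 !sub0r.
move=> /oppr_inj i r; apply: eq_ReIm => //; apply: (@mulIf _ (Im J)) => //.
by case: J1 => ->; rewrite ?oppr_eq0 oner_eq0.
Qed.

(** Converse of [piece_intro]. The reparametrization is a priori only smooth, but [W] equals [mu]
    times the second primitive at [phi] up to a constant, and comparing differentials forces [phi]
    to be complex differentiable for [J]. *)
Lemma piece_elim S X J l W f h h0 f0 f' q q1 q2 : domain S -> imaginary_unit J ->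
  surface_data S X J l W f h -> jet_model h0 f0 f' q q1 q2 ->
  piece_up_to_similarity S X h0 f0 ->
  exists (psi psi1 : R * R -> R[i]) (la : R) (mu ka : R[i]),
  [/\ la != 0, mu != 0 & forall z, S z -> [/\ f0 (psi z) != 0, cdiff J psi z (psi1 z),
    f z = mu * f0 (psi z) * psi1 z & mu * h z = la%:C * h0 (psi z) + ka]].
Proof.
move=> [oS _ _] J_unit [XE f_neq0 dW dl] jm [Y [F [phi [wY simF smphi _ XF]]]].
have [la [mu [ka [d [de [la0 nmu FE]]]]]] := similarity_formP simF.
have [lm [wm mP]] := weierstrass_diff jm wY.
have mu0 : mu != 0 by rewrite -normc2_gt0 nmu exprn_even_gt0.
pose psi1 z := to_complex (pd_u phi z).
exists (fun z => to_complex (phi z)), psi1, la, mu, ka; split => // z Sz.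
have [rz _] := XF _ Sz; have [_ dwm dlm] := mP _ rz.
have nS : \forall y \near z, S y by exact: open_nbhs_nbhs.
have dphi : is_diff z phi (fun w => w.1 *: pd_u phi z + w.2 *: pd_v phi z).
  exact: smooth_pair_is_diff oS smphi Sz.
set p := phi z in rz dwm dlm dphi *.
pose D w := to_complex (w.1 *: pd_u phi z + w.2 *: pd_v phi z).
have DE w : jc 'i%C (w.1 *: pd_u phi z + w.2 *: pd_v phi z) = D w by rewrite /D to_complexE.
have nE : \forall y \near z, l y = la * lm (phi y) + Re (ka * wm (phi y)) + d /\
    W y = mu * wm (phi y) + de.
  apply: filterS nS => y Sy; have [ry Xy] := XF _ Sy; have [YE _ _] := mP _ ry.
  move: Xy; rewrite YE FE XE // => E.
  have coord k := congr1 (fun M : 'cV[R]_4 => M (inord k) 0) E.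
  have [a0 a1 a2 _] := ptE (l y) (W y).
  have [b0 b1 b2 _] := ptE (la * lm (phi y) + Re (ka * wm (phi y)) + d) (mu * wm (phi y) + de).
  by split; [rewrite -b0 -a0; exact: coord|apply: eq_ReIm; rewrite -?a1 -?a2 -?b1 -?b2; exact: coord].
have f0p : f0 (to_complex p) != 0 by [].
have [w1 w2] := cdiffD (cdiffM (cdiff_cst 'i%C mu p) dwm) (cdiff_cst 'i%C de p).
have nW1 : \forall y \near z, ((fun p => Re (mu * wm p + de)) \o phi) y = Re (W y).
  by apply: filterS nE => y [_ ->].
have nW2 : \forall y \near z, ((fun p => Im (mu * wm p + de)) \o phi) y = Im (W y).
  by apply: filterS nE => y [_ ->].
have EW : forall w, f z * jc J w = mu * f0 (to_complex p) * D w.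
  move=> w; have [f1 f2] := dW _ Sz; apply: eq_ReIm.
    have k := is_diff_near nW1 (is_diff_comp dphi w1).
    have a := is_diff_derive w f1; have b := is_diff_derive w k.
    rewrite -(@derive_val _ _ _ _ _ _ _ a) (@derive_val _ _ _ _ _ _ _ b) /= DE.
    by congr Re; ring.
  have k := is_diff_near nW2 (is_diff_comp dphi w2).
  have a := is_diff_derive w f2; have b := is_diff_derive w k.
  rewrite -(@derive_val _ _ _ _ _ _ _ a) (@derive_val _ _ _ _ _ _ _ b) /= DE.
  by congr Im; ring.
have fE : f z = mu * f0 (to_complex p) * psi1 z.
  by have := EW (e_u R); rewrite jcu mulr1 => ->; rewrite /D /= scale1r scale0r addr0.
have muf : mu * f0 (to_complex p) != 0 by rewrite mulf_neq0.
(* The real differential of [phi] is multiplication by [psi1 z], because [mu f0] is invertible. *)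
have DJ w : D w = psi1 z * jc J w.
  by apply: (mulfI muf); rewrite -EW fE; ring.
split=> //.
  have [c1 c2] := cdiff_to_complex p.
  split; [have k := is_diff_comp dphi c1|have k := is_diff_comp dphi c2];
    by apply: (is_diff_ext k) => w; rewrite -DJ -DE -[jc 'i%C _]mul1r.
have [v1 _] := cdiffM (cdiff_cst 'i%C ka p) dwm.
have kl := is_diff_comp dphi (is_diffD (is_diffD (is_diffZ la dlm) v1) (is_diff_cst d p)).
have nl : \forall y \near z, ((la *: lm + (fun y => Re (ka * wm y)) + cst d) \o phi) y = l y.
  by apply: filterS nE => y [-> _].
have k := is_diff_near nl kl.
have psi10 : psi1 z != 0.
  by have := f_neq0 _ Sz; rewrite fE mulf_eq0 negb_or => /andP[].
apply: (mulIf (mulf_neq0 f0p psi10)).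
apply: (eq_linear J_unit) => w.
have a := is_diff_derive w (dl _ Sz); have b := is_diff_derive w k.
transitivity (Re (h z * f z * jc J w)); first by rewrite fE; congr Re; ring.
rewrite -(@derive_val _ _ _ _ _ _ _ a) (@derive_val _ _ _ _ _ _ _ b) /= !fctE scaleE DE DJ.
rewrite [X in _ + X = _](_ : _ = 0) // addr0.
have lC x : la * Re x = Re (la%:C * x) by rewrite ReM ReC ImC mul0r subr0.
by rewrite lC -ReD; congr Re; ring.
Qed.

End Uniqueness.

(** * Invariants of the Weierstrass data *)

Section Jets.
Variable R : realType.
Implicit Types (z w : R * R) (p : R[i]).

(** For jets that obey the structure equations, [7 p1^2 - 4 p p2 = 8 c p^3] and
    [3 p1^2 - 2 p p2 = - (p1^2 - 8 c p^3) / 2]. So for [p] nonzero the two quadratic tests detect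
    [c = 0] and [e = 0], and when [c = 0] the latter reduces to [p1 = 0]. *)
Definition jet_class p p1 p2 : surface_type :=
  if p == 0 then plane
  else if 7 * p1 ^+ 2 == 4 * p * p2 then (if p1 == 0 then trivial_enneper else enneper)
  else if 3 * p1 ^+ 2 == 2 * p * p2 then catenoid else bonnet.

Lemma jet_class_scale p p1 p2 (a b c : R[i]) : a != 0 -> b != 0 -> c != 0 -> b ^+ 2 = a * c ->
  jet_class (a * p) (b * p1) (c * p2) = jet_class p p1 p2.
Proof.
move=> a0 b0 c0 E.
have scale k m : (k * (b * p1) ^+ 2 == m * (a * p) * (c * p2)) = (k * p1 ^+ 2 == m * p * p2).
  rewrite -(inj_eq (mulfI (mulf_neq0 a0 c0)) (k * p1 ^+ 2)); congr (_ == _); last by ring.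
  by rewrite exprMn E; ring.
by rewrite /jet_class !scale !mulf_eq0 ?(negbTE a0) ?(negbTE b0).
Qed.

Lemma cdiff_near_uniq S J (G F : R * R -> R[i]) z d d' : open S -> S z ->
  (forall y, S y -> G y = F y) -> cdiff J G z d -> cdiff J F z d' -> d = d'.
Proof.
move=> oS Sz E dG; apply: cdiff_uniq; apply: cdiff_near dG.
have : \forall y \near z, S y by exact: open_nbhs_nbhs.
by apply: filterS.
Qed.

Lemma piece_jets S X J l W f h h0 f0 f' q q1 q2 (P P1 P2 : R * R -> R[i]) :
  domain S -> imaginary_unit J -> surface_data S X J l W f h ->
  (forall z, S z -> cdiff J h z (P z * f z)) ->
  (forall z, S z -> cdiff J P z (P1 z * f z)) ->
  (forall z, S z -> cdiff J P1 z (P2 z * f z)) ->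
  jet_model h0 f0 f' q q1 q2 -> piece_up_to_similarity S X h0 f0 ->
  exists a b c : R[i], [/\ a != 0, b != 0, c != 0, b ^+ 2 = a * c &
    forall z, S z -> exists2 p, f0 p != 0 &
      [/\ P z = a * q p, P1 z = b * q1 p & P2 z = c * q2 p]].
Proof.
move=> domS J_unit dataS dh dP dP1 jm piece; have [oS _ _] := domS.
have [psi [psi1 [la [mu [ka [la0 mu0 psiP]]]]]] := piece_elim domS J_unit dataS jm piece.
have laC : la%:C != 0 :> R[i] by rewrite real_complex_neq0.
exists (la%:C / mu ^+ 2), (la%:C / mu ^+ 3), (la%:C / mu ^+ 4).
(* Since [f = mu f0 psi1], a derivative with respect to [W] is one in the model divided by [mu];
   each differentiation contributes one such factor. *)
have chain (k k' : R[i] -> R[i]) z : S z ->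
    (forall p : R * R, regular_points f0 p -> cdiff 'i%C (fun y => k (to_complex y)) p (k' (to_complex p) * f0 (to_complex p))) ->
    cdiff J (fun y => k (psi y)) z (k' (psi z) * mu^-1 * f z).
  move=> Sz dk; have [r0 dpsi fE _] := psiP _ Sz.
  have dk' := dk (to_pair (psi z)); rewrite /regular_points /= to_complexK in dk'.
  apply: (cdiff_eq (cdiff_comp (dk' r0) dpsi)); rewrite fE; field.
  exact: mu0.
have [_ f_neq0 _ _] := dataS.
have E0 z : S z -> P z = la%:C / mu ^+ 2 * q (psi z).
  move=> Sz; apply: (mulIf (f_neq0 _ Sz)); apply: (mulfI mu0).
  have E y : S y -> mu * h y = la%:C * h0 (psi y) + ka by move=> /psiP[].
  have d1 := cdiffM (cdiff_cst J mu z) (dh _ Sz).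
  have d2 := cdiffD (cdiffM (cdiff_cst J la%:C z) (chain h0 q z Sz (fun (p : R * R) r => let: And4 _ a _ _ := jm p r in a)))
    (cdiff_cst J ka z).
  have := cdiff_near_uniq oS Sz E d1 d2; rewrite !mul0r !add0r addr0 => ->.
  by field.
have E1 z : S z -> P1 z = la%:C / mu ^+ 3 * q1 (psi z).
  move=> Sz; apply: (mulIf (f_neq0 _ Sz)).
  have d2 := cdiffM (cdiff_cst J (la%:C / mu ^+ 2) z) (chain q q1 z Sz (fun (p : R * R) r => let: And4 _ _ a _ := jm p r in a)).
  rewrite (cdiff_near_uniq oS Sz E0 (dP _ Sz) d2); by field.
have E2 z : S z -> P2 z = la%:C / mu ^+ 4 * q2 (psi z).
  move=> Sz; apply: (mulIf (f_neq0 _ Sz)).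
  have d2 := cdiffM (cdiff_cst J (la%:C / mu ^+ 3) z) (chain q1 q2 z Sz (fun (p : R * R) r => let: And4 _ _ _ a := jm p r in a)).
  rewrite (cdiff_near_uniq oS Sz E1 (dP1 _ Sz) d2); by field.
split; rewrite ?mulf_neq0 ?invr_eq0 ?expf_neq0 //; first by field.
by move=> z Sz; exists (psi z); [have [] := psiP _ Sz|split; [exact: E0|exact: E1|exact: E2]].
Qed.

Lemma cdiff_csinh_ccosh (a : R[i]) z :
  cdiff 'i%C (fun y => csinh (a * to_complex y / 2)) z (a / 2 * ccosh (a * to_complex z / 2)) /\
  cdiff 'i%C (fun y => ccosh (a * to_complex y / 2)) z (a / 2 * csinh (a * to_complex z / 2)).
Proof.
have d : cdiff 'i%C (fun y => a * to_complex y / 2) z (a / 2).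
  by apply: (cdiff_eq (cdiffM (cdiffM (cdiff_cst _ a z) (cdiff_to_complex z)) (cdiff_cst _ 2^-1 z))); ring.
have e1 := cdiff_cexp d; have e2 := cdiff_cexp (cdiffN d).
split; [apply: (cdiff_eq (cdiffM (cdiffB e1 e2) (cdiff_cst _ 2^-1 z)))
  |apply: (cdiff_eq (cdiffM (cdiffD e1 e2) (cdiff_cst _ 2^-1 z)))];
  by rewrite /csinh /ccosh; field.
Qed.

Lemma ccosh2 (x : R[i]) : ccosh x ^+ 2 = csinh x ^+ 2 + 1.
Proof. by rewrite /ccosh /csinh cexpN; field; rewrite cexp_neq0. Qed.

Lemma jet_models T (h f : R[i] -> R[i]) : weierstrass_data T h f ->
  exists f' q q1 q2, jet_model h f f' q q1 q2 /\
    forall p, f p != 0 -> jet_class (q p) (q1 p) (q2 p) = T.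
Proof.
case.
- exists (fun=> 0), (fun=> 0), (fun=> 0), (fun=> 0); split; last by move=> p _; rewrite /jet_class eqxx.
  by move=> z _; split; apply: (cdiff_eq (cdiff_cst _ _ _)); rewrite ?mul0r.
- exists (fun=> 0), (fun=> 1), (fun=> 0), (fun=> 0); split; last first.
    by move=> p _; rewrite /jet_class oner_eq0 expr0n /= !mulr0 !eqxx.
  move=> z _; split; try by apply: (cdiff_eq (cdiff_cst _ _ _)); rewrite ?mul0r.
  by rewrite mulr1; exact: cdiff_to_complex.
- pose e (x : R[i]) := cexp x.
  exists (fun x => - cexp (- x)), (fun x => e x * e x), (fun x => 2 * (e x * (e x * e x))),
    (fun x => 6 * (e x * e x * (e x * e x))); split; last first.
    move=> p _; rewrite /jet_class mulf_eq0 orbb (negbTE (cexp_neq0 _)) -subr_eq0.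
    have -> : 7 * (2 * (e p * (e p * e p))) ^+ 2 - 4 * (e p * e p) * (6 * (e p * e p * (e p * e p))) =
      4 * e p ^+ 6 by ring.
    rewrite mulf_eq0 pnatr_eq0 expf_eq0 /= (negbTE (cexp_neq0 _)).
    by rewrite ifT //; apply/eqP; ring.
  move=> z _; have d : cdiff 'i%C (fun y => e (to_complex y)) z (e (to_complex z)).
    by apply: (cdiff_eq (cdiff_cexp (cdiff_to_complex z))); rewrite mul1r.
  have e0 : e (to_complex z) != 0 by exact: cexp_neq0.
  split.
  + by apply: (cdiff_eq (cdiff_cexp (cdiffN (cdiff_to_complex z)))); rewrite mulN1r.
  + by apply: (cdiff_eq d); rewrite cexpN -/(e _); field.
  + by apply: (cdiff_eq (cdiffM d d)); rewrite cexpN -/(e _); field.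
  + by apply: (cdiff_eq (cdiffM (cdiff_cst _ 2 z) (cdiffM d (cdiffM d d)))); rewrite cexpN -/(e _); field.
- exists (fun x => 2 * x), (fun x => - (x * x * (x * x))^-1),
    (fun x => 4 * (x * x * (x * x) * (x * (x * x)))^-1),
    (fun x => - 28 * (x * x * (x * x) * (x * x * (x * x) * (x * x)))^-1); split; last first.
    move=> p; rewrite expf_eq0 /= => p0.
    have x0 : p * p * (p * p) != 0 by rewrite !mulf_neq0.
    have x1 : 4 * (p * p * (p * p) * (p * (p * p)))^-1 != 0.
      by rewrite mulf_neq0 ?pnatr_eq0 // invr_eq0 !mulf_neq0.
    rewrite /jet_class oppr_eq0 invr_eq0 (negbTE x0) (negbTE x1) ifT //.
    by apply/eqP; field.
  move=> z; rewrite /regular_points /= expf_eq0 /= => z0.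
  have d := cdiff_to_complex z; have zz : to_complex z * to_complex z * (to_complex z * to_complex z) != 0.
    by rewrite !mulf_neq0.
  have z7 : to_complex z * to_complex z * (to_complex z * to_complex z) *
     (to_complex z * (to_complex z * to_complex z)) != 0 by rewrite !mulf_neq0.
  have d4 := cdiffM (cdiffM d d) (cdiffM d d).
  split.
  + by apply: (cdiff_eq (cdiffM d d)); ring.
  + by apply: (cdiff_eq (cdiffM (cdiff_cst _ 1 z) (cdiffV z0 d))); field.
  + by apply: (cdiff_eq (cdiffN (cdiffV zz d4))); field.
  + by apply: (cdiff_eq (cdiffM (cdiff_cst _ 4 z) (cdiffV z7 (cdiffM d4 (cdiffM d (cdiffM d d)))))); field.
- move=> alpha beta al0 be0 a b.
  have a0 : a != 0 by rewrite eq_complex /= gt_eqF.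
  have b0 : b != 0 by rewrite eq_complex /= gt_eqF.
  (* Differentiation with respect to a primitive of [f] is [a^2 u^2 / (2 b)] times that in [z], so
     the iterated derivatives of [h] are polynomials in [s], [k] and [u]. *)
  pose s x : R[i] := csinh (a * x / 2); pose k x : R[i] := ccosh (a * x / 2).
  pose u x : R[i] := (s x)^-1.
  exists (fun x => 2 * b / a * (s x * k x)),
    (fun x => - (a ^+ 4 / (4 * b ^+ 2)) * (u x * u x * (u x * u x))),
    (fun x => a ^+ 7 / (4 * b ^+ 3) * (k x * (u x * u x * (u x * u x) * (u x * (u x * u x))))),
    (fun x => a ^+ 10 / (16 * b ^+ 4) * (s x ^+ 2 - 7 * k x ^+ 2) * (u x) ^+ 10); split; last first.
    move=> p; rewrite mulf_eq0 negb_or expf_eq0 /= -/(s p) => /andP[_ s0].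
    have k2 : k p ^+ 2 = s p ^+ 2 + 1 by exact: ccosh2.
    have u0 : u p != 0 by rewrite invr_eq0.
    have nz m : a ^+ m != 0 by exact: expf_neq0.
    have coef m n (x : R[i]) : x != 0 -> a ^+ m / (x * b ^+ n) != 0.
      move=> x0; apply: mulf_neq0; first exact: nz.
      by rewrite invr_eq0; apply: mulf_neq0; last exact: expf_neq0.
    have c4 : 4 != 0 :> R[i] by rewrite pnatr_eq0.
    have c16 : 16 != 0 :> R[i] by rewrite pnatr_eq0.
    have c32 : 32 != 0 :> R[i] by rewrite pnatr_eq0.
    have u4 : u p * u p * (u p * u p) != 0 by rewrite !mulf_neq0.
    set Q := - _ * _; set Q1 := _ * _; set Q2 := _ * _.
    have Q0 : Q != 0 by apply: (mulf_neq0 _ u4); rewrite oppr_eq0; exact: (coef 4%N 2%N 4 c4).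
    have E7 : 7 * Q1 ^+ 2 - 4 * Q * Q2 = a ^+ 14 / (16 * b ^+ 6) * (s p ^+ 2 * u p ^+ 14).
      by rewrite /Q /Q1 /Q2; field.
    have E3 : 3 * Q1 ^+ 2 - 2 * Q * Q2 = - (a ^+ 14 / (32 * b ^+ 6)) * u p ^+ 14.
      transitivity (- (a ^+ 14 / (32 * b ^+ 6)) * ((k p ^+ 2 - s p ^+ 2) * u p ^+ 14)).
        by rewrite /Q /Q1 /Q2; field.
      by rewrite k2 addrAC subrr add0r mul1r.
    have n7 : 7 * Q1 ^+ 2 - 4 * Q * Q2 != 0.
      by rewrite E7; apply: mulf_neq0; [exact: (coef 14%N 6%N 16 c16)|apply: mulf_neq0; exact: expf_neq0].
    have n3 : 3 * Q1 ^+ 2 - 2 * Q * Q2 != 0.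
      by rewrite E3; apply: mulf_neq0; [rewrite oppr_eq0; exact: (coef 14%N 6%N 32 c32)|exact: expf_neq0].
    clearbody Q Q1 Q2.
    by move: n7 n3; rewrite !subr_eq0 /jet_class (negbTE Q0) => /negbTE -> /negbTE ->.
  move=> z; rewrite /regular_points /= mulf_eq0 negb_or expf_eq0 /= -/(s (to_complex z)) => /andP[_ s0].
  have [ds dk] := cdiff_csinh_ccosh a z.
  rewrite -/(s (to_complex z)) -/(k (to_complex z)) in ds dk.
  have k2 : k (to_complex z) ^+ 2 = s (to_complex z) ^+ 2 + 1 by exact: ccosh2.
  have du : cdiff 'i%C (fun y => u (to_complex y)) z (- (a / 2 * k (to_complex z)) * u (to_complex z) ^+ 2).
    by apply: (cdiff_eq (cdiffV s0 ds)); rewrite /u exprVn.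
  have du2 := cdiffM du du; have du4 := cdiffM du2 du2.
  have uE : u (to_complex z) = (s (to_complex z))^-1 by [].
  split.
  + have -> : (fun y => 2 * b / a ^+ 2 * csinh (a * to_complex y / 2) ^+ 2) =
        fun y => 2 * b / a ^+ 2 * (s (to_complex y) * s (to_complex y)).
      by apply/funext => y; rewrite expr2.
    by apply: (cdiff_eq (cdiffM (cdiff_cst _ (2 * b / a ^+ 2) z) (cdiffM ds ds))); rewrite -/(s (to_complex z)); field.
  + have -> : (fun y => a / b * ccoth (a * to_complex y / 2)) =
        fun y => a / b * (k (to_complex y) * u (to_complex y)) by [].
    apply: (cdiff_eq (cdiffM (cdiff_cst _ (a / b) z) (cdiffM dk du))).
    rewrite -/(s (to_complex z)) -/(k (to_complex z)) uE.
    transitivity (- (a ^+ 2 / (2 * b)) * ((k (to_complex z) ^+ 2 - s (to_complex z) ^+ 2) / s (to_complex z) ^+ 2)).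
      by field; rewrite b0 s0.
    by rewrite k2; field; rewrite a0 b0 s0.
  + apply: (cdiff_eq (cdiffM (cdiff_cst _ (- (a ^+ 4 / (4 * b ^+ 2))) z) du4)).
    by rewrite -/(s (to_complex z)) -/(k (to_complex z)) uE; field; rewrite a0 b0 s0.
  + apply: (cdiff_eq (cdiffM (cdiff_cst _ (a ^+ 7 / (4 * b ^+ 3)) z) (cdiffM dk (cdiffM du4 (cdiffM du du2))))).
    by rewrite -/(s (to_complex z)) -/(k (to_complex z)) uE; field; rewrite a0 b0 s0.
Qed.

End Jets.

(** * Classification *)

Section Classification.
Variable R : realType.
Implicit Types (G : R * R -> R[i]).

(** Iterated from [h], this provides [P], [P1], [P2] and also [P3]; the last one makes [C], which
    contains [P2], differentiable. *)
Lemma hol_quotient_deriv S (J : R[i]) f G : open S -> (forall z, S z -> f z != 0) ->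
  (forall k, hol J S k f) -> (forall k, hol J S k G) ->
  exists2 G1, forall z, S z -> cdiff J G z (G1 z * f z) & forall k, hol J S k G1.
Proof.
move=> oS f0 hf hG; have [G1 G1P _] := hG 1%N.
exists (fun z => G1 z * (f z)^-1) => [z Sz|k].
  by apply: (cdiff_eq (G1P _ Sz)); rewrite divfK // f0.
  by apply: holM; [exact: (hol_deriv oS (hG k.+1) G1P)|exact: holV].
Qed.

Variables (S : set (R * R)) (X n : R * R -> 'cV[R]_4) (omega : R * R -> R).
Hypothesis domS : domain S.
Hypothesis immX : spacelike_immersion S X.
Hypothesis confX : conformal_coordinates S X omega.
Hypothesis gaussX : lightlike_gauss_map S X n.
Hypothesis zmcX : zero_mean_curvature S X n omega.

Let openS : open S := let: And3 a _ _ := domS in a.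

Lemma classification_exists : simply_connected S -> planar_curvature_lines S X n ->
  exists T h0 f0, weierstrass_data T h0 f0 /\ piece_up_to_similarity S X h0 f0.
Proof.
move=> scS planarX.
have [J [l [W [f [h [h1 [J_unit dataS hol3 dh1 formE]]]]]]] :=
  surface_structure domS immX confX gaussX zmcX.
have [_ f0 _ _] := dataS.
have hW k : hol J S k W by have [] := hol3 k.
have hf k : hol J S k f by have [] := hol3 k.
have hh k : hol J S k h by have [] := hol3 k.
have [P dh hP] := hol_quotient_deriv openS f0 hf hh.
have [P1 dP hP1] := hol_quotient_deriv openS f0 hf hP.
have [P2 dP1 hP2] := hol_quotient_deriv openS f0 hf hP1.
have [P3 dP2 _] := hol_quotient_deriv openS f0 hf hP2.
have h1E z : S z -> h1 z = P z * f z by move=> Sz; exact: (cdiff_uniq (dh1 _ Sz) (dh _ Sz)).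
have [f1 df _] := hf 1%N.
have cf1 : hol J S 0 f1 := hol_deriv openS (hf 1%N) df.
have cf z : S z -> ccont f z by move=> Sz; exact: cdiff_ccont (df _ Sz).
have C_real z : S z -> P z != 0 -> Im ((7 * P1 z ^+ 2 - 4 * P z * P2 z) / (8 * P z ^+ 3)) = 0.
  apply: (curvature_real openS J_unit dataS _ _ _ _ planarX df dh dP dP1 cf1) => y Sy;
    by have [] := formE _ Sy; rewrite ?h1E.
have [P0|P0] := dichotomy domS J_unit cf dP dP1 dP2 C_real.
  by exists plane; exact: (plane_case domS J_unit dataS hW dh P0).
have [c [e [ode eE]]] := curvature_ode domS J_unit dP dP1 dP2 C_real P0.
have [e0|e0] := eqVneq e 0.
  have P1E z : S z -> P1 z ^+ 2 = 8 * c%:C * P z ^+ 3.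
    by move=> Sz; apply/eqP; rewrite -subr_eq0 -sqrf_eq0 eE // e0 mul0r.
  have [c0|c0] := eqVneq c 0; last first.
    by exists catenoid; exact: (catenoid_case domS J_unit dataS hf hP hP1 dh P0 dP dP1 ode scS c0 P1E).
  have [p pE] : exists p, forall z, S z -> P z = p.
    apply: (constant_on (J := J) domS) => z Sz; apply: (cdiff_eq (dP _ Sz)).
    have : P1 z == 0 by rewrite -sqrf_eq0 P1E // c0 mulr0 mul0r.
    by move/eqP ->; rewrite mul0r.
  have [z0 Sz0] : S !=set0 by case: domS.
  have p0 : p != 0 by rewrite -(pE _ Sz0) P0.
  by exists trivial_enneper; exact: (trivial_enneper_case domS J_unit dataS hW dh p0 pE).
have [c0|c0] := eqVneq c 0.
  exists enneper; apply: (enneper_case domS J_unit dataS hP hP1 dh P0 dP dP1 ode c0 e0) => z Sz.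
  by rewrite -eE // c0 mulr0 mul0r subr0 -exprM.
by exists bonnet; exact: (bonnet_case domS J_unit dataS hW hP hP1 dh P0 dP dP1 ode c0 e0 eE).
Qed.

Lemma classification_uniq T T' h0 f0 h0' f0' :
  weierstrass_data T h0 f0 -> piece_up_to_similarity S X h0 f0 ->
  weierstrass_data T' h0' f0' -> piece_up_to_similarity S X h0' f0' -> T = T'.
Proof.
have [J [l [W [f [h [h1 [J_unit dataS hol3 _ _]]]]]]] :=
  surface_structure domS immX confX gaussX zmcX.
have [_ f_neq0 _ _] := dataS.
have hf k : hol J S k f by have [] := hol3 k.
have hh k : hol J S k h by have [] := hol3 k.
have [P dh hP] := hol_quotient_deriv openS f_neq0 hf hh.
have [P1 dP hP1] := hol_quotient_deriv openS f_neq0 hf hP.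
have [P2 dP1 _] := hol_quotient_deriv openS f_neq0 hf hP1.
have [z0 Sz0] : S !=set0 by case: domS.
have classE T0 k0 g0 : weierstrass_data T0 k0 g0 -> piece_up_to_similarity S X k0 g0 ->
    jet_class (P z0) (P1 z0) (P2 z0) = T0.
  move=> /jet_models[f' [q [q1 [q2 [jm qT]]]]] piece.
  have [a [b [c [a0 b0 c0 abc]]]] := piece_jets domS J_unit dataS dh dP dP1 jm piece.
  move=> /(_ _ Sz0)[p p0 [-> -> ->]].
  by rewrite jet_class_scale // qT.
by move=> d p d' p'; rewrite -(classE _ _ _ d p) -(classE _ _ _ d' p').
Qed.

End Classification.

Theorem theorem3p13 (R : realType) (Sigma : set (R * R))
    (X n : R * R -> 'cV[R]_4) (omega : R * R -> R) :
  domain Sigma -> simply_connected Sigma ->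
  spacelike_immersion Sigma X ->
  conformal_coordinates Sigma X omega ->
  lightlike_gauss_map Sigma X n ->
  zero_mean_curvature Sigma X n omega ->
  planar_curvature_lines Sigma X n ->
  exists! T : surface_type, exists h f : R[i] -> R[i],
    weierstrass_data T h f /\ piece_up_to_similarity Sigma X h f.
Proof.
move=> domS scS immX confX gaussX zmcX planarX.
have [T [h [f [dT pT]]]] := classification_exists domS immX confX gaussX zmcX scS planarX.
exists T; split; first by exists h, f.
move=> T' [h' [f' [dT' pT']]].
exact: (classification_uniq domS immX confX gaussX zmcX dT pT dT' pT').
Qed.
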